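(* Let $\Omega=(0,1)$, $T>0$, $Q=(0,T)\times\Omega$. Assume $0<\alpha<2$ and $n>2+\frac{2}{\alpha+1}$. Let $u_0\in H^{\alpha/2}(\Omega)$ be nonnegative with $\int_\Omega G(u_0)\,dx<\infty$, and let $u$ be a constructed solution with initial data $u_0$ (as defined in the context). Then there exists a set $P\subset(0,T)$ such that $|(0,T)\setminus P|=0$ and, for all $t\in P$, $u(t,\cdot)\in C^{0,\beta}(\Omega)$ for all $\beta<\min\{1,\frac{\alpha+1}{2}\}$ and $u(t,\cdot)$ is strictly positive in $\Omega$. Furthermore, $u$ is a solution of $$u_t+\partial_xJ=0\quad\text{in }\mathcal{D}'(Q),$$ where $$J(t,\cdot)=u^n\,\partial_xI(u)\in L^1(\Omega)\quad\text{for all }t\in P.$$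
   Context: Let $\{\lambda_k,\varphi_k\}_{k\geq0}$ be the eigenvalues and $L^2(\Omega)$-normalized eigenfunctions of the Neumann Laplacian on $\Omega=(0,1)$. For $s\ge0$, $H^s_N(\Omega)=\{u=\sum_k c_k\varphi_k:\sum_k c_k^2(1+\lambda_k^s)<\infty\}$ with homogeneous semi-norm $\|u\|^2_{\dot H^s_N(\Omega)}=\sum_kc_k^2\lambda_k^s$; for $0\le s<3/2$, $H^s_N(\Omega)=H^s(\Omega)$ and $\|\cdot\|_{\dot H^s(\Omega)}=\|\cdot\|_{\dot H^s_N(\Omega)}$. The operator $I=-(-\Delta)^{\alpha/2}$ is $I\big(\sum_kc_k\varphi_k\big)=-\sum_kc_k\lambda_k^{\alpha/2}\varphi_k$, acting in $x$. $G(s)=\int_1^s\int_1^r t^{-n}\,dt\,dr$ for $s>0$, $G(0)=\lim_{s\to0^+}G(s)\in[0,+\infty]$, $G(s)=+\infty$ for $s<0$. For $\epsilon>0$ set $f_\epsilon(s)=s_+^n+\epsilon$, where $s_+=\max\{0,s\}$, and $G_\epsilon(s)=\int_1^s\int_1^t\frac{1}{f_\epsilon(r)}\,dr\,dt$. Regularized solutions: for $\epsilon>0$, $u^\epsilon\in L^\infty(0,T;H^{\alpha/2}(\Omega))\cap L^2(0,T;H^{\alpha+1}_N(\Omega))$ satisfies $$\iint_Q u^\epsilon\partial_t\varphi\,dx\,dt+\iint_Q f_\epsilon(u^\epsilon)\,\partial_xI(u^\epsilon)\,\partial_x\varphi\,dx\,dt=-\int_\Omega u_0\varphi(0,\cdot)\,dx$$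 for all $\varphi\in C^1([0,T);H^1(\Omega))$ with compact support in $[0,T)\times\bar\Omega$, and for almost every $t\in(0,T)$: $\int_\Omega u^\epsilon(t)\,dx=\int_\Omega u_0\,dx$; $\|u^\epsilon(t)\|^2_{\dot H^{\alpha/2}(\Omega)}+2\int_0^t\int_\Omega f_\epsilon(u^\epsilon)(\partial_xI(u^\epsilon))^2\,dx\,ds\le\|u_0\|^2_{\dot H^{\alpha/2}(\Omega)}$; $\int_\Omega G_\epsilon(u^\epsilon(t))\,dx+\int_0^t\|u^\epsilon(s)\|^2_{\dot H^{\frac\alpha2+1}_N(\Omega)}\,ds\le\int_\Omega G_\epsilon(u_0)\,dx$. Constructed solution: a nonnegative $u\in L^\infty(0,T;H^{\alpha/2}(\Omega))\cap L^2(0,T;H^{\frac\alpha2+1}_N(\Omega))$ which is the limit, along a sequence $\epsilon\to0$, of such regularized solutions $u^\epsilon$ (almost everywhere in $Q$; in $C^0(0,T;L^p(\Omega))$ for all $p<\frac{2}{1-\alpha}$, i.e. all $p<\infty$ if $\alpha=1$, when $\alpha\le1$; locally uniformly when $\alpha>1$), and which satisfies: (i) $\iint_Q u\,\partial_t\varphi-\iint_Q nu^{n-1}\partial_xu\,I(u)\,\partial_x\varphi-\iint_Q u^nI(u)\,\partial_{xx}^2\varphi=-\int_\Omega u_0\varphi(0,\cdot)\,dx$ for all smooth $\varphi$ compactly supported in $[0,T)\times\bar\Omega$ with $\partial_x\varphi=0$ on $(0,T)\times\partial\Omega$; (ii) for a.e. $t\in(0,T)$, $\int_\Omega u(t)\,dx=\int_\Omega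 u_0\,dx$; (iii) for a.e. $t\in(0,T)$, $\|u(t)\|^2_{\dot H^{\alpha/2}(\Omega)}+2\int_0^t\int_\Omega g^2\,dx\,ds\le\|u_0\|^2_{\dot H^{\alpha/2}(\Omega)}$, where $g\in L^2(Q)$ satisfies $g=\partial_x(u^{n/2}I(u))-\frac n2u^{\frac{n-2}2}\partial_xu\,I(u)$ in $\mathcal{D}'(Q)$; (iv) for a.e. $t\in(0,T)$, $\int_\Omega G(u(t))\,dx+\int_0^t\|u(s)\|^2_{\dot H^{\frac\alpha2+1}_N(\Omega)}\,ds\le\int_\Omega G(u_0)\,dx$. *)

(* Defs.v *)
From HB Require Import structures.
From mathcomp Require Import all_boot all_order all_algebra.
From mathcomp Require Import all_classical all_reals all_analysis.
From mathcomp Require Import measurable_realfun ring.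

Set Implicit Arguments.
Unset Strict Implicit.
Unset Printing Implicit Defensive.
Import Order.TTheory GRing.Theory Num.Theory.
Import numFieldNormedType.Exports.
Local Open Scope classical_set_scope.
Local Open Scope ring_scope.

(* Functions of (t, x) are curried, u : R -> R -> R, and stand for their class
   modulo Lebesgue-null sets; the statements below do not depend on the choice
   of the representative. *)

Notation leb R := (@lebesgue_measure R).
Notation leb2 R := (@lebesgue_measure R \x @lebesgue_measure R)%E.

Section Domains.
Context {R : realType}.

Definition Omega : set R := `]0%R, 1%R[.
Definition Omegabar : set R := `[0%R, 1%R].
Definition cyl (T : R) : set (R * R) := `]0%R, T[ `*` Omega.
Definition cyl0 (T : R) : set (R * R) := `[0%R, T[ `*` Omegabar.

(* "for almost every t in (0,T)" *)
Definition ae_time (T : R) (P : R -> Prop) : Prop :=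
  {ae leb R, forall t : R, 0 < t < T -> P t}.

Definition measurable2 (D : set (R * R)) (F : R -> R -> R) : Prop :=
  measurable_fun D (fun p => F p.1 p.2).

Definition integrable2 (D : set (R * R)) (F : R -> R -> R) : Prop :=
  (leb2 R).-integrable D (fun p => (F p.1 p.2)%:E).

Definition Rint2 (D : set (R * R)) (F : R -> R -> R) : R :=
  \int[leb2 R]_(p in D) F p.1 p.2.

Definition locally_integrable2 (D : set (R * R)) (F : R -> R -> R) : Prop :=
  measurable2 D F /\
  forall K : set (R * R), compact K -> K `<=` D -> integrable2 K F.

Definition LpO (p : \bar R) (f : R -> R) : \bar R :=
  Lnorm (leb R) p (EFin \o (f \_ Omega)).

Definition inLpO (p : \bar R) (f : R -> R) : Prop :=
  measurable_fun Omega f /\ (LpO p f < +oo)%E.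

End Domains.

Section TestFunctions.
Context {R : realType}.

(* Only the values of f on A matter; for A = [0,T) x [0,1], f may be nonzero
   at t = 0 and at x = 0, 1. *)
Definition compactly_supported_in (X : topologicalType) (A : set X)
    (f : X -> R) : Prop :=
  exists K : set X, [/\ compact K, K `<=` A &
    forall p, A p -> ~ K p -> f p = 0].

Definition smooth1 (f : R -> R) : Prop :=
  forall k x, derivable (derive1n k f) x 1.

Definition Dt (f : R -> R -> R) (t x : R) : R := derive1 (fun s => f s x) t.
Definition Dx (f : R -> R -> R) (t x : R) : R := derive1 (f t) x.

(* C^oo(R^2): every iterated partial derivative, in any order, is continuous
   and has partial derivatives. *)
Definition smooth2 (f : R -> R -> R) : Prop :=
  forall s : seq bool,
    let g := foldr (fun (b : bool) h => if b then Dt h else Dx h) f s in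
    continuous (fun p : R * R => g p.1 p.2) /\
    forall t x : R, derivable (fun r => g r x) t 1 /\ derivable (g t) x 1.

Definition test1 (psi : R -> R) : Prop :=
  smooth1 psi /\ compactly_supported_in Omega psi.

Definition test2 (A : set (R * R)) (phi : R -> R -> R) : Prop :=
  smooth2 phi /\ compactly_supported_in A (fun p => phi p.1 p.2).

(* w = v' in D'(0,1) *)
Definition weak_deriv (v w : R -> R) : Prop :=
  [/\ locally_integrable Omega v, locally_integrable Omega w &
    forall psi, test1 psi ->
      \int[leb R]_(x in Omega) (v x * derive1 psi x) =
      - \int[leb R]_(x in Omega) (w x * psi x)].

(* w = d_x v, as functions on (0,T) x (0,1) *)
Definition is_dx (T : R) (v w : R -> R -> R) : Prop :=
  measurable2 (cyl T) w /\ ae_time T (fun t => weak_deriv (v t) (w t)).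

(* v in H^1(0,1), with derivative dv *)
Definition H1 (v dv : R -> R) : Prop :=
  [/\ inLpO 2%:E v, inLpO 2%:E dv & weak_deriv v dv].

(* The H^1-norm of f, given its derivative df (up to equivalence of norms) *)
Definition H1norm (f df : R -> R) : \bar R :=
  (LpO 2%:E f + LpO 2%:E df)%E.

(* phi in C^1([0,T); H^1(0,1)) with compact support in [0,T) x [0,1], where
   phit, phix and phitx are its derivatives d_t phi, d_x phi and d_x d_t phi.
   The measurability clauses select representatives for which the integrals
   over (0,T) x (0,1) make sense. *)
Definition testH1 (T : R) (phi phit phix phitx : R -> R -> R) : Prop :=
  [/\ (forall t : R, 0 <= t < T -> H1 (phi t) (phix t) /\ H1 (phit t) (phitx t)),
      (forall t : R, 0 <= t < T ->
        H1norm (fun x => (phi s x - phi t x) / (s - t) - phit t x)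
               (fun x => (phix s x - phix t x) / (s - t) - phitx t x)
          @[s --> within `[0%R, T[ (dnbhs t)] --> 0%E),
      (forall t : R, 0 <= t < T ->
        H1norm (fun x => phit s x - phit t x) (fun x => phitx s x - phitx t x)
          @[s --> within `[0%R, T[ (nbhs t)] --> 0%E),
      measurable2 (cyl T) phit /\ measurable2 (cyl T) phix &
      compactly_supported_in (cyl0 T) (fun p => phi p.1 p.2)].

End TestFunctions.

Section NeumannSpectral.
Context {R : realType}.

Definition eigval (k : nat) : R := (k%:R * pi) ^+ 2.
Definition eigfun (k : nat) (x : R) : R :=
  if k == 0%N then 1 else Num.sqrt 2 * cos (k%:R * pi * x).

Lemma sin_natpi (k : nat) : sin (k%:R * pi) = 0 :> R.
Proof.
elim: k => [|k IH]; first by rewrite mul0r sin0.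
by rewrite -natr1 mulrDl mul1r sinDpi IH oppr0.
Qed.

Lemma derive1_cosM (c a x : R) :
  derive1 (fun y => c * cos (a * y)) x = - (c * a * sin (a * x)).
Proof.
rewrite derive1E derive_val.
by rewrite /GRing.scale /=; ring.
Qed.

Lemma derive1_sinM (c a x : R) :
  derive1 (fun y => - (c * sin (a * y))) x = - (c * a * cos (a * x)).
Proof.
rewrite derive1E derive_val.
by rewrite /GRing.scale /=; ring.
Qed.

Lemma eigfun_eqn (k : nat) (x : R) :
  derive1n 2 (eigfun k) x = - (eigval k * eigfun k x).
Proof.
rewrite /eigfun /eigval /=; case: eqP => [->|_].
  rewrite (_ : derive1 _ = cst 0) ?derive1_cst ?mul0r ?expr0n ?mul0r ?oppr0 //.
  by apply/funext => y; rewrite derive1_cst.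
rewrite (_ : derive1 (fun y => Num.sqrt 2 * _) =
    fun y => - (Num.sqrt 2 * (k%:R * pi) * sin (k%:R * pi * y))); last first.
  by apply/funext => y; exact: derive1_cosM.
by rewrite [LHS]derive1_sinM; ring.
Qed.

Lemma eigfun_bc (k : nat) :
  derive1 (eigfun k) 0 = 0 /\ derive1 (eigfun k) 1 = 0.
Proof.
rewrite /eigfun; case: eqP => _; first by split; exact: derive1_cst.
by split; rewrite [LHS]derive1_cosM ?mulr0 ?mulr1 ?sin0 ?sin_natpi mulr0 oppr0.
Qed.

Lemma eigfun_norm (k : nat) :
  \int[leb R]_(x in Omega) (eigfun k x ^+ 2) = 1.
Proof.
case: (posnP k) => [->|k0].
  rewrite /eigfun eqxx; under eq_Rintegral do rewrite expr1n.
  rewrite /Rintegral integral_cst; last exact: measurable_itv.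
  rewrite mul1e /Omega [X in fine X]lebesgue_measure_itv /= lte_fin ltr01.
  by rewrite -EFinB subr0.
have a0 : k%:R * pi != 0 :> R.
  by rewrite mulf_neq0 ?pnatr_eq0 ?gt_eqF// ?pi_gt0//.
pose F (x : R) := x + (k%:R * pi)^-1 * (sin (k%:R * pi * x) * cos (k%:R * pi * x)).
have dF (x : R) : is_derive x 1 F (eigfun k x ^+ 2).
  apply: is_derive_eq; rewrite /eigfun gtn_eqF// /GRing.scale /=.
  rewrite exprMn sqr_sqrtr ?ler0n//.
  have := cos2Dsin2 (k%:R * pi * x); set s := sin _; set c := cos _ => cs.
  by rewrite mulr1 -[X in X + _]cs; move: (k%:R * pi) a0 => a a0; field.
have cF (x : R) : {for x, continuous F}.
  by apply: differentiable_continuous; apply/derivable1_diffP; case: (dF x).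
have ce (x : R) : {for x, continuous (fun x => eigfun k x ^+ 2)}.
  rewrite /eigfun gtn_eqF//; apply: differentiable_continuous.
  by apply/derivable1_diffP.
have cw : {within `[0, 1], continuous (fun x : R => eigfun k x ^+ 2)}.
  exact: continuous_subspaceT.
have me : measurable_fun setT (fun x : R => eigfun k x ^+ 2).
  exact: continuous_measurable_fun.
rewrite /Rintegral /Omega -(@integral_itv_bndoo _ _ _ _ true false); last first.
  by apply/measurable_EFinP; exact: measurable_funTS.
rewrite (@continuous_FTC2 _ _ F)//.
- by rewrite /F /= mulr0 mulr1 sin0 sin_natpi !mul0r !mulr0 !addr0 subr0.
- split.
  + by move=> x _; have [] := dF x.
  + by apply: cvg_at_right_filter; exact: cF.
  + by apply: cvg_at_left_filter; exact: cF.
- by move=> x _; rewrite derive1E; have [_ ->] := dF x.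
Qed.

Definition coef (v : R -> R) (k : nat) : R :=
  \int[leb R]_(x in Omega) (v x * eigfun k x).

(* v = \sum_k c_k phi_k, with convergence in L^2(0,1) *)
Definition expands (c : nat -> R) (v : R -> R) : Prop :=
  inLpO 2%:E v /\
  LpO 2%:E (fun x => v x - \sum_(k < N) c k * eigfun k x)
    @[N --> \oo] --> 0%E.

Definition hnorm2 (s : R) (v : R -> R) : \bar R :=
  (\sum_(0 <= k <oo) (coef v k ^+ 2 * (1 + eigval k `^ s))%:E)%E.

Definition hdot2 (s : R) (v : R -> R) : \bar R :=
  (\sum_(0 <= k <oo) (coef v k ^+ 2 * eigval k `^ s)%:E)%E.

(* For 0 <= s < 3/2 this is also H^s(0,1). *)
Definition HsN (s : R) (v : R -> R) : Prop :=
  expands (coef v) v /\ (hnorm2 s v < +oo)%E.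

(* w = I(v) = - (- Delta)^(alpha/2) v *)
Definition fracI (alpha : R) (v w : R -> R) : Prop :=
  expands (fun k => - (coef v k * eigval k `^ (alpha / 2))) w.

(* w = I(v), as functions on (0,T) x (0,1), I acting in x *)
Definition is_I (T alpha : R) (v w : R -> R -> R) : Prop :=
  measurable2 (cyl T) w /\ ae_time T (fun t => fracI alpha (v t) (w t)).

Definition Linf_HsN (T s : R) (u : R -> R -> R) : Prop :=
  [/\ measurable2 (cyl T) u, ae_time T (fun t => HsN s (u t)) &
      exists C : R, ae_time T (fun t => (hnorm2 s (u t) <= C%:E)%E)].

Definition L2_HsN (T s : R) (u : R -> R -> R) : Prop :=
  [/\ measurable2 (cyl T) u, ae_time T (fun t => HsN s (u t)) &
      (\int[leb R]_(t in `]0%R, T[) hnorm2 s (u t) < +oo)%E].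

End NeumannSpectral.

Section Entropies.
Context {R : realType}.

(* \int_a^b f, also for b < a *)
Definition oriented_int (f : R -> R) (a b : R) : R :=
  \int[leb R]_(x in `[a, b]) f x - \int[leb R]_(x in `[b, a]) f x.

Definition Gpos (n s : R) : R :=
  oriented_int (fun r => oriented_int (fun t => t `^ (- n)) 1 r) 1 s.

Definition G (n s : R) : \bar R :=
  if 0 < s then (Gpos n s)%:E
  else if s == 0 then lim ((Gpos n r)%:E @[r --> 0^'+])
  else +oo%E.

Definition feps (n eps s : R) : R := Num.max 0 s `^ n + eps.

Definition Geps (n eps s : R) : R :=
  oriented_int (fun t => oriented_int (fun r => (feps n eps r)^-1) 1 t) 1 s.

End Entropies.

Section Solutions.
Context {R : realType}.

Definition same_mass (T : R) (u0 : R -> R) (u : R -> R -> R) : Prop :=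
  ae_time T (fun t =>
    \int[leb R]_(x in Omega) u t x = \int[leb R]_(x in Omega) u0 x).

Definition regularized_solution (T alpha n eps : R) (u0 : R -> R)
    (u : R -> R -> R) : Prop :=
  [/\ Linf_HsN T (alpha / 2) u, L2_HsN T (alpha + 1) u &
  exists Iu dIu : R -> R -> R,
  [/\ is_I T alpha u Iu /\ is_dx T Iu dIu,
      forall phi phit phix phitx, testH1 T phi phit phix phitx ->
        let A t x := u t x * phit t x in
        let B t x := feps n eps (u t x) * dIu t x * phix t x in
        [/\ integrable2 (cyl T) A, integrable2 (cyl T) B &
          Rint2 (cyl T) A + Rint2 (cyl T) B =
          - \int[leb R]_(x in Omega) (u0 x * phi 0 x)],
      same_mass T u0 u,
      ae_time T (fun t =>
        (hdot2 (alpha / 2) (u t) +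
         2%:E * \int[leb2 R]_(p in cyl t)
                  (feps n eps (u p.1 p.2) * dIu p.1 p.2 ^+ 2)%:E
         <= hdot2 (alpha / 2) u0)%E) &
      ae_time T (fun t =>
        (\int[leb R]_(x in Omega) (Geps n eps (u t x))%:E +
         \int[leb R]_(s in `]0%R, t[) hdot2 (alpha / 2 + 1) (u s)
         <= \int[leb R]_(x in Omega) (Geps n eps (u0 x))%:E)%E)]].

Definition C0Lp (T : R) (p : \bar R) (v : R -> R -> R) : Prop :=
  forall t : R, 0 < t < T ->
    inLpO p (v t) /\ LpO p (fun x => v s x - v t x) @[s --> t] --> 0%E.

(* Convergence in C^0(0,T; L^p): vj and v are the time-continuous versions of
   the classes uj and u. *)
Definition cvg_C0Lp (T : R) (p : \bar R) (uj : nat -> R -> R -> R)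
    (u : R -> R -> R) : Prop :=
  exists (vj : nat -> R -> R -> R) (v : R -> R -> R),
  [/\ forall j, ae_time T (fun t =>
        {ae leb R, forall x, Omega x -> vj j t x = uj j t x}),
      ae_time T (fun t => {ae leb R, forall x, Omega x -> v t x = u t x}),
      (forall j, C0Lp T p (vj j)), C0Lp T p v &
      forall d : R, 0 < d -> \forall j \near \oo,
        forall t : R, 0 < t < T -> (LpO p (fun x => vj j t x - v t x)%R <= d%:E)%E].

(* Locally uniform convergence in (0,T) x (0,1), for classes of functions *)
Definition cvg_locally_uniformly (T : R) (uj : nat -> R -> R -> R)
    (u : R -> R -> R) : Prop :=
  forall K : set (R * R), compact K -> K `<=` cyl T ->
  forall d : R, 0 < d -> \forall j \near \oo,
    {ae leb2 R, forall p, K p -> `|uj j p.1 p.2 - u p.1 p.2| <= d}.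

(* p (1 - alpha) < 2 reads p < 2 / (1 - alpha), and p < oo if alpha = 1. *)
Definition limit_of_regularized (T alpha n : R) (u0 : R -> R)
    (u : R -> R -> R) : Prop :=
  exists (eps : nat -> R) (uj : nat -> R -> R -> R),
  [/\ (forall j, 0 < eps j) /\ eps @ \oo --> 0,
      forall j, regularized_solution T alpha n (eps j) u0 (uj j),
      {ae leb2 R, forall p, cyl T p -> uj j p.1 p.2 @[j --> \oo] --> u p.1 p.2},
      alpha <= 1 -> forall p : R, 1 <= p -> p * (1 - alpha) < 2 ->
        cvg_C0Lp T p%:E uj u &
      1 < alpha -> cvg_locally_uniformly T uj u].

(* As in the other weak formulations, the integrands are required to be
   Lebesgue integrable: Rint2 is a junk value otherwise. *)
Definition weak_formulation (T n : R) (u0 : R -> R)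
    (u ux Iu : R -> R -> R) : Prop :=
  forall phi, test2 (cyl0 T) phi ->
    (forall t : R, 0 < t < T -> Dx phi t 0 = 0 /\ Dx phi t 1 = 0) ->
    let A t x := u t x * Dt phi t x in
    let B t x := n * u t x `^ (n - 1) * ux t x * Iu t x * Dx phi t x in
    let C t x := u t x `^ n * Iu t x * Dx (Dx phi) t x in
    [/\ integrable2 (cyl T) A, integrable2 (cyl T) B, integrable2 (cyl T) C &
      Rint2 (cyl T) A - Rint2 (cyl T) B - Rint2 (cyl T) C =
      - \int[leb R]_(x in Omega) (u0 x * phi 0 x)].

(* g in L^2(Q) and
   g = d_x (u^(n/2) I(u)) - n/2 u^((n-2)/2) d_x u I(u) in D'(Q) *)
Definition dissipation (T n : R) (u ux Iu g : R -> R -> R) : Prop :=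
  let V t x := u t x `^ (n / 2) * Iu t x in
  let W t x := n / 2 * u t x `^ ((n - 2) / 2) * ux t x * Iu t x in
  [/\ measurable2 (cyl T) g,
      (\int[leb2 R]_(p in cyl T) (g p.1 p.2 ^+ 2)%:E < +oo)%E,
      locally_integrable2 (cyl T) V, locally_integrable2 (cyl T) W &
      forall phi, test2 (cyl T) phi ->
        Rint2 (cyl T) (fun t x => g t x * phi t x) =
        - Rint2 (cyl T) (fun t x => V t x * Dx phi t x)
        - Rint2 (cyl T) (fun t x => W t x * phi t x)].

Definition constructed_solution (T alpha n : R) (u0 : R -> R)
    (u : R -> R -> R) : Prop :=
  [/\ Linf_HsN T (alpha / 2) u /\ L2_HsN T (alpha / 2 + 1) u,
      {ae leb2 R, forall p, cyl T p -> 0 <= u p.1 p.2},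
      limit_of_regularized T alpha n u0 u &
  exists ux Iu g : R -> R -> R,
  [/\ is_dx T u ux /\ is_I T alpha u Iu,
      weak_formulation T n u0 u ux Iu,
      same_mass T u0 u,
      dissipation T n u ux Iu g /\
      ae_time T (fun t =>
        (hdot2 (alpha / 2) (u t) +
         2%:E * \int[leb2 R]_(p in cyl t) (g p.1 p.2 ^+ 2)%:E
         <= hdot2 (alpha / 2) u0)%E) &
      ae_time T (fun t =>
        (\int[leb R]_(x in Omega) G n (u t x) +
         \int[leb R]_(s in `]0%R, t[) hdot2 (alpha / 2 + 1) (u s)
         <= \int[leb R]_(x in Omega) G n (u0 x))%E)]].

(* f in C^(0,beta)(0,1); boundedness is automatic on a bounded interval. *)
Definition Holder (beta : R) (f : R -> R) : Prop :=
  exists C : R, forall x y, Omega x -> Omega y ->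
    `|f x - f y| <= C * `|x - y| `^ beta.

(* u_t + d_x J = 0 in D'(Q) *)
Definition conservation_law (T : R) (u J : R -> R -> R) : Prop :=
  [/\ locally_integrable2 (cyl T) u, locally_integrable2 (cyl T) J &
    forall phi, test2 (cyl T) phi ->
      Rint2 (cyl T) (fun t x => u t x * Dt phi t x) +
      Rint2 (cyl T) (fun t x => J t x * Dx phi t x) = 0].

End Solutions.

(* Main.v *)
(* For almost every t the function u(t) lies in H^(alpha/2+1), so its cosine
   series converges absolutely to a Hoelder continuous representative v whose
   second differences are O(h^b) for every b < (alpha+1)/2.  As v >= 0, a zero
   x0 would give v(x0 + h) <= C h^b; since G(s) >= c s^(2-n) - C', the choice
   b = 1/(n-2), allowed by the lower bound on n, would make the entropy
   infinite.  Hence v > 0.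

   Localizing the identity that defines g in time, u^(n/2) I(u) has, for almost
   every t, a locally absolutely continuous representative with derivative
   g + (n/2) u^((n-2)/2) u_x I(u).  Dividing by v^(n/2) > 0 yields
   d_x I(u) = v^(-n/2) g, so J = v^n v^(-n/2) g, and an integration by parts on
   each slice turns the weak formulation into the conservation law.

   The local integrability of J follows from |J| <= v^n + g^2.  For alpha > 1,
   v is bounded.  For alpha <= 1 the inequality
     - int v^n I(v) >= kappa (int v^(n+1) - int v int v^n)
   bounds int v^n by int |v^n I(v)|, which the weak formulation controls; it is
   proved by writing the concave multiplier (k pi)^alpha in terms of Fejer
   kernels. *)
Require Import Defs.
From mathcomp Require Import all_boot all_order all_algebra.
From mathcomp Require Import all_classical all_reals all_analysis.
From mathcomp Require Import measurable_realfun ring lra.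
Import Order.TTheory GRing.Theory Num.Theory.
Import numFieldNormedType.Exports.
Local Open Scope classical_set_scope.
Local Open Scope ring_scope.

Set Implicit Arguments.
Unset Strict Implicit.
Unset Printing Implicit Defensive.

(** * Smooth functions and flat cut-offs *)

Section SmoothFunctions.
Context {R : realType}.
Implicit Types (f g : R -> R) (x : R).

(** Strict positivity is what gives the flux a meaning: [g] is tied to [u] only by an identity in
    the plane whose coefficients degenerate where [u] vanishes. The exponent 1/(n-2) is critical:
    G(v) then dominates a multiple of 1/h, which just fails to be integrable. Each distributional
    identity holds outside a null set of times that depends on the test function. To keep a single
    null set, slices are tested only against countably many functions, built from smooth bumps with
    rational endpoints. The obstacle for J is uniformity in time. When alpha <= 1, a bound in
    H^(alpha/2) does not control the supremum of v(t), so the estimate of v^n must have a constant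
    depending on the mass alone. Concavity of k -> (k pi)^alpha holds exactly for alpha <= 1, the
    range complementary to the embedding of H^(alpha/2) into bounded functions; the monotonicity of
    s -> s^n supplies the sign. *)

Lemma smooth1_class (C : (R -> R) -> Prop) :
  (forall f, C f -> (forall x, derivable f x 1) /\ C (derive1 f)) ->
  forall f, C f -> smooth1 f.
Proof.
move=> HC f Cf k x.
suff /HC[//] : C (derive1n k f) by [].
elim: k => [//|k /HC[_ ?]].
by rewrite derive1nS.
Qed.

Lemma smooth1_derivable f x : smooth1 f -> derivable f x 1.
Proof. by move=> sf; exact: (sf 0%N x). Qed.

Lemma smooth1_derive1n k f : smooth1 f -> smooth1 (derive1n k f).
Proof. by move=> sf j x; rewrite /derive1n -iterD; exact: (sf (j + k)%N x). Qed.

Lemma smooth1_derive1 f : smooth1 f -> smooth1 (derive1 f).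
Proof. exact: (@smooth1_derive1n 1 f). Qed.

Lemma smooth1_continuous f : smooth1 f -> continuous f.
Proof.
move=> sf x; apply: differentiable_continuous.
by apply/derivable1_diffP; exact: smooth1_derivable.
Qed.

(** The derivative of a member is again a member, by the sum, product and chain rules.
    [smooth1_class] then yields smoothness of all members at once, with no Leibniz formula for
    higher derivatives. *)
Inductive smooth_alg : (R -> R) -> Prop :=
| sa_base f : smooth1 f -> smooth_alg f
| sa_cst c : smooth_alg (fun=> c)
| sa_add f g : smooth_alg f -> smooth_alg g -> smooth_alg (fun x => f x + g x)
| sa_mul f g : smooth_alg f -> smooth_alg g -> smooth_alg (fun x => f x * g x)
| sa_aff f a b : smooth_alg f -> smooth_alg (fun x => f (a * x + b)).

Lemma derive1_aff f (a b x : R) : derivable f (a * x + b) 1 ->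
  derivable (fun x => f (a * x + b)) x 1 /\
  derive1 (fun x => f (a * x + b)) x = a * derive1 f (a * x + b).
Proof.
move=> df.
have dl : is_derive x 1 (fun x => a * x + b) a.
  by apply: is_derive_eq; rewrite /GRing.scale /=; ring.
have dff : is_derive (a * x + b) 1 f (derive1 f (a * x + b)).
  by rewrite derive1E; exact/derivableP.
have H : is_derive x 1 (f \o (fun x => a * x + b)) (derive1 f (a * x + b) * a).
  exact: is_derive1_comp.
by split; [case: H|rewrite derive1E mulrC; case: H].
Qed.

Lemma smooth_alg_smooth1 f : smooth_alg f -> smooth1 f.
Proof.
apply: smooth1_class => {}f; elim => {f}.
- by move=> f sf; split=> [x|]; [exact: smooth1_derivable|exact/sa_base/smooth1_derive1].
- move=> c; split=> [x|]; first exact: derivable_cst.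
  rewrite (_ : derive1 _ = fun=> 0); first exact: sa_cst.
  by apply/funext => x; exact: derive1_cst.
- move=> f g _ [df sf] _ [dg sg]; split=> [x|]; first exact: derivableD.
  rewrite (_ : derive1 _ = fun x => derive1 f x + derive1 g x); first exact: sa_add.
  by apply/funext => x; rewrite !derive1E deriveD.
- move=> f g sf0 [df sf] sg0 [dg sg]; split=> [x|]; first exact: derivableM.
  rewrite (_ : derive1 _ = fun x => f x * derive1 g x + g x * derive1 f x).
    by apply: sa_add; exact: sa_mul.
  by apply/funext => x; rewrite !derive1E deriveM.
- move=> f a b sf0 [df sf]; split=> [x|]; first by case: (@derive1_aff f a b x).
  rewrite (_ : derive1 _ = fun x => a * derive1 f (a * x + b)).
    by apply: (@sa_mul (fun=> a)); [exact: sa_cst|exact: (@sa_aff _ a b)].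
  by apply/funext => x; case: (@derive1_aff f a b x).
Qed.

Lemma smooth1_cst c : smooth1 (fun=> c : R).
Proof. exact/smooth_alg_smooth1/sa_cst. Qed.

Lemma smooth1D f g : smooth1 f -> smooth1 g -> smooth1 (fun x => f x + g x).
Proof. by move=> *; apply/smooth_alg_smooth1/sa_add; exact: sa_base. Qed.

Lemma smooth1M f g : smooth1 f -> smooth1 g -> smooth1 (fun x => f x * g x).
Proof. by move=> *; apply/smooth_alg_smooth1/sa_mul; exact: sa_base. Qed.

Lemma smooth1_aff f a b : smooth1 f -> smooth1 (fun x => f (a * x + b)).
Proof. by move=> *; apply/smooth_alg_smooth1/sa_aff; exact: sa_base. Qed.

Lemma smooth1_primitive f g : (forall x, is_derive x 1 f (g x)) -> smooth1 g ->
  smooth1 f.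
Proof.
move=> fg sg; apply: (@smooth1_class (fun h => h = f \/ smooth1 h)); last by left.
move=> h [->|sh]; split.
- by move=> x; case: (fg x).
- by right; rewrite (_ : derive1 f = g)//; apply/funext => x; rewrite derive1E; case: (fg x).
- by move=> x; exact: smooth1_derivable.
- by right; exact: smooth1_derive1.
Qed.

Lemma smooth1_cos : smooth1 (@cos R).
Proof.
apply: (@smooth1_class (fun h => exists a b, h = fun x => a * cos x + b * sin x)).
  move=> _ [a [b ->]].
  have D x : is_derive x 1 (fun x : R => a * cos x + b * sin x) (b * cos x + (- a) * sin x).
    by apply: is_derive_eq; rewrite /GRing.scale /=; ring.
  split; first by move=> x; case: (D x).
  by exists b, (- a); apply/funext => x; rewrite derive1E; case: (D x).
by exists 1, 0; apply/funext => x; rewrite mul1r mul0r addr0.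
Qed.

Definition flat_exp x : R := if 0 < x then expR (- x^-1) else 0.

(** The exponential dominates y^i / i!, so each monomial contributes at most its coefficient times
    i!. This is what flattens all derivatives of exp(-1/x) at 0. *)
Lemma poly_expRN_bounded (p : {poly R}) :
  exists C : R, forall y : R, 0 <= y -> `|p.[y] * expR (- y)| <= C.
Proof.
exists (\sum_(i < size p) `|p`_i| * i`!%:R) => y y0.
rewrite horner_coef normrM (ger0_norm (expR_ge0 _)) expRN ler_pdivrMr ?expR_gt0//.
rewrite mulr_suml (le_trans (ler_norm_sum _ _ _))//; apply: ler_sum => i _.
rewrite normrM -mulrA ler_wpM2l// normrX (ger0_norm y0).
case: (nat_of_ord i) => [|k].
  by rewrite expr0 fact0 mul1r (le_trans _ (expR_ge1Dx _))// lerDl.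
have := expR_ge1Dxn k y0; rewrite -ler_pdivrMl ?ltr0n ?fact_gt0// mulrC.
by move=> H; apply: le_trans H; rewrite lerDr ler01.
Qed.

(** The functions p(1/x) exp(-1/x), extended by 0, form a class closed under differentiation: p
    becomes (p - p') X^2. The flat exponential is the case p = 1. *)
Let flat_poly (p : {poly R}) x : R :=
  if 0 < x then p.[x^-1] * expR (- x^-1) else 0.

Let flat_poly_derive (p : {poly R}) x :
  is_derive x 1 (flat_poly p) (flat_poly ((p - p^`()) * 'X^2) x).
Proof.
have [x0|x0|x0] := ltgtP x 0.
- rewrite {2}/flat_poly ltNge (ltW x0)/=.
  apply: (near_eq_is_derive _ (is_derive_cst (0 : R) x 1)).
  near=> y; rewrite /flat_poly ltNge (_ : y <= 0)%R//.
  apply/ltW.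
  by near: y; exact: lt_nbhsl.
- rewrite {2}/flat_poly x0.
  have xn0 : x != 0 by rewrite gt_eqF.
  apply: (@near_eq_is_derive _ _ _ (fun x => p.[x^-1] * expR (- x^-1))).
    near=> y; rewrite /flat_poly ifT//.
    by near: y; exact: lt_nbhsr.
  have Dp : is_derive x^-1 1 (horner p) (p^`().[x^-1]).
    exact: is_derive_poly.
  have Di : is_derive x 1 (fun y : R => y^-1) (- x ^- 2).
    have := is_deriveV (f := id) xn0 (is_derive_id x 1).
    by rewrite [_%:A]mulr1.
  have D1 := @is_derive1_comp _ (horner p) _ x _ _ Dp Di.
  have D2 : is_derive x 1 (fun y => expR (- y^-1)) (expR (- x^-1) * x ^- 2).
    have Dn : is_derive x 1 (fun y : R => - y^-1) (x ^- 2).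
      by have := is_deriveN Di; rewrite opprK.
    exact: (@is_derive1_comp _ expR _ x _ _ (is_derive_expR _) Dn).
  apply: (is_derive_eq (is_deriveM D1 D2)).
  rewrite hornerM hornerXn hornerD hornerN -exprVn /GRing.scale /=.
  by move: (p.[_]) (p^`().[_]) (expR _) => A B E; ring.
(* At 0 the bound is taken for p X^2 rather than p: the difference quotient is h times (p X^2)(1/h)
   exp(-1/h), hence at most C |h|. *)
- rewrite x0 {2}/flat_poly ltxx.
  have [C HC] := poly_expRN_bounded (p * 'X^2).
  have L : h^-1 *: (flat_poly p (h *: 1 + 0) - flat_poly p 0) @[h --> 0^'] --> (0 : R).
    apply: norm_cvg0 => //.
    apply: (@squeeze_cvgr _ _ _ _ (fun=> 0) (fun h => C * `|h|)).
    + near=> h; rewrite normr_ge0/= [X in _ - X]/flat_poly ltxx subr0 addr0.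
      rewrite /GRing.scale /= mulr1.
      have hn0 : h != 0 by near: h; exact: nbhs_dnbhs_neq.
      rewrite /flat_poly; case: ltP => h0; last first.
        rewrite mulr0 normr0 mulr_ge0// (le_trans _ (HC 0 _))//.
      have H : `|(p * 'X^2).[h^-1] * expR (- h^-1)| <= C.
        by apply: HC; rewrite invr_ge0 ltW.
      rewrite (gtr0_norm h0) -ler_pdivrMr//; apply: le_trans H.
      rewrite -[X in _ / X <= _](gtr0_norm h0) -normrV ?unitfE// -normrM.
      rewrite hornerM hornerXn le_eqVlt; apply/orP; left.
      by apply/eqP; congr `|_|; ring.
    + exact: cvg_cst.
    + rewrite -[X in _ --> X](mulr0 C); apply: cvgMr => //.
      have : `|h| @[h --> (0 : R)^'] --> `|0 : R| by apply: cvg_norm; exact: nbhs_dnbhs.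
      by rewrite normr0.
  split; first by apply/cvg_ex; exists 0.
  exact: cvg_lim L.
Unshelve. all: by end_near. Qed.

Lemma smooth1_flat_exp : smooth1 flat_exp.
Proof.
apply: (@smooth1_class (fun h => exists p, h = flat_poly p)).
  move=> _ [p ->]; split=> [x|]; first by case: (flat_poly_derive p x).
  exists ((p - p^`()) * 'X^2); apply/funext => x.
  by rewrite derive1E; case: (flat_poly_derive p x).
by exists 1; apply/funext => x; rewrite /flat_poly hornerC mul1r.
Qed.

Lemma flat_exp_derive x : 0 < x -> derive1 flat_exp x = x ^- 2 * flat_exp x.
Proof.
move=> x0; have -> : flat_exp = flat_poly 1.
  by apply/funext => y; rewrite /flat_poly hornerC mul1r.
rewrite derive1E; have [_ ->] := flat_poly_derive 1 x.
rewrite /flat_poly x0 derivC subr0 mul1r hornerXn hornerC -exprVn; ring.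
Qed.

Lemma flat_exp_ge0 x : 0 <= flat_exp x.
Proof. by rewrite /flat_exp; case: ifP => // _; exact: expR_ge0. Qed.

Lemma flat_exp_gt0 x : 0 < x -> 0 < flat_exp x.
Proof. by rewrite /flat_exp => ->; exact: expR_gt0. Qed.

Lemma flat_exp_le0 x : x <= 0 -> flat_exp x = 0.
Proof. by rewrite /flat_exp ltNge => ->. Qed.

Lemma flat_exp_le1 x : flat_exp x <= 1.
Proof.
rewrite /flat_exp; case: ltP => // x0.
by rewrite -(expR0 R) ler_expR oppr_le0 invr_ge0 ltW.
Qed.


Lemma derive1Mr f (c x : R) : derivable f x 1 ->
  derive1 (fun y => f y * c) x = derive1 f x * c.
Proof.
move=> df; have H : is_derive x 1 (fun y => f y * c) (derive1 f x * c).
  have D : is_derive x 1 f (derive1 f x) by rewrite derive1E; exact/derivableP.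
  apply: (is_derive_eq (is_deriveM D (is_derive_cst c x 1))).
  by rewrite scaler0 add0r [_ *: _]mulrC.
by rewrite derive1E; case: H.
Qed.

Lemma derive1Ml f (c x : R) : derivable f x 1 ->
  derive1 (fun y => c * f y) x = c * derive1 f x.
Proof.
by move=> df; under eq_fun do rewrite mulrC; rewrite derive1Mr// mulrC.
Qed.

Lemma smooth2_tensor f g : smooth1 f -> smooth1 g -> smooth2 (fun t x => f t * g x).
Proof.
move=> sf sg s /=.
have [i [j ->]] : exists i j, foldr
    (fun (b : bool) h => if b then Dt h else Dx h) (fun t x => f t * g x) s
    = (fun t x => derive1n i f t * derive1n j g x).
  elim: s => [|b s [i [j IH]]]; first by exists 0%N, 0%N.
  rewrite /= IH; case: b.
    exists i.+1, j; apply/funext => t; apply/funext => x; rewrite /Dt derive1nS.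
    by rewrite derive1Mr//; exact: sf.
  exists i, j.+1; apply/funext => t; apply/funext => x; rewrite /Dx derive1nS.
  by rewrite derive1Ml//; exact: sg.
split.
  move=> p; apply: cvgM.
    have : {for p, continuous ((derive1n i f) \o fst)} by
      apply: continuous_comp; [exact: cvg_fst|exact/smooth1_continuous/smooth1_derive1n].
    exact.
  have : {for p, continuous ((derive1n j g) \o snd)} by
    apply: continuous_comp; [exact: cvg_snd|exact/smooth1_continuous/smooth1_derive1n].
  exact.
move=> t x; split.
  by apply: derivableM; [exact: sf|exact: derivable_cst].
by apply: derivableM; [exact: derivable_cst|exact: sg].
Qed.

Lemma Dt_tensor f g t x : smooth1 f -> Dt (fun t x => f t * g x) t x = derive1 f t * g x.
Proof. by move=> sf; rewrite /Dt derive1Mr//; exact: (sf 0%N). Qed.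

Lemma Dx_tensor f g t x : smooth1 g -> Dx (fun t x => f t * g x) t x = f t * derive1 g x.
Proof. by move=> sg; rewrite /Dx derive1Ml//; exact: (sg 0%N). Qed.

(** The factor [j] sharpens the edges: the bumps stay between 0 and 1, vanish off ]a, b[ and tend
    pointwise to its indicator. Smooth tests thereby recover integrals over intervals, by dominated
    convergence. *)
Definition flat_bump (a b : R) (j : nat) x : R :=
  flat_exp (j%:R * (x - a)) * flat_exp (j%:R * (b - x)).

Lemma smooth1_flat_bump a b j : smooth1 (flat_bump a b j).
Proof.
rewrite (_ : flat_bump a b j = fun x => flat_exp (j%:R * x + (- (j%:R * a))) *
    flat_exp ((- j%:R) * x + j%:R * b)).
  by apply: smooth1M; apply: smooth1_aff; exact: smooth1_flat_exp.
by apply/funext => x; rewrite /flat_bump mulrBr mulrBr mulNr [in X in _ * X]addrC.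
Qed.

Lemma flat_bump_ge0 a b j x : 0 <= flat_bump a b j x.
Proof. by rewrite mulr_ge0 ?flat_exp_ge0. Qed.

Lemma flat_bump_le1 a b j x : flat_bump a b j x <= 1.
Proof. by rewrite mulr_ile1 ?flat_exp_ge0 ?flat_exp_le1. Qed.

Lemma flat_bump_out a b j x : ~~ (a < x < b) -> flat_bump a b j x = 0.
Proof.
rewrite /flat_bump negb_and -!leNgt => /orP[h|h].
  by rewrite flat_exp_le0 ?mul0r// mulr_ge0_le0// subr_le0.
by rewrite (flat_exp_le0 (x := _ * (b - x))) ?mulr0// mulr_ge0_le0// subr_le0.
Qed.

Lemma flat_exp_cvg c : 0 < c -> flat_exp (j%:R * c) @[j --> \oo] --> (1 : R).
Proof.
move=> c0; rewrite -[X in _ --> X](@expR0 R) -[X in expR X]oppr0.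
apply: (@cvg_trans _ ((expR (- (j%:R * c)^-1) @[j --> \oo]))).
  apply: near_eq_cvg; near=> j; rewrite /flat_exp ifT//.
  rewrite mulr_gt0// ltr0n; near: j; exact: nbhs_infty_gt.
apply: continuous_cvg; first exact: continuous_expR.
apply: cvgN; rewrite -[X in _ --> X](mulr0 c^-1).
under eq_fun do rewrite invfM mulrC.
by apply: cvgMr => //; apply/gtr0_cvgV0; [near=> j; rewrite ltr0n; near: j; exact: nbhs_infty_gt|exact: cvgr_idn].
Unshelve. all: by end_near. Qed.

Lemma flat_bump_cvg a b x : flat_bump a b j x @[j --> \oo] --> ((\1_(`]a, b[%classic) x) : R).
Proof.
rewrite indicE; case: (boolP (a < x < b)) => [/andP[ax xb]|xab].
  rewrite mem_set/= ?in_itv/= ?ax ?xb// -[X in _ --> X](mulr1 1).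
  by apply: cvgM; apply: flat_exp_cvg; rewrite subr_gt0.
rewrite memNset/= ?in_itv/=; last exact/negP.
by under eq_fun do rewrite flat_bump_out//; exact: cvg_cst.
Qed.

End SmoothFunctions.

(** * Integration of real functions *)

Section RealIntegrable.
Context d (T : measurableType d) (R : realType) (mu : {measure set T -> \bar R}).
Implicit Types (D : set T) (f g : T -> R).

Lemma le_integrableR D f g : measurable D -> measurable_fun D f ->
  (forall x, D x -> `|f x| <= g x) -> mu.-integrable D (EFin \o g) ->
  mu.-integrable D (EFin \o f).
Proof.
move=> mD mf fg ig; apply: (le_integrable mD _ _ ig); first exact/measurable_EFinP.
by move=> x Dx; rewrite /= lee_fin (le_trans (fg x Dx))// ler_norm.
Qed.

Lemma integrableRM_bounded D f g (M : R) : measurable D -> measurable_fun D g ->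
  (forall x, D x -> `|g x| <= M) -> mu.-integrable D (EFin \o f) ->
  mu.-integrable D (EFin \o (fun x => f x * g x)).
Proof.
move=> mD mg gM fi; have mf : measurable_fun D f.
  by apply/measurable_EFinP; exact: measurable_int fi.
apply: (@le_integrableR _ _ (fun x => M * `|f x|)) => //.
- exact: measurable_funM.
- by move=> x Dx; rewrite normrM mulrC ler_wpM2r// gM.
- rewrite (_ : _ \o _ = fun x => M%:E * (`|f x|)%:E)%E//.
  by apply: integrableZl => //; exact: integrable_norm.
Qed.

Lemma integrableRD D f g : measurable D -> mu.-integrable D (EFin \o f) ->
  mu.-integrable D (EFin \o g) -> mu.-integrable D (EFin \o (fun x => f x + g x)).
Proof. by move=> mD fi gi; exact: (integrableD mD fi gi). Qed.

Lemma integrableRB D f g : measurable D -> mu.-integrable D (EFin \o f) ->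
  mu.-integrable D (EFin \o g) -> mu.-integrable D (EFin \o (fun x => f x - g x)).
Proof. by move=> mD fi gi; exact: (integrableB mD fi gi). Qed.

Lemma integrableRZl D f (c : R) : measurable D -> mu.-integrable D (EFin \o f) ->
  mu.-integrable D (EFin \o (fun x => c * f x)).
Proof. by move=> mD fi; exact: (integrableZl mD c fi). Qed.

Lemma integrable_measurableR D f : mu.-integrable D (EFin \o f) -> measurable_fun D f.
Proof. by move=> /measurable_int /measurable_EFinP. Qed.

Lemma ae_eq_Rintegral D f g : measurable D -> measurable_fun D f -> measurable_fun D g ->
  {ae mu, forall x, D x -> f x = g x} ->
  \int[mu]_(x in D) f x = \int[mu]_(x in D) g x.
Proof.
move=> mD mf mg fg; congr fine; apply: ae_eq_integral => //; [exact/measurable_EFinP..|].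
by apply: filterS fg => x /[apply] ->.
Qed.

Lemma ae_eq_integrableR D f g : measurable D -> measurable_fun D g ->
  {ae mu, forall x, D x -> f x = g x} -> mu.-integrable D (EFin \o f) ->
  mu.-integrable D (EFin \o g).
Proof.
move=> mD mg fg fi; apply/integrableP; split; first exact/measurable_EFinP.
case/integrableP: (fi) => mf; apply: le_lt_trans; rewrite le_eqVlt; apply/orP; left.
apply/eqP; apply: ae_eq_integral => //.
- by apply: measurableT_comp => //; exact/measurable_EFinP.
- exact: measurableT_comp.
- by apply: filterS fg => x /= + Dx => ->.
Qed.

Lemma EFin_Rintegral D f : measurable D -> mu.-integrable D (EFin \o f) ->
  (\int[mu]_(x in D) f x)%:E = (\int[mu]_(x in D) (f x)%:E)%E.
Proof. by move=> mD fi; rewrite /Rintegral fineK//; exact: integrable_fin_num. Qed.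

Lemma Rintegral_dominated D (f_ : nat -> T -> R) f g : measurable D ->
  (forall n, measurable_fun D (f_ n)) -> measurable_fun D f ->
  {ae mu, forall x, D x -> f_ n x @[n --> \oo] --> f x} ->
  mu.-integrable D (EFin \o g) ->
  {ae mu, forall x n, D x -> `|f_ n x| <= g x} ->
  \int[mu]_(x in D) f_ n x @[n --> \oo] --> \int[mu]_(x in D) f x.
Proof.
move=> mD mf_ mf ff gi fg.
have mfn n : measurable_fun D (EFin \o f_ n) by exact/measurable_EFinP.
have mfE : measurable_fun D (EFin \o f) by exact/measurable_EFinP.
have ffE : {ae mu, forall x, D x -> (EFin \o f_ n) x @[n --> \oo] --> (EFin \o f) x}.
  by apply: filterS ff => x /[apply] ?; apply/cvg_EFin => //; exact: nearW.
have fgE : {ae mu, forall x n, D x -> (`|(EFin \o f_ n) x| <= (EFin \o g) x)%E}.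
  by apply: filterS fg => x H n Dx; rewrite lee_fin H.
have [fi _ H] := dominated_convergence mD mfn mfE ffE gi fgE.
rewrite /Rintegral; apply: fine_cvg; rewrite fineK; last exact: integrable_fin_num.
exact: H.
Qed.

End RealIntegrable.

(** * Null sets and integrals over intervals of the line *)

Section Intervals.
Context {R : realType}.
Local Notation mu := (@lebesgue_measure R).
Implicit Types (f g h F : R -> R) (a b c d x : R).

Lemma ae_mono (P Q : R -> Prop) : (forall x, P x -> Q x) ->
  {ae mu, forall x, P x} -> {ae mu, forall x, Q x}.
Proof. by move=> PQ; apply: (@filterS _ _ (ae_filter_ringOfSetsType mu)). Qed.

Lemma ae_and (P Q : R -> Prop) : {ae mu, forall x, P x} ->
  {ae mu, forall x, Q x} -> {ae mu, forall x, P x /\ Q x}.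
Proof. exact: (@filterI _ _ (ae_filter_ringOfSetsType mu)). Qed.

Lemma ae_forall_nat (P : nat -> R -> Prop) : (forall k, {ae mu, forall x, P k x}) ->
  {ae mu, forall x k, P k x}.
Proof. by move=> H; exact: (ae_foralln H). Qed.

Lemma ae_forall_count (I : countType) (P : I -> R -> Prop) :
  (forall i, {ae mu, forall x, P i x}) -> {ae mu, forall x i, P i x}.
Proof.
move=> H; pose Q k x := if unpickle k is Some i then P i x else True.
apply: (@ae_mono (fun x => forall k, Q k x)).
  by move=> x /[swap] i /(_ (pickle i)); rewrite /Q pickleK.
apply: ae_forall_nat => k; rewrite /Q; case: unpickle => //.
exact: aeW.
Qed.

Lemma Rintegral_split f a b c : a <= b -> b <= c ->
  mu.-integrable `[a, c] (EFin \o f) ->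
  \int[mu]_(x in `[a, c]) f x = \int[mu]_(x in `[a, b]) f x + \int[mu]_(x in `[b, c]) f x.
Proof.
move=> ab bc fi.
have := @Rintegral_itvB R f (BLeft a) (BRight c) b fi.
rewrite !bnd_simp => /(_ ab bc) H.
have fi' : mu.-integrable `]b, c] (EFin \o f).
  apply: integrableS fi => //; apply: subset_itvr; by rewrite bnd_simp.
by rewrite -(Rintegral_itv_obnd_cbnd fi') -H addrC subrK.
Qed.

Lemma integrable_subitv f a b c d : a <= c -> d <= b ->
  mu.-integrable `[a, b] (EFin \o f) -> mu.-integrable `[c, d] (EFin \o f).
Proof.
by move=> ac db; apply: integrableS => //; apply: subset_itv; rewrite bnd_simp.
Qed.

Lemma primitive_continuous f a b x : mu.-integrable `[a, b] (EFin \o f) ->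
  a < x < b -> {for x, continuous (fun y => \int[mu]_(t in `[a, y]) f t)}.
Proof.
move=> fi /andP[ax xb].
have ab := lt_trans ax xb.
have := parameterized_integral_continuous (ltW ab) fi.
by move=> /(continuous_within_itvP _ ab)[+ _ _]; apply; rewrite in_itv/= ax.
Qed.

(** Lebesgue differentiation: the primitive of [f] is constant on ]a, b[, and its derivative is [f]
    almost everywhere. *)
Lemma ae_eq0_of_itv f a b : mu.-integrable `[a, b] (EFin \o f) ->
  (forall c d, a < c -> c < d -> d < b -> \int[mu]_(x in `[c, d]) f x = 0) ->
  {ae mu, forall x, a < x < b -> f x = 0}.
Proof.
move=> fi f0.
have [ba|ab] := leP b a.
  by apply: aeW => x /andP[ax xb]; have := lt_trans ax xb; rewrite ltNge ba.
pose g := f \_ `[a, b].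
have gi A : measurable A -> mu.-integrable A (EFin \o g).
  move=> mA; apply: (@integrableS _ _ _ _ setT) => //.
  by rewrite -restrict_EFin; apply: (integrable_mkcond _ _).1.
have gloc : locally_integrable [set: R] g by exact: integrable_locally.
have H := @FTC1 R g (BLeft a) (fun y => gi _ (measurable_itv _)) gloc.
apply: ae_mono H => x H /andP[ax xb].
have [_ <-] : derivable (fun y => \int[mu]_(t in `[a, y]) g t) x 1 /\
    derive1 (fun y => \int[mu]_(t in `[a, y]) g t) x = f x.
  have cax : (a%:E < x%:E)%E by rewrite lte_fin.
  have [d1 d2] := H cax.
  by split => //; rewrite d2 /g patchE mem_set//= in_itv/= !ltW.
have cst0 c d : a < c -> c <= d -> d < b ->
    \int[mu]_(t in `[a, c]) g t = \int[mu]_(t in `[a, d]) g t.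
  move=> ac cd db; rewrite (@Rintegral_split g a c d) ?(ltW ac)//; last exact: gi.
  rewrite [X in _ + X](_ : _ = 0) ?addr0//.
  move: cd; rewrite le_eqVlt => /predU1P[->|cd]; first by rewrite set_itv1 Rintegral_set1.
  rewrite -(f0 c d)//; apply: eq_Rintegral => y; rewrite inE/= in_itv/= => /andP[cy yd].
  by rewrite /g patchE mem_set//= in_itv/= (le_trans (ltW ac) cy) (le_trans yd (ltW db)).
rewrite -(@derive1_cst R R (\int[mu]_(t in `[a, x]) g t) x) !derive1E.
apply: near_eq_derive; near=> y.
have ay : a < y by near: y; exact: lt_nbhsr.
have yb : y < b by near: y; exact: lt_nbhsl.
have [yx|xy] := leP y x; first exact: cst0.
by apply/esym; apply: cst0 => //; exact: ltW.
Unshelve. all: by end_near. Qed.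

Lemma flat_bump_measurable a b j D : measurable_fun D (flat_bump a b j : R -> R).
Proof.
apply: measurable_funTS; apply: continuous_measurable_fun.
exact/smooth1_continuous/smooth1_flat_bump.
Qed.

Lemma flat_bump_limit f a b : mu.-integrable `[a, b] (EFin \o f) ->
  \int[mu]_(x in `[a, b]) (f x * flat_bump a b j x) @[j --> \oo] -->
  \int[mu]_(x in `[a, b]) f x.
Proof.
move=> fi; have mf := integrable_measurableR fi.
apply: (@Rintegral_dominated _ _ _ mu _ (fun j x => f x * flat_bump a b j x) f (fun x => `|f x|)) => //.
- by move=> n; apply: measurable_funM => //; exact: flat_bump_measurable.
(* The bumps vanish at both endpoints, so the pointwise limit fails there and only there. *)
- have N : mu [set a; b] = 0%E.
    by apply: countable_lebesgue_measure0; exact: finite_set_countable.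
  exists [set a; b]; split => //; first exact: measurableU.
  move=> x /= /not_implyP[xab H]; apply: contrapT => xN; apply: H.
  have xo : (`]a, b[%classic : set R) x.
    move: xab; rewrite /= !in_itv/= => /andP[ax xb]; rewrite !lt_neqAle ax xb !andbT.
    by apply/andP; split; apply/eqP => e; apply: xN; [left|right].
  rewrite -[X in _ --> X]mulr1; apply: cvgM; first exact: cvg_cst.
  by have := @flat_bump_cvg R a b x; rewrite indicE mem_set.
- exact: integrable_norm.
- apply: aeW => x n _; rewrite normrM ler_piMr// ger0_norm ?flat_bump_ge0//.
  exact: flat_bump_le1.
Qed.

End Intervals.

(** * Absolutely continuous functions on (0,1) *)

Section Primitives.
Context {R : realType}.
Local Notation mu := (@lebesgue_measure R).
Implicit Types (f g h F H D : R -> R) (a b c d x : R).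

(** Heine's theorem, by near-covering compactness. Continuity is two-sided at every point of [a, b],
    so [y] is not confined to the interval. *)
Lemma itv_unif_continuous f a b (e : R) :
  (forall x, a <= x <= b -> {for x, continuous f}) -> 0 < e ->
  exists2 d : R, 0 < d & forall x y : R, a <= x <= b -> `|x - y| < d -> `|f x - f y| < e.
Proof.
move=> cf e0.
pose P (r x : R) := forall y, `|x - y| < r -> `|f x - f y| < e.
have /compact_near_coveringP/(_ R (0^'+) P) : compact (`[a, b] : set R) by exact: segment_compact.
case.
  move=> x; rewrite /= in_itv/= => xab.
  have /cvgrPdist_lt/(_ (e / 2)) := cf x xab.
  rewrite divr_gt0// => /(_ isT)/nbhs_ballP[r /= r0 Hr].
  exists (ball x (r / 2), [set s | s < r / 2]); first split => /=.
  - by apply: nbhsx_ballx; rewrite divr_gt0.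
  - by apply: nbhs_right_lt; rewrite divr_gt0.
  move=> [z s] /= [zx sr] y zy.
  have -> : f z - f y = (f x - f y) - (f x - f z) by ring.
  rewrite (le_lt_trans (ler_normB _ _))// (splitr e) ltrD//; apply: Hr => /=.
    rewrite /ball/= (_ : x - y = (x - z) + (z - y)); last by ring.
    rewrite (le_lt_trans (ler_normD _ _))// (splitr r) ltrD//.
    exact: lt_trans sr.
  apply: lt_le_trans zx _; rewrite ler_pdivrMr// ler_peMr//; first exact: ltW.
  by rewrite ler1n.
move=> r /= r0 Hr; exists (r / 2); first by rewrite divr_gt0.
move=> x y xab; apply: (Hr (r / 2)).
- by rewrite /ball_/= sub0r normrN gtr0_norm ?divr_gt0//; lra.
- by rewrite divr_gt0.
- by rewrite /= in_itv.
Qed.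

(** Local absolute continuity on ]0, 1[, encoded by the fundamental theorem of calculus instead of
    epsilon-delta sums. Nothing is asked near 0 and 1, where [f] need not be integrable. *)
Definition is_primitive f F := forall a b, 0 < a -> a <= b -> b < 1 ->
  mu.-integrable `[a, b] (EFin \o f) /\ F b - F a = \int[mu]_(x in `[a, b]) f x.

Lemma is_primitive_continuous f F x : is_primitive f F -> 0 < x < 1 ->
  {for x, continuous F}.
Proof.
move=> fF /andP[x0 x1].
pose a := x / 2; pose b := (x + 1) / 2.
have a0 : 0 < a by rewrite divr_gt0.
have ax : a < x by rewrite /a; lra.
have xb : x < b by rewrite /b; lra.
have b1 : b < 1 by rewrite /b; lra.
have [fi _] := fF a b a0 (ltW (lt_trans ax xb)) b1.
have axb : a < x < b by rewrite ax.
have C := primitive_continuous fi axb.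
have E : {near x, (fun y => F a + \int[mu]_(t in `[a, y]) f t) =1 F}.
  near=> y.
  have ay : a < y by near: y; exact: lt_nbhsr.
  have yb : y < 1 by near: y; exact: lt_nbhsl.
  by have [_ <-] := fF a y a0 (ltW ay) yb; rewrite addrC subrK.
have : {for x, continuous (fun y => F a + \int[mu]_(t in `[a, y]) f t)}.
  by apply: cvgD => //; exact: cvg_cst.
move=> G; rewrite /prop_for /continuous_at -(nbhs_singleton E).
apply: cvg_trans G; apply: near_eq_cvg.
by first [exact: E | apply: filterS E => y ->].
Unshelve. all: by end_near. Qed.

(** The error D(y) - D(x) - int f is additive over adjacent intervals, and so is the bound e int h.
    A bound on short intervals therefore holds on all of [a, b] for every e, which forces the error
    to be 0. *)
Lemma is_primitive_of_local f D :
  (forall a b, 0 < a -> a < b -> b < 1 -> mu.-integrable `[a, b] (EFin \o f)) ->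
  (forall a b, 0 < a -> a < b -> b < 1 -> exists2 h,
     mu.-integrable `[a, b] (EFin \o h) &
     forall e, 0 < e -> exists2 d : R, 0 < d & forall x y : R, a <= x -> x <= y -> y <= b ->
       y - x < d ->
       `|D y - D x - \int[mu]_(t in `[x, y]) f t| <= e * \int[mu]_(t in `[x, y]) h t) ->
  is_primitive f D.
Proof.
move=> fi loc a b a0; rewrite le_eqVlt => /predU1P[<- a1|ab b1].
  rewrite {2}set_itv1 Rintegral_set1 subrr; split => //.
  have aa1 : a < (a + 1) / 2 by lra.
  by apply: integrable_subitv (fi a ((a + 1) / 2) a0 aa1 _); lra.
split; first exact: fi.
have fab := fi a b a0 ab b1.
have [h hi H] := loc a b a0 ab b1.
have key e : 0 < e -> `|D b - D a - \int[mu]_(t in `[a, b]) f t| <= e * \int[mu]_(t in `[a, b]) h t.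
  move=> e0; have [d d0 Hd] := H e e0.
  (* Pieces of length d/2 are removed one at a time; [k] bounds their number. *)
  have step (k : nat) x y : a <= x -> x <= y -> y <= b -> y - x < k%:R * (d / 2) ->
      `|D y - D x - \int[mu]_(t in `[x, y]) f t| <= e * \int[mu]_(t in `[x, y]) h t.
    elim: k x y => [|k IH] x y ax xy yb.
      by rewrite mul0r subr_lt0 ltNge xy.
    rewrite -natr1 mulrDl mul1r => xyk.
    have [xyd|xyd] := leP (y - x) (d / 2); first by apply: Hd => //; lra.
    pose z := x + d / 2.
    have xz : x <= z by rewrite /z; lra.
    have zy : z <= y by rewrite /z; lra.
    rewrite (Rintegral_split xz zy); last exact: integrable_subitv fab.
    rewrite (@Rintegral_split _ h x z y)//; last exact: integrable_subitv hi.
    rewrite mulrDr (_ : D y - D x - _ = (D z - D x - \int[mu]_(t in `[x, z]) f t) +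
       (D y - D z - \int[mu]_(t in `[z, y]) f t)); last by ring.
    rewrite (le_trans (ler_normD _ _))// lerD//.
      by apply: Hd => //; rewrite /z; lra.
    by apply: IH => //; rewrite /z; lra.
  have [k Hk] : exists k : nat, (b - a) / (d / 2) < k%:R.
    by exists (Num.truncn ((b - a) / (d / 2))).+1; exact: truncnS_gt.
  by apply: (step k) => //; [exact: ltW|rewrite -ltr_pdivrMr// divr_gt0].
apply/eqP; rewrite -subr_eq0 -normr_eq0 eq_le normr_ge0 andbT.
apply/ler_addgt0Pl => e e0; rewrite addr0.
set I := \int[mu]_(t in `[a, b]) h t in key.
have I0 : 0 < `|I| + 1 by rewrite ltr_wpDl.
apply: le_trans (key (e / (`|I| + 1)) (divr_gt0 e0 I0)) _.
rewrite mulrAC ler_pdivrMr// ler_wpM2l//; first exact: ltW.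
by rewrite (le_trans (ler_norm _))// lerDl.
Qed.

Lemma itv_continuous_measurable F a b :
  (forall x, a <= x <= b -> {for x, continuous F}) -> measurable_fun `[a, b] F.
Proof.
move=> cF; apply: subspace_continuous_measurable_fun => //.
by apply: continuous_in_subspaceT => x; rewrite inE/= in_itv/=; exact: cF.
Qed.

Lemma itv_continuous_bounded F a b :
  (forall x, a <= x <= b -> {for x, continuous F}) ->
  exists M, forall x, a <= x <= b -> `|F x| <= M.
Proof.
move=> cF; have [ba|ab] := ltP b a.
  by exists 0 => x /andP[ax xb]; have := le_trans ax xb; rewrite leNgt ba.
have cN : {within `[a, b], continuous (fun x => `|F x|)}.
  apply: continuous_in_subspaceT => x; rewrite inE/= in_itv/= => /cF cFx.
  exact: cvg_norm.
have [c _ Hc] := EVT_max ab cN.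
by exists `|F c| => x xab; apply: Hc; rewrite in_itv.
Qed.

Lemma itv_continuous_integrable F a b :
  (forall x, a <= x <= b -> {for x, continuous F}) ->
  mu.-integrable `[a, b] (EFin \o F).
Proof.
move=> cF; apply: continuous_compact_integrable; first exact: segment_compact.
by apply: continuous_in_subspaceT => x; rewrite inE/= in_itv/=; exact: cF.
Qed.

Lemma itv_continuous_integrableM F f a b :
  (forall x, a <= x <= b -> {for x, continuous F}) ->
  mu.-integrable `[a, b] (EFin \o f) ->
  mu.-integrable `[a, b] (EFin \o (fun x => f x * F x)).
Proof.
move=> cF fi; have [M HM] := itv_continuous_bounded cF.
apply: (@integrableRM_bounded _ _ _ mu _ _ _ M) => //.
exact: itv_continuous_measurable.
Qed.

Lemma is_primitiveM F f H h : is_primitive f F -> is_primitive h H ->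
  is_primitive (fun x => f x * H x + h x * F x) (fun x => F x * H x).
Proof.
move=> fF hH.
have cF a b x : 0 < a -> b < 1 -> a <= x <= b -> {for x, continuous F}.
  move=> a0 b1 /andP[ax xb]; apply: (is_primitive_continuous fF).
  by rewrite (lt_le_trans a0 ax) (le_lt_trans xb b1).
have cH a b x : 0 < a -> b < 1 -> a <= x <= b -> {for x, continuous H}.
  move=> a0 b1 /andP[ax xb]; apply: (is_primitive_continuous hH).
  by rewrite (lt_le_trans a0 ax) (le_lt_trans xb b1).
have fi a b : 0 < a -> a <= b -> b < 1 -> mu.-integrable `[a, b] (EFin \o f).
  by move=> a0 ab b1; have [] := fF a b a0 ab b1.
have hi a b : 0 < a -> a <= b -> b < 1 -> mu.-integrable `[a, b] (EFin \o h).
  by move=> a0 ab b1; have [] := hH a b a0 ab b1.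
have fHi a b : 0 < a -> a <= b -> b < 1 -> mu.-integrable `[a, b] (EFin \o (fun x => f x * H x)).
  by move=> a0 ab b1; apply: itv_continuous_integrableM; [move=> x; exact: cH|exact: fi].
have hFi a b : 0 < a -> a <= b -> b < 1 -> mu.-integrable `[a, b] (EFin \o (fun x => h x * F x)).
  by move=> a0 ab b1; apply: itv_continuous_integrableM; [move=> x; exact: cF|exact: hi].
apply: is_primitive_of_local => [a b a0 /ltW ab b1|a b a0 /ltW ab b1].
  by apply: integrableRD; [|exact: fHi|exact: hFi].
exists (fun x => `|f x| + `|h x|).
  by apply: integrableRD => //; apply: integrable_norm => //; [exact: fi|exact: hi].
move=> e e0.
have [d1 d10 H1] := itv_unif_continuous (fun x => @cF a b x a0 b1) e0.
have [d2 d20 H2] := itv_unif_continuous (fun x => @cH a b x a0 b1) e0.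
exists (Num.min d1 d2); first by rewrite lt_min d10.
move=> x y ax xy yb; rewrite lt_min => /andP[xy1 xy2].
have x0 : 0 < x by exact: lt_le_trans ax.
have y1 : y < 1 by exact: le_lt_trans yb b1.
have [_ EF] := fF x y x0 xy y1; have [_ EH] := hH x y x0 xy y1.
have fxy := fi x y x0 xy y1; have hxy := hi x y x0 xy y1.
rewrite (_ : F y * H y - F x * H x = (F y - F x) * H x + (H y - H x) * F y); last by ring.
rewrite EF EH -!RintegralZr// -RintegralD//; last 2 first.
- by apply: (@integrableRM_bounded _ _ _ mu _ _ (fun=> H x) `|H x|).
- by apply: (@integrableRM_bounded _ _ _ mu _ _ (fun=> F y) `|F y|).
have i1 : mu.-integrable `[x, y] (EFin \o (fun t => f t * H x + h t * F y)).
  apply: integrableRD => //.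
  - by apply: (@integrableRM_bounded _ _ _ mu _ _ (fun=> H x) `|H x|).
  - by apply: (@integrableRM_bounded _ _ _ mu _ _ (fun=> F y) `|F y|).
have i2 : mu.-integrable `[x, y] (EFin \o (fun t => f t * H t + h t * F t)).
  by apply: integrableRD => //; [exact: fHi|exact: hFi].
have i3 : mu.-integrable `[x, y] (EFin \o (fun t => `|f t| + `|h t|)).
  by apply: integrableRD => //; apply: integrable_norm.
rewrite -RintegralB// -RintegralZl//.
apply: le_trans (le_normr_Rintegral _ _) _ => //.
  exact: integrableRB.
apply: le_Rintegral => //.
- by apply: integrable_norm => //; exact: integrableRB.
- exact: integrableRZl.
move=> t /=; rewrite in_itv/= => /andP[xt ty].
rewrite (_ : f t * H x + h t * F y - _ = f t * (H x - H t) + h t * (F y - F t)); last by ring.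
rewrite (le_trans (ler_normD _ _))// !normrM mulrDr ![e * _]mulrC lerD// ler_wpM2l//.
  apply/ltW/H2; first by rewrite ax (le_trans xy).
  by rewrite distrC ger0_norm ?subr_ge0//; apply: le_lt_trans xy2; lra.
apply/ltW/H1; first by rewrite yb (le_trans ax).
by rewrite ger0_norm ?subr_ge0//; apply: le_lt_trans xy1; lra.
Qed.

(** Chain rule. The mean value theorem produces a value between F(x) and F(y), the intermediate
    value theorem places it at a point z of [x, y], and uniform continuity of phi' o F replaces z by
    the running point. Only positive arguments of phi matter, since powers are the intended use. *)
Lemma is_primitive_comp (phi dphi : R -> R) F f :
  (forall y : R, 0 < y -> is_derive y 1 phi (dphi y)) ->
  (forall y : R, 0 < y -> {for y, continuous dphi}) ->
  (forall x : R, 0 < x < 1 -> 0 < F x) -> is_primitive f F ->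
  is_primitive (fun x => f x * dphi (F x)) (fun x => phi (F x)).
Proof.
move=> dphiE cdphi F0 fF.
have cF x : 0 < x < 1 -> {for x, continuous F} by exact: is_primitive_continuous fF.
have cdF a b x : 0 < a -> b < 1 -> a <= x <= b -> {for x, continuous (dphi \o F)}.
  move=> a0 b1 /andP[ax xb].
  have x01 : 0 < x < 1 by rewrite (lt_le_trans a0 ax) (le_lt_trans xb b1).
  by apply: continuous_comp; [exact: cF|exact/cdphi/F0].
have fi a b : 0 < a -> a <= b -> b < 1 -> mu.-integrable `[a, b] (EFin \o f).
  by move=> a0 ab b1; have [] := fF a b a0 ab b1.
have fdi a b : 0 < a -> a <= b -> b < 1 ->
    mu.-integrable `[a, b] (EFin \o (fun x => f x * dphi (F x))).
  move=> a0 ab b1; apply: (@itv_continuous_integrableM (dphi \o F)); last exact: fi.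
  by move=> x; exact: cdF.
apply: is_primitive_of_local => [a b a0 /ltW ab b1|a b a0 /ltW ab b1]; first exact: fdi.
exists (fun x => `|f x|); first by apply: integrable_norm => //; exact: fi.
move=> e e0.
have [d d0 Hd] := itv_unif_continuous (fun x => @cdF a b x a0 b1) e0.
exists d => // x y ax xy yb xyd.
have x0 : 0 < x by exact: lt_le_trans ax.
have y1 : y < 1 by exact: le_lt_trans yb b1.
have x01 : 0 < x < 1 by rewrite x0 (le_lt_trans xy y1).
have y01 : 0 < y < 1 by rewrite (lt_le_trans x0 xy).
have [_ EF] := fF x y x0 xy y1.
have fxy := fi x y x0 xy y1.
have [z zxy Ez] : exists2 z, x <= z <= y & phi (F y) - phi (F x) = dphi (F z) * (F y - F x).
  pose m := Num.min (F x) (F y); pose M := Num.max (F x) (F y).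
  have m0 : 0 < m by rewrite lt_min !F0.
  have mM : m <= M by rewrite le_max ge_min lexx.
  have dm s : s \in `]m, M[ -> is_derive s 1 phi (dphi s).
    by rewrite in_itv/= => /andP[ms _]; apply: dphiE; exact: lt_trans ms.
  have cphi : {within `[m, M], continuous phi}.
    apply: continuous_in_subspaceT => s; rewrite inE/= in_itv/= => /andP[ms _].
    apply: differentiable_continuous; apply/derivable1_diffP.
    by have [] := dphiE s (lt_le_trans m0 ms).
  have [c cmM Ec] := MVT_segment mM dm cphi.
  have cxy : {within `[x, y], continuous F}.
    apply: continuous_in_subspaceT => s; rewrite inE/= in_itv/= => /andP[xs sy].
    by apply: cF; rewrite (lt_le_trans x0 xs) (le_lt_trans sy y1).
  have [z zxy Fz] : exists2 z, z \in `[x, y] & F z = c.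
    by apply: IVT => //; move: cmM; rewrite in_itv.
  exists z; first by move: zxy; rewrite in_itv.
  rewrite Fz; move: Ec; rewrite /m /M; case: (leP (F x) (F y)) => // _ Ec.
  by rewrite -opprB Ec; ring.
case/andP: zxy => xz zy.
have i1 : mu.-integrable `[x, y] (EFin \o (fun t => f t * dphi (F z))).
  by apply: (@integrableRM_bounded _ _ _ mu _ _ (fun=> dphi (F z)) `|dphi (F z)|).
have i2 := fdi x y x0 xy y1.
rewrite Ez EF mulrC -RintegralZr// -RintegralB// -RintegralZl//; last exact: integrable_norm.
apply: le_trans (le_normr_Rintegral _ _) _ => //.
  exact: integrableRB.
apply: le_Rintegral => //.
- by apply: integrable_norm => //; exact: integrableRB.
- by apply: integrableRZl => //; exact: integrable_norm.
move=> t /=; rewrite in_itv/= => /andP[xt ty].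
rewrite -mulrBr normrM mulrC ler_wpM2r//.
apply/ltW/Hd; first by rewrite (le_trans ax xz) (le_trans zy yb).
by apply: le_lt_trans xyd; rewrite ler_norml; apply/andP; split; lra.
Qed.

Lemma is_primitive_derive f F : (forall x : R, is_derive x 1 F (f x)) -> continuous f ->
  is_primitive f F.
Proof.
move=> fF cf a b a0; rewrite le_eqVlt => /predU1P[<- b1|ab b1].
  split; last by rewrite set_itv1 Rintegral_set1 subrr.
  by apply: itv_continuous_integrable => x _; exact: cf.
have cF : continuous F.
  move=> x; apply: differentiable_continuous; apply/derivable1_diffP.
  by have [] := fF x.
split; first by apply: itv_continuous_integrable => x _; exact: cf.
rewrite /Rintegral (@continuous_FTC2 _ _ F)//.
- exact: continuous_subspaceT.
- split.
  + by move=> x _; have [] := fF x.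
  + by apply: cvg_at_right_filter; exact: cF.
  + by apply: cvg_at_left_filter; exact: cF.
- by move=> x _; rewrite derive1E; have [_ ->] := fF x.
Qed.

Lemma is_primitive_ae f g F : is_primitive f F -> measurable_fun Omega g ->
  {ae mu, forall x, Omega x -> f x = g x} -> is_primitive g F.
Proof.
move=> fF mg fg a b a0 ab b1; have [fi ->] := fF a b a0 ab b1.
have sub : `[a, b] `<=` Omega.
  move=> x; rewrite /Omega /= !in_itv/= => /andP[ax xb].
  by rewrite (lt_le_trans a0 ax) (le_lt_trans xb b1).
have fgab : {ae mu, forall x, `[a, b]%classic x -> f x = g x}.
  by apply: ae_mono fg => x H /sub; exact: H.
have mgab : measurable_fun `[a, b] g by apply: measurable_funS mg => //; exact: measurable_itv.
split; first exact: ae_eq_integrableR fi.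
by apply: ae_eq_Rintegral => //; exact: integrable_measurableR fi.
Qed.

Lemma Rintegral_Omega_compact f a b : 0 < a -> a <= b -> b < 1 ->
  (forall x, Omega x -> ~~ (a <= x <= b) -> f x = 0) ->
  \int[mu]_(x in Omega) f x = \int[mu]_(x in `[a, b]) f x.
Proof.
move=> a0 ab b1 f0; rewrite Rintegral_mkcond [RHS]Rintegral_mkcond.
apply: eq_Rintegral => x _; rewrite !patchE.
case: ifPn => xO; case: ifPn => // xab.
  by apply: f0; [exact: set_mem|apply: contra xab => h; rewrite inE/= in_itv].
move: xO; rewrite notin_setE => xO; exfalso; apply: xO.
move: xab; rewrite inE/= /Omega/= !in_itv/= => /andP[ax xb].
by rewrite (lt_le_trans a0 ax) (le_lt_trans xb b1).
Qed.

Lemma is_primitive_compact f F a b : is_primitive f F -> 0 < a -> a <= b -> b < 1 ->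
  (forall x, Omega x -> ~~ (a < x < b) -> F x = 0 /\ f x = 0) ->
  \int[mu]_(x in Omega) f x = 0.
Proof.
move=> fF a0 ab b1 out.
rewrite (Rintegral_Omega_compact a0 ab b1); last first.
  move=> x Ox xab; apply: (out x Ox _).2; apply: contra xab => /andP[ax xb].
  by rewrite !ltW.
have [_ <-] := fF a b a0 ab b1.
have Oa : Omega a by rewrite /Omega/= in_itv/= a0 (le_lt_trans ab).
have Ob : Omega b by rewrite /Omega/= in_itv/= b1 (lt_le_trans a0).
have /(out a Oa)[-> _] : ~~ (a < a < b) by rewrite ltxx.
have /(out b Ob)[-> _] : ~~ (a < b < b) by rewrite ltxx andbF.
by rewrite subrr.
Qed.

End Primitives.

(** * The lemma of du Bois-Reymond for a countable family of test functions *)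

Section DuBoisReymond.
Context {R : realType}.
Local Notation mu := (@lebesgue_measure R).
Implicit Types (f g h F H D V v w : R -> R) (a b c d x : R).

Lemma OmegaP x : (Omega x : Prop) = (0 < x < 1 : bool).
Proof. by rewrite /Omega/= in_itv. Qed.

Lemma measurable_Omega : measurable (Omega : set R).
Proof. exact: measurable_itv. Qed.

Lemma subset_itv_Omega a b : 0 < a -> b < 1 -> `[a, b] `<=` Omega.
Proof.
move=> a0 b1 x; rewrite OmegaP /= in_itv/= => /andP[ax xb].
by rewrite (lt_le_trans a0 ax) (le_lt_trans xb b1).
Qed.

(** The extreme values of [p] on [K] are attained, so strict bounds leave room. A general [p] serves
    both coordinate projections of the plane. *)
Lemma compact_sub_itv (T : topologicalType) (K : set T) (p : T -> R) c d :
  continuous p -> compact K -> c < d -> (forall z, K z -> c < p z < d) ->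
  exists a b, [/\ c < a, a <= b, b < d & forall z, K z -> a <= p z <= b].
Proof.
move=> cp cK cd Kcd; have [->|/set0P K0] := eqVneq K set0.
  by exists ((c + d) / 2), ((c + d) / 2); split => //; lra.
have cpK : {within K, continuous p} by exact: continuous_subspaceT.
have [x xK Hx] := compact_EVT_min K0 cK cpK.
have [y yK Hy] := compact_EVT_max K0 cK cpK.
have /andP[cx _] := Kcd x (set_mem xK); have /andP[_ yd] := Kcd y (set_mem yK).
exists (p x), (p y); split => //; first exact: Hx.
by move=> z /mem_set zK; rewrite Hx ?Hy.
Qed.

Lemma compact_sub_Omega (K : set R) : compact K -> K `<=` Omega ->
  exists a b, [/\ 0 < a, a <= b, b < 1 & forall x, K x -> a <= x <= b].
Proof.
move=> cK KO; apply: (@compact_sub_itv _ K id 0 1) => //.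
by move=> x; exact: cvg_id.
Qed.

Lemma locally_integrable_itv f a b : locally_integrable Omega f -> 0 < a -> b < 1 ->
  mu.-integrable `[a, b] (EFin \o f).
Proof.
move=> [mf _ H] a0 b1; have sub := subset_itv_Omega a0 b1.
apply/integrableP; split.
  by apply/measurable_EFinP; apply: measurable_funS mf => //; exact: measurable_Omega.
by apply: H => //; exact: segment_compact.
Qed.

Lemma itv_locally_integrable f : measurable_fun Omega f ->
  (forall a b, 0 < a -> a <= b -> b < 1 -> mu.-integrable `[a, b] (EFin \o f)) ->
  locally_integrable Omega f.
Proof.
move=> mf H; split; [exact: mf|by rewrite /Omega; exact: interval_open|].
move=> K KO cK.
have [a [b [a0 ab b1 Kab]]] := compact_sub_Omega cK KO.
have /integrableP[mfab] := H a b a0 ab b1; apply: le_lt_trans.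
apply: ge0_subset_integral => //.
- exact: compact_measurable.
- by apply/measurable_EFinP; apply: measurableT_comp => //; exact/measurable_EFinP.
Qed.

(** Integration by parts: F psi is locally absolutely continuous with compact support, so its
    derivative has integral 0. *)
Lemma is_primitive_weak_deriv f F v w : is_primitive f F ->
  measurable_fun Omega v -> measurable_fun Omega w ->
  {ae mu, forall x, Omega x -> v x = F x} ->
  {ae mu, forall x, Omega x -> w x = f x} -> weak_deriv v w.
Proof.
move=> fF mv mw vF wf.
have mO := measurable_Omega.
have cF x : 0 < x < 1 -> {for x, continuous F} by exact: is_primitive_continuous fF.
have wF : is_primitive w F.
  by apply: is_primitive_ae fF mw _; apply: ae_mono wf => x + Ox => ->.
have cFab a b x : 0 < a -> b < 1 -> a <= x <= b -> {for x, continuous F}.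
  by move=> a0 b1 /(subset_itv_Omega a0 b1); rewrite OmegaP; exact: cF.
have Fi a b : 0 < a -> a <= b -> b < 1 -> mu.-integrable `[a, b] (EFin \o F).
  by move=> a0 ab b1; apply: itv_continuous_integrable => x; exact: cFab.
have vi a b : 0 < a -> a <= b -> b < 1 -> mu.-integrable `[a, b] (EFin \o v).
  move=> a0 ab b1; apply: (ae_eq_integrableR _ _ _ (Fi a b a0 ab b1)) => //.
    by apply: measurable_funS mv => //; exact: subset_itv_Omega.
  by apply: ae_mono vF => x H xab; rewrite H//; exact: subset_itv_Omega xab.
split.
- exact: itv_locally_integrable.
- by apply: itv_locally_integrable => // a b a0 ab b1; have [] := wF a b a0 ab b1.
move=> psi [spsi [K [cK KO Kpsi]]].
have [a [b [a0 ab b1 Kab]]] := compact_sub_Omega cK KO.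
(* The enlarged interval leaves a margin: off ]a', b'[ the function [psi] vanishes on a
   neighbourhood of each point, so its derivative vanishes there too. *)
pose a' := a / 2; pose b' := (b + 1) / 2.
have a'0 : 0 < a' by rewrite divr_gt0.
have b'1 : b' < 1 by rewrite /b'; lra.
have a'a : a' < a by rewrite /a'; lra.
have bb' : b < b' by rewrite /b'; lra.
have a'b' : a' <= b' by apply/ltW/(lt_trans a'a)/(le_lt_trans ab).
have psi0 x : Omega x -> ~~ (a <= x <= b) -> psi x = 0.
  by move=> Ox xab; apply: Kpsi => // /Kab; exact/negP.
have dpsi0 x : Omega x -> ~~ (a' < x < b') -> derive1 psi x = 0.
  move=> Ox xab; rewrite -(@derive1_cst R R 0 x) !derive1E.
  apply: near_eq_derive.
  move: (Ox); rewrite OmegaP => /andP[x0 x1].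
  move: xab; rewrite negb_and -!leNgt => /orP[xa|bx].
    near=> y; apply: psi0.
      rewrite OmegaP; apply/andP; split; near: y; [exact: lt_nbhsr|exact: lt_nbhsl].
    rewrite negb_and -!ltNge; apply/orP; left; near: y.
    by apply: lt_nbhsl; exact: le_lt_trans a'a.
  near=> y; apply: psi0.
    rewrite OmegaP; apply/andP; split; near: y; [exact: lt_nbhsr|exact: lt_nbhsl].
  rewrite negb_and -!ltNge; apply/orP; right; near: y.
  by apply: lt_nbhsr; exact: lt_le_trans bx.
have psi0' x : Omega x -> ~~ (a' < x < b') -> psi x = 0.
  move=> Ox xab; apply: psi0 => //; apply: contra xab => /andP[ax xb].
  by rewrite (lt_le_trans a'a) ?(le_lt_trans xb).
have ppsi : is_primitive (derive1 psi) psi.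
  apply: is_primitive_derive; last exact/smooth1_continuous/smooth1_derive1.
  by move=> x; rewrite derive1E; apply/derivableP; exact: smooth1_derivable.
have := is_primitive_compact (is_primitiveM wF ppsi) a'0 a'b' b'1.
move=> /(_ _)/wrap[].
  by move=> x Ox xab; rewrite psi0'// dpsi0// !mulr0 mul0r addr0.
have cpsi := smooth1_continuous spsi.
have cdpsi := smooth1_continuous (smooth1_derive1 spsi).
have iw := itv_continuous_integrableM (fun x (_ : a' <= x <= b') => cpsi x)
  (wF a' b' a'0 a'b' b'1).1.
have iF := itv_continuous_integrableM (fun x (_ : a' <= x <= b') => cdpsi x)
  (Fi a' b' a'0 a'b' b'1).
have iv := itv_continuous_integrableM (fun x (_ : a' <= x <= b') => cdpsi x)
  (vi a' b' a'0 a'b' b'1).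
have out x : ~~ (a' <= x <= b') -> ~~ (a' < x < b').
  by apply: contra => /andP[ax xb]; rewrite !ltW.
rewrite !(Rintegral_Omega_compact a'0 a'b' b'1); first last.
- by move=> x Ox /out xab; rewrite psi0'// dpsi0// mulr0 mul0r addr0.
- by move=> x Ox /out xab; rewrite dpsi0// mulr0.
- by move=> x Ox /out xab; rewrite psi0'// mulr0.
under eq_Rintegral do rewrite (mulrC (derive1 psi _)).
rewrite RintegralD// => /eqP; rewrite addrC addr_eq0 => /eqP <-.
apply: ae_eq_Rintegral => //; [exact: integrable_measurableR iv|exact: integrable_measurableR iF|].
apply: ae_mono vF => x H xab; rewrite H//; exact: subset_itv_Omega xab.
Unshelve. all: by end_near. Qed.

Lemma flat_exp_mono x y : x <= y -> flat_exp x <= flat_exp y.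
Proof.
move=> xy; rewrite /flat_exp; case: ifPn => x0; last by case: ifP => // _; exact: expR_ge0.
by rewrite (lt_le_trans x0 xy) ler_expR lerN2 lef_pV2// posrE (lt_le_trans x0).
Qed.

Lemma flat_bump_integrable a b j : mu.-integrable setT (EFin \o flat_bump a b j).
Proof.
apply: (@le_integrableR _ _ _ mu _ _ (\1_(`]a, b[%classic))) => //.
- exact: flat_bump_measurable.
- move=> x _; rewrite indicE; case: (boolP (a < x < b)) => xab.
    rewrite mem_set/= ?in_itv//= ger0_norm ?flat_bump_ge0//; exact: flat_bump_le1.
  by rewrite flat_bump_out// normr0.
- exact: integrable_indic_itv.
Qed.

Definition ref_bump : R -> R := flat_bump (1/4) (3/4) 1.

Lemma ref_bump_int_gt0 : 0 < \int[mu]_x ref_bump x.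
Proof.
(* On [3/8, 5/8] the distances to 1/4 and 3/4 are both at least 1/8, and [flat_exp] is
   nondecreasing. *)
pose m : R := flat_exp (1/8) * flat_exp (1/8).
have m0 : 0 < m by rewrite mulr_gt0// flat_exp_gt0.
have mu8 : mu `[3/8, 5/8]%classic = (1/4)%:E.
  rewrite [LHS]lebesgue_measure_itv/= lte_fin ifT; last by lra.
  by rewrite -EFinB; congr (_%:E); lra.
have : \int[mu]_x ((fun=> m) \_ `[3/8, 5/8]) x <= \int[mu]_x ref_bump x.
  apply: le_Rintegral => //; last first.
  - move=> x _; rewrite patchE; case: ifPn => [|_]; last exact: flat_bump_ge0.
    rewrite inE/= in_itv/= => /andP[x1 x2].
    by apply: ler_pM; rewrite ?flat_exp_ge0//; apply: flat_exp_mono; lra.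
  - exact: flat_bump_integrable.
  - rewrite -restrict_EFin; apply: (integrable_mkcond _ _).1 => //.
    apply: itv_continuous_integrable => x _; exact: cvg_cst.
rewrite -Rintegral_mkcond Rintegral_cst//; apply: lt_le_trans.
rewrite [X in fine X]mu8 /=.
by rewrite mulr_gt0//; lra.
Qed.

(* Subtracting a multiple of a fixed bump makes the mean vanish, so that the
   primitive is a test function. *)
Definition mean0_bump a b j x : R := flat_bump a b j x -
  (\int[mu]_y flat_bump a b j y) / (\int[mu]_y ref_bump y) * ref_bump x.

Definition bump_primitive a b j x : R := \int[mu]_(y in `]-oo, x]) mean0_bump a b j y.

Lemma mean0_bump_integrable a b j : mu.-integrable setT (EFin \o mean0_bump a b j).
Proof.
apply: integrableRB => //; first exact: flat_bump_integrable.
by apply: integrableRZl => //; exact: flat_bump_integrable.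
Qed.

Lemma mean0_bump_int a b j : \int[mu]_x mean0_bump a b j x = 0.
Proof.
rewrite RintegralB//; last 2 first.
- exact: flat_bump_integrable.
- by apply: integrableRZl => //; exact: flat_bump_integrable.
rewrite RintegralZl//; last exact: flat_bump_integrable.
by rewrite divfK ?subrr// gt_eqF// ref_bump_int_gt0.
Qed.

Lemma smooth1_mean0_bump a b j : smooth1 (mean0_bump a b j).
Proof.
rewrite (_ : mean0_bump a b j = fun x => flat_bump a b j x + (fun y =>
    - ((\int[mu]_y flat_bump a b j y) / (\int[mu]_y ref_bump y))) x * ref_bump x).
  apply: smooth1D; first exact: smooth1_flat_bump.
  by apply: smooth1M; [exact: smooth1_cst|exact: smooth1_flat_bump].
by apply/funext => x; rewrite mulNr.
Qed.

Lemma mean0_bump_out a b j x : ~~ (Num.min a (1/4) < x < Num.max b (3/4)) ->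
  mean0_bump a b j x = 0.
Proof.
move=> H; rewrite /mean0_bump /ref_bump !flat_bump_out ?mulr0 ?subrr//.
  by apply: contra H => /andP[h1 h2]; rewrite gt_min lt_max h1 h2 !orbT.
by apply: contra H => /andP[h1 h2]; rewrite gt_min lt_max h1 h2.
Qed.

Lemma bump_primitive_derive a b j x :
  is_derive x 1 (bump_primitive a b j) (mean0_bump a b j x).
Proof.
have cb := smooth1_continuous (@smooth1_mean0_bump a b j).
have x1 : x < x + 1 by rewrite ltrDl.
have ib : mu.-integrable `]-oo, (x + 1)] (EFin \o mean0_bump a b j).
  by apply: integrableS (mean0_bump_integrable a b j) => //; exact: measurableT.
have xoo : (-oo < x%:E)%E by rewrite ltNyr.
have [d1 d2] := @continuous_FTC1 R (mean0_bump a b j) -oo%O x (x + 1) x1 ib xoo (cb x).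
by apply: DeriveDef; [exact: d1|rewrite -derive1E; exact: d2].
Qed.

Lemma bump_primitive_out a b j x : ~~ (Num.min a (1/4) < x < Num.max b (3/4)) ->
  bump_primitive a b j x = 0.
Proof.
move=> xab; rewrite /bump_primitive Rintegral_mkcond.
move: xab; rewrite negb_and -!leNgt => /orP[xa|bx].
  rewrite -[RHS](@Rintegral_set0 _ _ _ mu (fun=> 0)) [RHS]Rintegral_mkcond.
  apply: eq_Rintegral => y _; rewrite !patchE in_set0; case: ifPn => //.
  rewrite inE/= in_itv/= => yx; rewrite mean0_bump_out// negb_and -!leNgt.
  by rewrite (le_trans yx xa).
rewrite -(mean0_bump_int a b j); apply: eq_Rintegral => y _; rewrite patchE.
case: ifPn => //; rewrite notin_setE/= in_itv/= => /negP; rewrite -ltNge => xy.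
by rewrite mean0_bump_out// negb_and -!leNgt (le_trans bx (ltW xy)) orbT.
Qed.

Lemma smooth1_bump_primitive a b j : smooth1 (bump_primitive a b j).
Proof.
apply: (@smooth1_primitive _ _ (mean0_bump a b j)).
  exact: bump_primitive_derive.
exact: smooth1_mean0_bump.
Qed.

Lemma test1_bump_primitive a b j : 0 < a -> b < 1 -> test1 (bump_primitive a b j).
Proof.
move=> a0 b1; split; first exact: smooth1_bump_primitive.
exists `[Num.min a (1/4), Num.max b (3/4)]%classic; split.
- exact: segment_compact.
- by apply: subset_itv_Omega; rewrite ?lt_min ?gt_max ?a0 ?b1/=; lra.
- move=> x _ /=; rewrite in_itv/= => /negP xab; apply: bump_primitive_out.
  by apply: contra xab => /andP[h1 h2]; rewrite !ltW.
Qed.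

(** The primitive is continuous and rationals are dense, so rational endpoints decide all intervals.
    This is what allows a countable family of tests. *)
Lemma eq0_of_rat_itv f a b : mu.-integrable `[a, b] (EFin \o f) ->
  (forall p q : rat, a < ratr p -> (ratr p : R) < ratr q -> ratr q < b ->
     \int[mu]_(x in `[ratr p, ratr q]) f x = 0) ->
  {ae mu, forall x, a < x < b -> f x = 0}.
Proof.
move=> fi H; apply: ae_eq0_of_itv => // c d ac cd db.
pose Phi (x : R) := \int[mu]_(y in `[a, x]) f y.
have ab : a < b by exact/(lt_trans ac)/(lt_trans cd).
have PhiE x y : a < x -> x <= y -> y < b -> \int[mu]_(t in `[x, y]) f t = Phi y - Phi x.
  move=> ax xy yb; rewrite /Phi (@Rintegral_split _ f a x y) ?(ltW ax)//.
    by rewrite addrC addKr.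
  by apply: integrable_subitv fi => //; exact: ltW.
rewrite PhiE ?(ltW cd)//.
have near_rat x (e : R) : a < x < b -> 0 < e ->
    exists2 q : rat, a < ratr q < b & `|Phi x - Phi (ratr q)| < e.
  move=> axb e0; have /andP[ax xb] := axb.
  have /cvgrPdist_lt/(_ e e0)/nbhs_ballP[r /= r0 Hr] := primitive_continuous fi axb.
  have : x < Num.min (x + r) b by rewrite lt_min xb ltrDl r0.
  move=> /rat_in_itvoo[q]; rewrite in_itv/= lt_min => /and3P[xq qr qb].
  exists q; first by rewrite qb (lt_trans ax).
  by apply: Hr; rewrite /ball/= distrC gtr0_norm ?subr_gt0// ltrBlDl.
apply/eqP; rewrite -normr_eq0 eq_le normr_ge0 andbT; apply/ler_addgt0Pl => e e0.
have e20 : 0 < e / 2 by rewrite divr_gt0.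
have [p /andP[ap pb] Hp] := near_rat c (e / 2) (introT andP (conj ac (lt_trans cd db))) e20.
have [q /andP[aq qb] Hq] := near_rat d (e / 2) (introT andP (conj (lt_trans ac cd) db)) e20.
have Epq : Phi (ratr p) = Phi (ratr q).
  have [pq|qp|->//] := ltgtP (ratr p : R) (ratr q).
    by apply/esym/eqP; rewrite -subr_eq0 -PhiE ?(ltW pq)// H.
  by apply/eqP; rewrite -subr_eq0 -PhiE ?(ltW qp)// H.
rewrite addr0 (_ : _ - _ = (Phi d - Phi (ratr q)) - (Phi c - Phi (ratr p))); last first.
  by rewrite Epq; ring.
rewrite (le_trans (ler_normB _ _))// (splitr e); apply: lerD; exact: ltW.
Qed.

(** The base point is 1/2, since [f] may fail to be integrable up to 0 or 1. Integrals over reversed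
    intervals are 0, so one formula covers both sides. *)
Lemma is_primitive_exists f :
  (forall a b, 0 < a -> a <= b -> b < 1 -> mu.-integrable `[a, b] (EFin \o f)) ->
  exists F, is_primitive f F.
Proof.
move=> fi.
exists (fun x => \int[mu]_(t in `[1/2, x]) f t - \int[mu]_(t in `[x, 1/2]) f t).
have z x y : x <= y -> \int[mu]_(t in `[y, x]) f t = 0.
  rewrite le_eqVlt => /predU1P[->|xy]; first by rewrite set_itv1 Rintegral_set1.
  by rewrite set_itv_ge ?Rintegral_set0// bnd_simp -ltNge.
move=> a b a0 ab b1; split; first exact: fi.
have [ha|ha] := leP (1/2) a; have [hb|hb] := leP (1/2) b.
- rewrite (z _ _ ha) (z _ _ hb) !subr0 (@Rintegral_split _ f (1/2) a b)//.
    by rewrite addrC addKr.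
  by apply: fi => //; lra.
- by move: (le_lt_trans ab hb); rewrite ltNge ha.
- rewrite (z _ _ (ltW ha)) (z _ _ hb) subr0 sub0r opprK.
  rewrite (@Rintegral_split _ f a (1/2) b) ?(ltW ha)//; first by rewrite addrC.
  exact: fi.
- rewrite (z _ _ (ltW ha)) (z _ _ (ltW hb)) !sub0r opprK addrC.
  rewrite (@Rintegral_split _ f a b (1/2)) ?(ltW hb)// ?addrK//.
  by apply: fi => //; lra.
Qed.

(** With F a primitive of [h], the difference V - F is orthogonal to every mean-zero bump, hence V -
    F - c is orthogonal to the plain bumps for a suitable constant c. Letting the bumps sharpen, its
    integral over every rational interval vanishes. *)
Lemma du_bois_reymond V h :
  (forall a b, 0 < a -> a <= b -> b < 1 -> mu.-integrable `[a, b] (EFin \o V)) ->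
  (forall a b, 0 < a -> a <= b -> b < 1 -> mu.-integrable `[a, b] (EFin \o h)) ->
  (forall (p q : rat) j, 0 < ratr p :> R -> (ratr p : R) < ratr q -> ratr q < 1 :> R ->
    \int[mu]_(x in Omega) (V x * mean0_bump (ratr p) (ratr q) j x) =
    - \int[mu]_(x in Omega) (h x * bump_primitive (ratr p) (ratr q) j x)) ->
  exists F, is_primitive h F /\ {ae mu, forall x, Omega x -> V x = F x}.
Proof.
move=> Vi hi H; have [F hF] := is_primitive_exists hi.
have cF a b x : 0 < a -> b < 1 -> a <= x <= b -> {for x, continuous F}.
  by move=> a0 b1 /(subset_itv_Omega a0 b1); rewrite OmegaP; exact: is_primitive_continuous hF.
have Fi a b : 0 < a -> a <= b -> b < 1 -> mu.-integrable `[a, b] (EFin \o F).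
  by move=> a0 ab b1; apply: itv_continuous_integrable => x; exact: cF.
pose M x := V x - F x.
have Mi a b : 0 < a -> a <= b -> b < 1 -> mu.-integrable `[a, b] (EFin \o M).
  by move=> a0 ab b1; apply: integrableRB => //; [exact: Vi|exact: Fi].
(* The constant of integration is the mean of M weighted by the reference bump, which undoes the
   mean-zero correction of the tests. *)
pose c := (\int[mu]_(x in `[1/4, 3/4]) (M x * ref_bump x)) / \int[mu]_x ref_bump x.
have key (p q : rat) j : 0 < ratr p :> R -> (ratr p : R) < ratr q -> ratr q < 1 :> R ->
    \int[mu]_(x in `[ratr p, ratr q]) ((M x - c) * flat_bump (ratr p) (ratr q) j x) = 0.
  move=> p0 pq q1; set a : R := ratr p in p0 pq *; set b : R := ratr q in pq q1 *.
  pose a' := Num.min a (1/4); pose b' := Num.max b (3/4).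
  have a'0 : 0 < a' by rewrite lt_min p0; lra.
  have b'1 : b' < 1 by rewrite gt_max q1; lra.
  have a'b' : a' <= b' by rewrite ge_min le_max (ltW pq).
  set s := mean0_bump a b j; set P := bump_primitive a b j.
  have cs : continuous s by exact/smooth1_continuous/smooth1_mean0_bump.
  have cP : continuous P by exact/smooth1_continuous/smooth1_bump_primitive.
  have Ps : is_primitive s P by apply: is_primitive_derive => // x; exact: bump_primitive_derive.
  have out x : ~~ (a' <= x <= b') -> ~~ (a' < x < b').
    by apply: contra => /andP[h1 h2]; rewrite !ltW.
  have := is_primitive_compact (is_primitiveM hF Ps) a'0 a'b' b'1.
  move=> /(_ _)/wrap[].
    by move=> x _ xab; rewrite /s /P mean0_bump_out// bump_primitive_out// !mulr0 mul0r addr0.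
  have iF := itv_continuous_integrableM (fun x (_ : a' <= x <= b') => cs x) (Fi a' b' a'0 a'b' b'1).
  have iV := itv_continuous_integrableM (fun x (_ : a' <= x <= b') => cs x) (Vi a' b' a'0 a'b' b'1).
  have ih := itv_continuous_integrableM (fun x (_ : a' <= x <= b') => cP x) (hi a' b' a'0 a'b' b'1).
  have := H p q j p0 pq q1; rewrite -/a -/b -/s -/P.
  rewrite !(Rintegral_Omega_compact a'0 a'b' b'1); first last.
  - by move=> x Ox /out xab; rewrite /s mean0_bump_out// mulr0.
  - by move=> x Ox /out xab; rewrite /P bump_primitive_out// mulr0.
  - by move=> x Ox /out xab; rewrite /s /P mean0_bump_out// bump_primitive_out// mulr0 mul0r addr0.
  move=> EV; under eq_Rintegral do rewrite (mulrC (s _)).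
  rewrite RintegralD// => /eqP; rewrite addrC addr_eq0 => /eqP EF.
  have E0 : \int[mu]_(x in `[a', b']) (M x * s x) = 0.
    under eq_Rintegral do rewrite mulrBl.
    by rewrite RintegralB// EV EF subrr.
  have cr : continuous ref_bump by exact/smooth1_continuous/smooth1_flat_bump.
  have cb : continuous (flat_bump a b j) by exact/smooth1_continuous/smooth1_flat_bump.
  have ir := itv_continuous_integrableM (fun x (_ : a' <= x <= b') => cr x) (Mi a' b' a'0 a'b' b'1).
  have ib := itv_continuous_integrableM (fun x (_ : a' <= x <= b') => cb x) (Mi a' b' a'0 a'b' b'1).
  have shrink f (u v : R) : a' <= u -> v <= b' -> (forall x, ~~ (u < x < v) -> f x = 0) ->
      \int[mu]_(x in `[a', b']) f x = \int[mu]_(x in `[u, v]) f x.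
    move=> au vb f0; rewrite Rintegral_mkcond [RHS]Rintegral_mkcond.
    apply: eq_Rintegral => x _; rewrite !patchE !mem_setE !in_itv/=.
    case: (boolP (u <= x <= v)) => [/andP[ux xv]|xuv].
      by rewrite (le_trans au ux) (le_trans xv vb).
    case: ifP => // _; apply: f0; apply: contra xuv => /andP[h1 h2]; by rewrite !ltW.
  have Eb : \int[mu]_(x in `[a', b']) flat_bump a b j x = \int[mu]_x flat_bump a b j x.
    rewrite Rintegral_mkcond; apply: eq_Rintegral => x _; rewrite patchE.
    case: ifPn => //; rewrite mem_setE in_itv/= => xab; rewrite flat_bump_out//.
    apply: contra xab => /andP[h1 h2].
    by rewrite ge_min le_max (ltW h1) (ltW h2).
  have Er : \int[mu]_(x in `[a', b']) (M x * ref_bump x) = c * \int[mu]_x ref_bump x.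
    rewrite /c divfK ?gt_eqF ?ref_bump_int_gt0//; apply: shrink.
    - by rewrite ge_min lexx orbT.
    - by rewrite le_max lexx orbT.
    - by move=> x xx; rewrite /ref_bump flat_bump_out ?mulr0.
  rewrite -(shrink (fun x => (M x - c) * flat_bump a b j x)); last 3 first.
  - by rewrite ge_min lexx.
  - by rewrite le_max lexx.
  - by move=> x xx; rewrite flat_bump_out ?mulr0.
  under eq_Rintegral do rewrite mulrBl.
  have iB : mu.-integrable `[a', b'] (EFin \o flat_bump a b j).
    by apply: itv_continuous_integrable => x _; exact: cb.
  rewrite RintegralB//; last exact: integrableRZl.
  rewrite RintegralZl// Eb.
  move: E0; rewrite /s /mean0_bump.
  set k := (\int[mu]_y flat_bump a b j y / _).
  under eq_Rintegral do rewrite mulrBr (mulrCA _ k).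
  rewrite RintegralB//; last exact: integrableRZl.
  rewrite RintegralZl// Er => /eqP; rewrite subr_eq0 => /eqP ->.
  rewrite /k; have := ref_bump_int_gt0; move: (\int[mu]_x ref_bump x) => r r0.
  by field; rewrite gt_eqF.
have Mae a b : 0 < a -> a <= b -> b < 1 -> {ae mu, forall x, a < x < b -> M x - c = 0}.
  move=> a0 ab b1.
  have ci : mu.-integrable `[a, b] (EFin \o (fun=> c)).
    by apply: itv_continuous_integrable => x _; exact: cvg_cst.
  have Mci : mu.-integrable `[a, b] (EFin \o (fun x => M x - c)).
    by apply: integrableRB => //; exact: Mi.
  apply: eq0_of_rat_itv => // p q ap pq qb.
  have pqi : mu.-integrable `[ratr p, ratr q] (EFin \o (fun x => M x - c)).
    by apply: integrable_subitv Mci; exact: ltW.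
  have L := flat_bump_limit pqi.
  have L0 : \int[mu]_(x in `[ratr p, ratr q])
       ((M x - c) * flat_bump (ratr p) (ratr q) j x) @[j --> \oo] --> (0 : R).
    under eq_fun => j do rewrite (key p q j (lt_trans a0 ap) pq (lt_trans qb b1)).
    exact: cvg_cst.
  by rewrite -(cvg_lim _ L) ?(cvg_lim _ L0)//; exact: Rhausdorff.
exists (fun x => F x + c); split.
  by move=> a b a0 ab b1; have [? <-] := hF a b a0 ab b1; split => //; ring.
(* The shift to k + 3 keeps the exhausting intervals nonempty, as 1/3 <= 2/3. *)
have /ae_forall_nat : forall k : nat, {ae mu, forall x,
    k.+3%:R^-1 < x < 1 - k.+3%:R^-1 -> M x - c = 0}.
  move=> k; have k3 : k.+3%:R^-1 <= 3^-1 :> R by rewrite lef_pV2 ?posrE// ler_nat.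
  have k0 : 0 < k.+3%:R^-1 :> R by rewrite invr_gt0.
  by move: (k.+3%:R^-1 : R) k3 k0 => e e3 e0; apply: Mae => //; lra.
apply: ae_mono => x Hx; rewrite OmegaP => /andP[x0 x1].
suff [k Hk] : exists k : nat, k.+3%:R^-1 < x < 1 - k.+3%:R^-1.
  by move/eqP: (Hx k Hk); rewrite subr_eq0 /M subr_eq addrC => /eqP ->.
pose e := Num.min x (1 - x).
have e0 : 0 < e by rewrite lt_min x0 subr_gt0.
exists (Num.truncn e^-1).
have ke : (Num.truncn e^-1).+3%:R^-1 < e.
  rewrite invf_plt ?posrE//; apply: lt_trans (truncnS_gt _) _; by rewrite ltr_nat ltnS.
have ex : e <= x by rewrite ge_min lexx.
have e1x : e <= 1 - x by rewrite ge_min lexx orbT.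
move: (_.+3%:R^-1 : R) ke => r ke; lra.
Qed.

End DuBoisReymond.

(** * Slicing integrals over the plane *)

Section Plane.
Context {R : realType}.
Local Notation mu := (@lebesgue_measure R).
Implicit Types (F : R -> R -> R) (f : R * R -> R) (A B : set R).

(** Measurability is for the product sigma-algebra. An open set is the union of the rational open
    rectangles it contains, and these are countably many. *)
Lemma open_measurable_plane (U : set (R * R)) : open U -> measurable U.
Proof.
move=> oU.
pose rect (q : rat * rat * (rat * rat)) : set (R * R) :=
  `]ratr q.1.1, ratr q.1.2[%classic `*` `]ratr q.2.1, ratr q.2.2[%classic.
have -> : U = \bigcup_q [set p | rect q p /\ rect q `<=` U].
  apply/seteqP; split => [[x y] Uxy|p [q _ [qp]]]; last exact.
  have : nbhs (x, y) U by exact: open_nbhs_nbhs.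
  move=> /nbhs_ballP[e /= e0 He].
  have sel z : exists p : rat * rat, z - e < ratr p.1 < z /\ z < ratr p.2 < z + e.
    have /rat_in_itvoo[p Hp] : z - e < z by rewrite ltrBlDr ltrDl.
    have /rat_in_itvoo[q Hq] : z < z + e by rewrite ltrDl.
    by exists (p, q); move: Hp Hq; rewrite !in_itv.
  have [p [/andP[p1 p2] /andP[p3 p4]]] := sel x.
  have [q [/andP[q1 q2] /andP[q3 q4]]] := sel y.
  exists (p, q) => //; split; first by rewrite /rect /= !in_itv/= p2 p3 q2 q3.
  move=> [x' y']; rewrite /rect/= !in_itv/= => -[/andP[h1 h2] /andP[h3 h4]].
  by apply: He; split; rewrite /ball/= ltr_norml; apply/andP; split; lra.
apply: countable_bigcupT_measurable; first exact: countableP.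
move=> q; have [qU|qU] := pselect (rect q `<=` U).
  rewrite (_ : [set p | _] = rect q); last by apply/seteqP; split => p /= => [[]|].
  by apply: measurableX; exact: measurable_itv.
rewrite (_ : [set p | _] = set0)//; last by apply/seteqP; split => p /= => [[]|].
Qed.

Lemma compact_measurable_plane (K : set (R * R)) : compact K -> measurable K.
Proof.
move=> cK; rewrite -(setCK K); apply: measurableC; apply: open_measurable_plane.
rewrite openC; exact: compact_closed.
Qed.

Lemma continuous_measurable_plane f : continuous f -> measurable_fun setT f.
Proof.
move=> cf; apply: (measurability _ (RGenOpens.measurableE R)).
move=> _ [_ [a [b ->] <-]]; rewrite setTI; apply: open_measurable_plane.
by move/continuousP : cf; apply; exact: interval_open.
Qed.

Lemma integrable2_patch A B F : measurable A -> measurable B ->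
  integrable2 (A `*` B) F ->
  (leb2 R).-integrable setT (EFin \o ((fun p => F p.1 p.2) \_ (A `*` B))).
Proof.
move=> mA mB iF; rewrite -restrict_EFin.
by apply: (integrable_mkcond _ _).1 => //; exact: measurableX.
Qed.

Lemma patch_slice A B F t x : ((fun p => F p.1 p.2) \_ (A `*` B)) (t, x) =
  if t \in A then (F t \_ B) x else 0.
Proof. by rewrite !patchE in_setX/=; case: (t \in A); case: (x \in B). Qed.

Lemma ae_integrable_slice A B F : measurable A -> measurable B ->
  integrable2 (A `*` B) F ->
  {ae mu, forall t, A t -> mu.-integrable B (EFin \o F t)}.
Proof.
move=> mA mB iF; have := ae_integrable1 (integrable2_patch mA mB iF).
apply: ae_mono => t H At; apply: (integrable_mkcond _ _).2 => //.
rewrite restrict_EFin; move: H; congr (_.-integrable _ _).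
by apply/funext => x; rewrite /= patch_slice mem_set.
Qed.

Lemma fubini_F_patch A B F : fubini_F mu (EFin \o ((fun p => F p.1 p.2) \_ (A `*` B))) =
  (fun t => \int[mu]_(x in B) (F t x)%:E)%E \_ A.
Proof.
apply/funext => t; rewrite /fubini_F patchE.
case: ifPn => tA.
  by rewrite [RHS]integral_mkcond restrict_EFin; apply: eq_integral => x _; rewrite /= patch_slice tA.
by rewrite integral0_eq// => x _; rewrite /= patch_slice (negbTE tA).
Qed.

(** The real-valued inner integral is compared with the extended one on integrable slices, that is
    for almost every [t]; both conclusions pass through this almost everywhere equality. *)
Lemma Rint2_fubini A B F : measurable A -> measurable B -> integrable2 (A `*` B) F ->
  mu.-integrable A (EFin \o (fun t => \int[mu]_(x in B) F t x)) /\
  Rint2 (A `*` B) F = \int[mu]_(t in A) \int[mu]_(x in B) F t x.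
Proof.
move=> mA mB iF; have iP := integrable2_patch mA mB iF.
have E1 := integral12_prod_meas1 iP; have I1 := integrable_fubini_F iP.
have I2 : mu.-integrable A (fun t => \int[mu]_(x in B) (F t x)%:E)%E.
  by apply: (integrable_mkcond _ _).2 => //; rewrite -fubini_F_patch; exact: I1.
have E2 : (\int[mu]_t ((fun t => \int[mu]_(x in B) (F t x)%:E) \_ A) t =
    \int[leb2 R]_p (EFin \o ((fun p => F p.1 p.2) \_ (A `*` B))) p)%E.
  by rewrite -fubini_F_patch; exact: E1.
have aeE : {ae mu, forall t, A t -> (\int[mu]_(x in B) (F t x)%:E)%E =
    (EFin \o (fun t => \int[mu]_(x in B) F t x)) t}.
  apply: ae_mono (ae_integrable_slice mA mB iF) => t H At.
  by rewrite /= EFin_Rintegral//; exact: H.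
have mF : measurable_fun A (EFin \o (fun t => \int[mu]_(x in B) F t x)).
  rewrite (_ : EFin \o _ = EFin \o (fine \o (fun t => \int[mu]_(x in B) (F t x)%:E)%E))//.
  by apply/measurable_EFinP; apply: measurableT_comp => //; exact: measurable_int I2.
have I3 : mu.-integrable A (EFin \o (fun t => \int[mu]_(x in B) F t x)).
  apply/integrableP; split => //; have /integrableP[m2] := I2.
  apply: le_lt_trans; rewrite le_eqVlt; apply/orP; left; apply/eqP.
  apply: ae_eq_integral => //; [exact: measurableT_comp..|].
  by apply: ae_mono aeE => t H At; rewrite H.
split => //; rewrite /Rint2 Rintegral_mkcond /Rintegral -[X in fine X = _]E2 -integral_mkcond.
congr fine; apply: ae_eq_integral => //; exact: measurable_int I2.
Qed.

(** Tonelli: the measures of the sections of a null set integrate to 0, so almost all sections are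
    null. *)
Lemma ae_slice (P : R -> R -> Prop) : {ae leb2 R, forall p, P p.1 p.2} ->
  {ae mu, forall t, {ae mu, forall x, P t x}}.
Proof.
move=> [N [mN N0 HN]].
have mF : measurable_fun setT (fun t => mu (xsection N t)).
  exact: measurable_fun_xsection.
have : (\int[mu]_t `|mu (xsection N t)| = 0)%E.
  by rewrite -[RHS]N0; apply: eq_integral => t _; rewrite gee0_abs.
move=> /(ae_eq_integral_abs mu measurableT mF)[M [mM M0 HM]].
exists M; split => // t /= H; apply: HM => /= H0; apply: H.
exists (xsection N t); split; [exact: measurable_xsection|exact: H0|].
by move=> x /= H; rewrite /xsection/= inE; exact: HN.
Qed.

Lemma ae_of_ae_cyl (T : R) (P : R -> R -> Prop) :
  {ae leb2 R, forall p, cyl T p -> P p.1 p.2} ->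
  ae_time T (fun t => {ae mu, forall x, Omega x -> P t x}).
Proof.
move=> /(@ae_slice (fun t x => cyl T (t, x) -> P t x)) H.
rewrite /ae_time; apply: ae_mono H => t H /andP[t0 tT]; apply: ae_mono H => x H Ox.
by apply: H; split => //=; rewrite in_itv/= t0.
Qed.

(** No integrability is assumed. Tonelli applies to the positive and negative parts separately, and
    [fine] is measurable even where their difference is infinite. *)
Lemma measurable_Rintegral_slice F : measurable_fun setT (fun p => F p.1 p.2) ->
  measurable_fun setT (fun t => \int[mu]_x F t x).
Proof.
move=> mF; have mE : measurable_fun setT (fun p : R * R => (F p.1 p.2)%:E).
  exact/measurable_EFinP.
pose Fp t := (\int[mu]_x (fun p : R * R => (F p.1 p.2)%:E)^\+ (t, x))%E.
pose Fm t := (\int[mu]_x (fun p : R * R => (F p.1 p.2)%:E)^\- (t, x))%E.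
have E : (fun t => \int[mu]_x F t x) = fine \o (Fp \- Fm)%E.
  apply/funext => t; rewrite /Rintegral/= integralE; congr (fine (_ - _)).
  - by rewrite /Fp; apply: eq_integral => x _; rewrite !funeposE.
  - by rewrite /Fm; apply: eq_integral => x _; rewrite !funenegE.
rewrite E; apply: measurableT_comp => //; apply: emeasurable_funB.
- by apply: measurable_fun_fubini_tonelli_F => //; exact: measurable_funepos.
- by apply: measurable_fun_fubini_tonelli_F => //; exact: measurable_funeneg.
Qed.

Lemma measurable_fun_fst D (h : R -> R) : measurable_fun setT h ->
  measurable_fun D (fun p : R * R => h p.1).
Proof. by move=> mh; apply: measurable_funTS; exact: measurableT_comp. Qed.

Lemma measurable_fun_snd D (h : R -> R) : measurable_fun setT h ->
  measurable_fun D (fun p : R * R => h p.2).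
Proof. by move=> mh; apply: measurable_funTS; exact: measurableT_comp. Qed.

Lemma measurable_cyl (T : R) : measurable (cyl T).
Proof. by apply: measurableX; exact: measurable_itv. Qed.

Lemma ae_time_exhaust (T : R) (P : R -> Prop) :
  (forall c d : R, 0 < c -> c <= d -> d < T -> {ae mu, forall t, c < t < d -> P t}) ->
  ae_time T P.
Proof.
move=> H; have /ae_forall_nat : forall k : nat, {ae mu, forall t,
    k.+1%:R^-1 < t < T - k.+1%:R^-1 -> P t}.
  move=> k; have k0 : 0 < k.+1%:R^-1 :> R by rewrite invr_gt0.
  move: (k.+1%:R^-1 : R) k0 => e e0; have [h|h] := leP e (T - e).
    by apply: H => //; lra.
  by apply: aeW => t /andP[h1 h2]; move: (lt_trans h1 h2); rewrite ltNge (ltW h).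
apply: ae_mono => t Ht /andP[t0 tT].
suff [k Hk] : exists k : nat, k.+1%:R^-1 < t < T - k.+1%:R^-1 by exact: Ht Hk.
pose e := Num.min t (T - t).
have e0 : 0 < e by rewrite lt_min t0 subr_gt0.
exists (Num.truncn e^-1).
have ke : (Num.truncn e^-1).+1%:R^-1 < e.
  by rewrite invf_plt ?posrE//; exact: truncnS_gt.
have ex : e <= t by rewrite ge_min lexx.
have e1x : e <= T - t by rewrite ge_min lexx orbT.
move: (_.+1%:R^-1 : R) ke => r ke; lra.
Qed.

(** By Fubini the hypothesis says that the slice integrals are orthogonal to all time bumps.
    Sharpening the bumps gives vanishing integrals over all time intervals. *)
Lemma slice_integral_eq0 (T : R) E :
  (forall c d, 0 < c -> c <= d -> d < T -> integrable2 (`[c, d] `*` Omega) E) ->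
  (forall c d j, 0 < c -> c < d -> d < T ->
     Rint2 (cyl T) (fun t x => E t x * flat_bump c d j t) = 0) ->
  ae_time T (fun t => \int[mu]_(x in Omega) E t x = 0).
Proof.
move=> iE H; have mO := @measurable_Omega R.
have mi c d : measurable (`[c, d]%classic : set R) by exact: measurable_itv.
have im c d : 0 < c -> c <= d -> d < T ->
    mu.-integrable `[c, d] (EFin \o (fun t => \int[mu]_(x in Omega) E t x)).
  by move=> c0 cd dT; have [] := Rint2_fubini (mi c d) mO (iE c d c0 cd dT).
apply: ae_time_exhaust => c d c0 cd dT; apply: ae_eq0_of_itv; first exact: im.
move=> a b ca ab bd.
have a0 := lt_trans c0 ca; have bT := lt_trans bd dT; have ab' := ltW ab.
have L := flat_bump_limit (im a b a0 ab' bT).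
have L0 : \int[mu]_(t in `[a, b]) ((\int[mu]_(x in Omega) E t x) * flat_bump a b j t)
    @[j --> \oo] --> (0 : R).
  suff H0 j : \int[mu]_(t in `[a, b]) ((\int[mu]_(x in Omega) E t x) * flat_bump a b j t) = 0.
    by under eq_fun do rewrite H0; exact: cvg_cst.
  rewrite -(H a b j a0 ab bT).
  have iEb : integrable2 (`[a, b] `*` Omega) (fun t x => E t x * flat_bump a b j t).
    apply: (@integrableRM_bounded _ _ _ (leb2 R) _ (fun p => E p.1 p.2)
      (fun p => flat_bump a b j p.1) 1).
    - exact: measurableX.
    - by apply: measurable_fun_fst; exact: flat_bump_measurable.
    - by move=> p _; rewrite ger0_norm ?flat_bump_ge0 ?flat_bump_le1.
    - exact: iE.
  transitivity (Rint2 (`[a, b] `*` Omega) (fun t x => E t x * flat_bump a b j t)).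
    have [_ ->] := Rint2_fubini (mi a b) mO iEb.
    apply: ae_eq_Rintegral => //.
    - apply: measurable_funM; last exact: flat_bump_measurable.
      exact: integrable_measurableR (im a b a0 ab' bT).
    - have [Ib _] := Rint2_fubini (mi a b) mO iEb; exact: integrable_measurableR Ib.
    - apply: ae_mono (ae_integrable_slice (mi a b) mO (iE a b a0 ab' bT)) => t Ht tab.
      by rewrite RintegralZr//; exact: Ht.
  rewrite /Rint2 Rintegral_mkcond [RHS]Rintegral_mkcond; apply: eq_Rintegral => -[t x] _.
  rewrite !patchE /cyl !in_setX/= !mem_setE !in_itv/=.
  case: ((0 < x) && (x < 1)); rewrite ?andbF// !andbT.
  case: (boolP (a < t < b)) => [/andP[h1 h2]|tab].
    by rewrite !ltW// (lt_trans a0 h1) (lt_trans h2 bT).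
  by rewrite flat_bump_out// mulr0 !if_same.
by rewrite -(cvg_lim _ L) ?(cvg_lim _ L0)//; exact: Rhausdorff.
Qed.

End Plane.

(** * Cosine expansions *)

Section L2.
Context {R : realType}.
Local Notation mu := (@lebesgue_measure R).
Implicit Types (f g v w : R -> R) (c : nat -> R).

Lemma measurable_patch_Omega f : measurable_fun Omega f -> measurable_fun setT (f \_ Omega).
Proof. by move=> mf; apply: (measurable_restrictT f _).1 => //; exact: measurable_Omega. Qed.

Lemma LpO2_sqr f : ((LpO 2%:E f) `^ 2 = \int[mu]_(x in Omega) (f x ^+ 2)%:E)%E.
Proof.
rewrite /LpO poweR_Lnorm ?pnatr_eq0// [RHS]integral_mkcond; apply: eq_integral => x _.
rewrite /= !patchE; case: ifP => _; last by rewrite normr0 powR0 ?pnatr_eq0.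
by rewrite powR_mulrn// real_normK// num_real.
Qed.

Lemma inLpO2_sqr_integrable f : inLpO 2%:E f -> mu.-integrable Omega (EFin \o (fun x => f x ^+ 2)).
Proof.
move=> [mf fy]; apply/integrableP; split.
  by apply/measurable_EFinP; exact: measurable_funX.
under eq_integral do rewrite /= ger0_norm ?sqr_ge0//.
by rewrite -LpO2_sqr poweR_lty.
Qed.

Lemma inLpO2_mul_integrable f g : inLpO 2%:E f -> inLpO 2%:E g ->
  mu.-integrable Omega (EFin \o (fun x => f x * g x)).
Proof.
move=> Lf Lg; have mO := @measurable_Omega R.
apply: (@le_integrableR _ _ _ mu _ _ (fun x => f x ^+ 2 + g x ^+ 2)) => //.
- by apply: measurable_funM; [case: Lf|case: Lg].
- move=> x _; rewrite normrM -(real_normK (num_real (f x))) -(real_normK (num_real (g x))).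
  move: (`|f x|) (`|g x|) (normr_ge0 (f x)) (normr_ge0 (g x)) => a b a0 b0; nra.
- by apply: integrableRD => //; exact: inLpO2_sqr_integrable.
Qed.

Lemma mu_Omega : mu Omega = 1%:E.
Proof. by rewrite [LHS]lebesgue_measure_itv/= lte_fin ltr01 -EFinB subr0. Qed.

Lemma bounded_inLpO2 f (M : R) : measurable_fun Omega f ->
  (forall x, Omega x -> `|f x| <= M) -> inLpO 2%:E f.
Proof.
move=> mf fM; split => //.
have : (LpO 2%:E f `^ 2 < +oo)%E.
  rewrite LpO2_sqr; apply: (@le_lt_trans _ _ ((M ^+ 2)%:E * mu Omega)%E); last first.
    by rewrite [X in (_ * X)%E]mu_Omega mule1 ltry.
  have -> : (\int[mu]_(x in Omega) (f x ^+ 2)%:E = \int[mu]_(x in Omega) `|(f x ^+ 2)%:E|)%E.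
    by apply: eq_integral => x _; rewrite gee0_abs// lee_fin sqr_ge0.
  apply: integral_le_bound => //.
  - exact: measurable_Omega.
  - by apply/measurable_EFinP; exact: measurable_funX.
  - by rewrite lee_fin sqr_ge0.
  - apply: aeW => x Ox; rewrite /= lee_fin ger0_norm ?sqr_ge0//.
    by rewrite -real_normK ?num_real// lerXn2r ?nnegrE// ?fM// (le_trans _ (fM x Ox)).
by rewrite !ltey; apply: contra => /eqP ->; rewrite poweRyr ?pnatr_eq0.
Qed.

Lemma inLpO2_1 : inLpO 2%:E (fun=> 1 : R).
Proof. by apply: (@bounded_inLpO2 _ 1) => // x _; rewrite normr1. Qed.

Lemma inLpO2_integrable f : inLpO 2%:E f -> mu.-integrable Omega (EFin \o f).
Proof.
move=> /inLpO2_mul_integrable/(_ inLpO2_1).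
by under eq_fun do rewrite mulr1.
Qed.

Lemma LpO2_hoelder f g : measurable_fun Omega f -> measurable_fun Omega g ->
  (\int[mu]_(x in Omega) `|f x * g x|%:E <= LpO 2%:E f * LpO 2%:E g)%E.
Proof.
move=> mf mg.
have := @hoelder _ _ _ mu (f \_ Omega) (g \_ Omega) 2 2 (measurable_patch_Omega mf)
  (measurable_patch_Omega mg).
move=> /(_ _ _ _)/wrap[]// => [|H]; first by lra.
apply: le_trans H; rewrite Lnorm1 [leLHS]integral_mkcond le_eqVlt; apply/orP; left; apply/eqP.
apply: eq_integral => x _; rewrite /= !patchE; case: ifP => _ //.
by rewrite mulr0 normr0.
Qed.

Lemma LpO2_cvg_mul (f : nat -> R -> R) w : (forall N, measurable_fun Omega (f N)) ->
  inLpO 2%:E w -> LpO 2%:E (f N) @[N --> \oo] --> 0%E ->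
  \int[mu]_(x in Omega) (f N x * w x) @[N --> \oo] --> (0 : R).
Proof.
move=> mf [mw wy] f0.
have L : (LpO 2%:E (f N) * LpO 2%:E w)%E @[N --> \oo] --> 0%E.
  have wfin : LpO 2%:E w \is a fin_num by rewrite ge0_fin_numE// Lnorm_ge0.
  rewrite -[X in _ --> X](mul0e (LpO 2%:E w)).
  by apply: cvgeZr.
have Lf : fine (LpO 2%:E (f N) * LpO 2%:E w)%E @[N --> \oo] --> (0 : R) by apply: fine_cvg.
have /fine_cvgP[finL _] := L.
apply: norm_cvg0; apply: (squeeze_cvgr _ (cvg_cst 0) Lf).
near=> N; rewrite normr_ge0/=.
rewrite -lee_fin fineK; last by near: N.
apply: le_trans (LpO2_hoelder (mf N) mw).
have mfw : measurable_fun Omega (fun x => f N x * w x) by exact: measurable_funM.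
have bnd : (\int[mu]_(x in Omega) `|f N x * w x|%:E < +oo)%E.
  apply: (le_lt_trans (LpO2_hoelder (mf N) mw)).
  by rewrite -ge0_fin_numE ?mule_ge0 ?Lnorm_ge0//; near: N.
have ifw : mu.-integrable Omega (EFin \o (fun x => f N x * w x)).
  by apply/integrableP; split => //; exact/measurable_EFinP.
rewrite -EFin_Rintegral; [|exact: measurable_Omega|exact: integrable_norm].
by rewrite lee_fin; apply: le_normr_Rintegral => //; exact: measurable_Omega.
Unshelve. all: by end_near. Qed.

Lemma measurable_eigfun D k : measurable_fun D (eigfun k : R -> R).
Proof.
apply: measurable_funTS; rewrite /eigfun; case: eqP => // _.
apply: measurable_funM => //; apply: continuous_measurable_fun => x.
apply: (@continuous_comp _ _ _ ( *%R (k%:R * pi)) cos); last exact: continuous_cos.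
exact: mulrl_continuous.
Qed.

Lemma sqrt2_sqr : (Num.sqrt 2) ^+ 2 = 2 :> R.
Proof. by rewrite sqr_sqrtr. Qed.

Lemma eigfun_bound k (x : R) : `|eigfun k x| <= Num.sqrt 2.
Proof.
rewrite /eigfun; case: eqP => _.
  by rewrite normr1 -[leLHS]sqrtr1 ler_wsqrtr// ler1n.
by rewrite normrM ger0_norm ?sqrtr_ge0// ler_piMr ?sqrtr_ge0// cos_max.
Qed.

Lemma eigfun_inLpO2 k : inLpO 2%:E (eigfun k : R -> R).
Proof.
apply: (@bounded_inLpO2 _ (Num.sqrt 2)); first exact: measurable_eigfun.
by move=> x _; exact: eigfun_bound.
Qed.

Lemma int_cos_natpi m : (0 < m)%N ->
  \int[mu]_(x in Omega) cos (m%:R * pi * x) = 0 :> R.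
Proof.
move=> m0; have a0 : m%:R * pi != 0 :> R by rewrite mulf_neq0 ?pnatr_eq0 ?gt_eqF ?pi_gt0.
have dF (x : R) : is_derive x 1 (fun x => (m%:R * pi)^-1 * sin (m%:R * pi * x)) (cos (m%:R * pi * x)).
  by apply: is_derive_eq; rewrite /GRing.scale /=; move: (m%:R * pi) a0 => a a0; field.
have cF (x : R) : {for x, continuous (fun x => (m%:R * pi)^-1 * sin (m%:R * pi * x))}.
  by apply: differentiable_continuous; apply/derivable1_diffP; case: (dF x).
have cc : continuous (fun x : R => cos (m%:R * pi * x)).
  by move=> x; apply: differentiable_continuous; apply/derivable1_diffP.
rewrite /Rintegral /Omega -(@integral_itv_bndoo _ _ _ _ true false); last first.
  by apply/measurable_EFinP; apply: measurable_funTS; exact: continuous_measurable_fun.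
rewrite (@continuous_FTC2 _ _ (fun x => (m%:R * pi)^-1 * sin (m%:R * pi * x)))//.
- by rewrite /= mulr1 mulr0 sin0 sin_natpi !mulr0 subrr.
- exact: continuous_subspaceT.
- split.
  + by move=> x _; have [] := dF x.
  + by apply: cvg_at_right_filter; exact: cF.
  + by apply: cvg_at_left_filter; exact: cF.
- by move=> x _; rewrite derive1E; have [_ ->] := dF x.
Qed.

Lemma coef_eigfun0 k : (0 < k)%N -> \int[mu]_(x in Omega) eigfun k x = 0 :> R.
Proof.
move=> k0; rewrite /eigfun gtn_eqF//.
rewrite RintegralZl ?int_cos_natpi ?mulr0//; first exact: measurable_Omega.
apply: inLpO2_integrable; apply: (@bounded_inLpO2 _ 1) => [|x _]; last exact: cos_max.
apply: measurable_funTS; apply: continuous_measurable_fun => x.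
by apply: differentiable_continuous; apply/derivable1_diffP.
Qed.

Lemma eigfun_orthonormal j k :
  \int[mu]_(x in Omega) (eigfun j x * eigfun k x) = (j == k)%:R :> R.
Proof.
have mO := @measurable_Omega R.
have ci m : mu.-integrable Omega (EFin \o (fun x : R => cos (m%:R * pi * x))).
  apply: inLpO2_integrable; apply: (@bounded_inLpO2 _ 1) => [|x _]; last exact: cos_max.
  apply: measurable_funTS; apply: continuous_measurable_fun => x.
  by apply: differentiable_continuous; apply/derivable1_diffP.
have E0 m : \int[mu]_(x in Omega) (eigfun 0 x * eigfun m x) = (0%N == m)%:R :> R.
  have -> : \int[mu]_(x in Omega) (eigfun 0 x * eigfun m x) = \int[mu]_(x in Omega) eigfun m x.
    by apply: eq_Rintegral => x _; rewrite {1}/eigfun/= mul1r.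
  case: m => [|m]; last by rewrite coef_eigfun0.
  by rewrite /eigfun /= Rintegral_cst// [X in fine X]mu_Omega mulr1.
wlog jk : j k / (j <= k)%N => [H|].
  have [jk|/ltnW kj] := leqP j k; first exact: H.
  by rewrite eq_sym -(H k j kj); apply: eq_Rintegral => x _; rewrite mulrC.
case: j jk => [|j] jk; first exact: E0.
move: jk; rewrite leq_eqVlt => /predU1P[<-|jk].
  by rewrite eqxx; under eq_Rintegral do rewrite -expr2; exact: eigfun_norm.
have E (x : R) : eigfun j.+1 x * eigfun k x =
    cos ((k - j.+1)%:R * pi * x) + cos ((k + j.+1)%:R * pi * x).
  rewrite /eigfun/= gtn_eqF ?(leq_ltn_trans _ jk)//.
  rewrite natrB ?(ltnW jk)// natrD !mulrBl !mulrDl cosB cosD.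
  rewrite mulrACA -expr2 sqrt2_sqr; ring.
under eq_Rintegral do rewrite E.
rewrite RintegralD// !int_cos_natpi ?subn_gt0// ?addn_gt0 ?orbT//.
by rewrite addr0 ltn_eqF.
Qed.

Lemma coef_integrable v k : inLpO 2%:E v ->
  mu.-integrable Omega (EFin \o (fun x => v x * eigfun k x)).
Proof. by move=> Lv; apply: inLpO2_mul_integrable => //; exact: eigfun_inLpO2. Qed.

Lemma partial_sum_inLpO2 c N : inLpO 2%:E (fun x : R => \sum_(k < N) c k * eigfun k x).
Proof.
apply: (@bounded_inLpO2 _ (\sum_(k < N) `|c k| * Num.sqrt 2)) => [|x _].
  apply: measurable_sum => k; apply: measurable_funM => //; exact: measurable_eigfun.
rewrite (le_trans (ler_norm_sum _ _ _))//; apply: ler_sum => k _.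
by rewrite normrM ler_wpM2l// eigfun_bound.
Qed.

Lemma Rintegral_sum_ord N (f : nat -> R -> R) :
  (forall k, mu.-integrable Omega (EFin \o f k)) ->
  \int[mu]_(x in Omega) (\sum_(k < N) f k x) = \sum_(k < N) \int[mu]_(x in Omega) f k x /\
  mu.-integrable Omega (EFin \o (fun x => \sum_(k < N) f k x)).
Proof.
have mO := @measurable_Omega R.
move=> fi; elim: N => [|N [IH1 IH2]].
  rewrite big_ord0; split.
    by under eq_Rintegral do rewrite big_ord0; rewrite Rintegral_cst// mul0r.
  under eq_fun do rewrite big_ord0.
  by apply: inLpO2_integrable; apply: (@bounded_inLpO2 _ 0) => // x _; rewrite normr0.
split.
  under eq_Rintegral do rewrite big_ord_recr/=.
  by rewrite RintegralD// IH1 big_ord_recr.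
under eq_fun do rewrite big_ord_recr/=.
exact: integrableRD.
Qed.

Lemma int_partial_sum c w N : inLpO 2%:E w ->
  \int[mu]_(x in Omega) ((\sum_(k < N) c k * eigfun k x) * w x) =
  \sum_(k < N) c k * coef w k.
Proof.
move=> Lw; have mO := @measurable_Omega R.
have wi k := coef_integrable k Lw.
under eq_Rintegral do rewrite mulr_suml.
have E k : (fun x => c k * eigfun k x * w x) = (fun x => c k * (w x * eigfun k x)).
  by apply/funext => x; ring.
have H k : mu.-integrable Omega (EFin \o (fun x => c k * eigfun k x * w x)).
  by rewrite E; exact: integrableRZl.
have [-> _] := Rintegral_sum_ord N H.
by apply: eq_bigr => k _; rewrite E RintegralZl.
Qed.

(** The remainder of the expansion tends to 0 in L^2, so its pairing with [w] tends to 0 by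
    Cauchy-Schwarz. *)
Lemma expands_int c v w : expands c v -> inLpO 2%:E w ->
  \sum_(k < N) c k * coef w k @[N --> \oo] --> \int[mu]_(x in Omega) (v x * w x).
Proof.
move=> [Lv ve] Lw; have mO := @measurable_Omega R.
have mS N : measurable_fun Omega (fun x => \sum_(k < N) c k * eigfun k x).
  by have [] := partial_sum_inLpO2 c N.
have mv : measurable_fun Omega v by case: Lv.
have := LpO2_cvg_mul (f := fun N x => v x - \sum_(k < N) c k * eigfun k x) _ Lw ve.
move=> /(_ _)/wrap[]; first by move=> N; exact: measurable_funB.
under eq_fun => N.
  under eq_Rintegral do rewrite mulrBl.
  rewrite RintegralB ?int_partial_sum//; last 2 first.
  - exact: inLpO2_mul_integrable.
  - by apply: inLpO2_mul_integrable => //; exact: partial_sum_inLpO2.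
  over.
set I := \int[mu]_(x in Omega) (v x * w x) => H.
have := cvgB (f := fun=> I) (cvg_cst I) H.
rewrite subr0 => /(_ _ _); apply: cvg_trans.
by apply: near_eq_cvg; near=> N; rewrite /= subKr.
Unshelve. all: by end_near.
Qed.

Lemma bessel w N : inLpO 2%:E w ->
  \sum_(k < N) coef w k ^+ 2 <= \int[mu]_(x in Omega) (w x ^+ 2).
Proof.
move=> Lw; have mO := @measurable_Omega R.
pose S x := \sum_(k < N) coef w k * eigfun k x.
have LS : inLpO 2%:E S := partial_sum_inLpO2 _ N.
have ES : \int[mu]_(x in Omega) (S x * w x) = \sum_(k < N) coef w k ^+ 2.
  by rewrite int_partial_sum//; apply: eq_bigr => k _; rewrite expr2.
have ESS : \int[mu]_(x in Omega) (S x * S x) = \sum_(k < N) coef w k ^+ 2.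
  rewrite int_partial_sum//; apply: eq_bigr => k _; rewrite expr2; congr (_ * _).
  have := @int_partial_sum (coef w) (eigfun k) N (eigfun_inLpO2 k).
  rewrite /coef => ->; rewrite (bigD1 k)//= big1 ?addr0.
    by rewrite eigfun_orthonormal eqxx mulr1.
  move=> j jk; rewrite eigfun_orthonormal.
  by move: jk; rewrite eq_sym -val_eqE/= => /negbTE ->; rewrite mulr0.
have i1 := inLpO2_mul_integrable LS LS.
have i2 := inLpO2_mul_integrable LS Lw.
have i3 := inLpO2_sqr_integrable Lw.
have : 0 <= \int[mu]_(x in Omega) (w x - S x) ^+ 2.
  by apply: Rintegral_ge0 => x _; exact: sqr_ge0.
have -> : \int[mu]_(x in Omega) (w x - S x) ^+ 2 =
    \int[mu]_(x in Omega) ((w x ^+ 2 - 2 * (S x * w x)) + S x * S x).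
  by apply: eq_Rintegral => x _; ring.
rewrite RintegralD//; last by apply: integrableRB => //; exact: integrableRZl.
rewrite RintegralB//; last exact: integrableRZl.
by rewrite RintegralZl// ES ESS; lra.
Qed.

End L2.

(** * Absolute convergence and regularity of cosine series *)

Section CosineSeries.
Context {R : realType}.
Local Notation mu := (@lebesgue_measure R).
Implicit Types (f g v w : R -> R) (c : nat -> R).

Lemma continuous_powR_gt0 (p x : R) : 0 < x -> {for x, continuous (fun y => y `^ p)}.
Proof.
move=> x0; apply: differentiable_continuous; apply/derivable1_diffP.
by have [] := is_derive1_powR p x0.
Qed.

(** Mean value theorem for z^(1-p). The right-hand side telescopes, which replaces the integral test
    for the p-series. *)
Lemma pseries_step (p x : R) : 1 < p -> 0 < x ->
  (p - 1) * (x + 1) `^ (- p) <= x `^ (1 - p) - (x + 1) `^ (1 - p).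
Proof.
move=> p1 x0; have x1 : x < x + 1 by rewrite ltrDl.
have d y : y \in `]x, x + 1[ -> is_derive y 1 (fun z => z `^ (1 - p)) ((1 - p) * y `^ (1 - p - 1)).
  by rewrite in_itv/= => /andP[xy _]; apply: is_derive1_powR; exact: lt_trans xy.
have cf : {within `[x, x + 1], continuous (fun z => z `^ (1 - p))}.
  apply: continuous_in_subspaceT => y; rewrite inE/= in_itv/= => /andP[xy _].
  by apply: continuous_powR_gt0; exact: lt_le_trans xy.
have [c] := MVT x1 d cf; rewrite in_itv/= => /andP[xc cx].
rewrite [x + 1 - x]addrAC subrr add0r mulr1 => E.
rewrite -[leRHS]opprB E -mulNr opprB ler_wpM2l ?subr_ge0 ?(ltW p1)//.
rewrite (_ : 1 - p - 1 = - p); last by ring.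
have c0 : 0 < c by exact: lt_trans xc.
rewrite !powRN lef_pV2 ?posrE ?powR_gt0 ?addr_gt0//.
by apply: ge0_ler_powR; rewrite ?nnegrE ?ltW ?addr_gt0//; lra.
Qed.

Lemma pseries_bounded (p : R) : 1 < p -> exists B, forall N,
  \sum_(k < N) (k.+1%:R : R) `^ (- p) <= B.
Proof.
move=> p1; have p10 : 0 < p - 1 by rewrite subr_gt0.
exists (1 + (p - 1)^-1) => N.
have key M : \sum_(k < M.+1) (k.+1%:R : R) `^ (- p) <=
    1 + (p - 1)^-1 * (1 - M.+1%:R `^ (1 - p)).
  elim: M => [|M IH]; first by rewrite big_ord1 !powR1 subrr mulr0 addr0.
  rewrite big_ord_recr/=; apply: (le_trans (lerD IH (lexx _))).
  have := pseries_step p1 (ltr0Sn R M); rewrite natr1.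
  set a := _ `^ (- p); set b := M.+1%:R `^ _; set d := M.+2%:R `^ _.
  rewrite -ler_pdivlMl// => h; rewrite -addrA lerD2l.
  apply: (le_trans (lerD (lexx _) h)); rewrite -mulrDr ler_pM2l ?invr_gt0//.
  by rewrite addrA subrK.
case: N => [|N]; first by rewrite big_ord0 addr_ge0// invr_ge0 ltW.
apply: (le_trans (key N)); rewrite lerD2l ler_piMr ?invr_ge0 ?(ltW p10)//.
Qed.

Lemma eigval_powR k (s : R) : eigval k `^ s = (k%:R * pi) `^ (2 * s).
Proof.
have a0 : 0 <= k%:R * pi :> R by rewrite mulr_ge0// pi_ge0.
by rewrite /eigval -powR_mulrn// powRrM.
Qed.

Lemma hnorm2_partial (s C : R) v : (hnorm2 s v <= C%:E)%E ->
  forall N, \sum_(k < N) coef v k ^+ 2 * (1 + eigval k `^ s) <= C.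
Proof.
move=> H N; rewrite -lee_fin; apply: le_trans H.
rewrite -(big_mkord xpredT (fun k => coef v k ^+ 2 * (1 + eigval k `^ s))) -sumEFin.
apply: nneseries_lim_ge => k _ _.
by rewrite lee_fin mulr_ge0 ?sqr_ge0// addr_ge0// powR_ge0.
Qed.

Lemma hnorm2_lty_partial (s : R) v : (hnorm2 s v < +oo)%E ->
  exists C, forall N, \sum_(k < N) coef v k ^+ 2 * (1 + eigval k `^ s) <= C.
Proof.
move=> H; exists (fine (hnorm2 s v)); apply: hnorm2_partial; rewrite fineK//.
rewrite ge0_fin_numE//; apply: nneseries_ge0 => k _ _.
by rewrite lee_fin mulr_ge0 ?sqr_ge0// addr_ge0// powR_ge0.
Qed.

(** With a = k pi, write |c| a^b = (|c| a^s) a^(b-s) and bound the product by the sum of squares: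
    the first squares sum to the energy, the second form a p-series with p = 2s - 2b > 1. The
    constant [B] is chosen before [c], hence is the same for all times. *)
Lemma weighted_sum_bounded (s b : R) : 0 <= b -> 2 * b + 1 < 2 * s ->
  exists B, forall c M, (forall N, \sum_(k < N) c k ^+ 2 * (1 + eigval k `^ s) <= M) ->
  forall N, \sum_(k < N) `|c k| * (k%:R * pi) `^ b <= M + B.
Proof.
move=> b0 bs; pose p := 2 * s - 2 * b.
have p1 : 1 < p by rewrite /p; lra.
have [B HB] := pseries_bounded p1.
have B0 : 0 <= B by have := HB 0%N; rewrite big_ord0.
pose d k : R := if k is k'.+1 then k'.+1%:R `^ (- p) else 1.
have Hd N : \sum_(k < N) d k <= 1 + B.
  case: N => [|N]; first by rewrite big_ord0 addr_ge0.
  by rewrite big_ord_recl/= lerD2l; apply: le_trans (HB N); exact: ler_sum.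
exists (1 + B) => c M HM N.
apply: (@le_trans _ _ (\sum_(k < N) (c k ^+ 2 * (1 + eigval k `^ s) + d k))); last first.
  by rewrite big_split/=; apply: lerD; [exact: HM|exact: Hd].
(* The zero mode has eigenvalue 0 and is controlled by the summand 1 of the weight alone. *)
apply: ler_sum => -[[|k] kN] _ /=.
  have h1 : `|c 0%N| <= c 0%N ^+ 2 + 1.
    rewrite -(real_normK (num_real (c 0%N))).
    move: (`|c 0%N|) (normr_ge0 (c 0%N)) => a a0; nra.
  have h2 : (0%:R * pi : R) `^ b <= 1.
    by rewrite mul0r; have [->|bn0] := eqVneq b 0; rewrite ?powRr0// powR0.
  apply: (@le_trans _ _ `|c 0%N|); first by rewrite ler_piMr.
  apply: (le_trans h1); rewrite lerD2r ler_peMr ?sqr_ge0//.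
  by rewrite lerDl powR_ge0.
have pi1 : 1 <= pi :> R by apply: le_trans (pi_ge2 R); rewrite ler1n.
set a := k.+1%:R * pi.
have a0 : 0 < a by rewrite mulr_gt0 ?pi_gt0.
have -> : a `^ b = a `^ s * a `^ (b - s).
  rewrite -powRD; last by rewrite (gt_eqF a0) implybT.
  by rewrite (_ : s + (b - s) = b)//; ring.
have h3 : a `^ (b - s) ^+ 2 <= k.+1%:R `^ (- p).
  rewrite -powR_mulrn ?powR_ge0// -powRrM (_ : (b - s) * 2%:R = - p); last by rewrite /p; ring.
  rewrite !powRN lef_pV2 ?posrE ?powR_gt0//.
  apply: ge0_ler_powR; rewrite ?nnegrE ?(ltW a0)//; first by lra.
  by rewrite /a ler_peMr.
have h4 : eigval k.+1 `^ s = a `^ s ^+ 2.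
  by rewrite eigval_powR -powR_mulrn ?powR_ge0// -powRrM (mulrC 2 s).
rewrite h4; apply: le_trans (lerD (lexx _) h3).
rewrite -(real_normK (num_real (c k.+1))) mulrA.
move: (`|c _|) (normr_ge0 (c k.+1)) (a `^ s) (powR_ge0 a s) (a `^ (b - s)) (powR_ge0 a (b - s)).
by move=> x x0 y y0 z z0; have := sqr_ge0 (x * y - z); nra.
Qed.

Definition cosine_series c (x : R) : R := limn (fun N => \sum_(k < N) c k * eigfun k x).

(** Since 0 to the power 0 is 1, exponent 0 gives absolute summability including the constant mode;
    for positive [b] that mode does not count. *)
Definition abs_bounded c (b B : R) := forall N, \sum_(k < N) `|c k| * (k%:R * pi) `^ b <= B.

Lemma cosine_series_cvg c B x : abs_bounded c 0 B ->
  \sum_(k < N) c k * eigfun k x @[N --> \oo] --> cosine_series c x.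
Proof.
move=> HB.
have : cvgn (series (fun k => c k * eigfun k x)).
  apply: normed_cvg; apply: nondecreasing_is_cvgn.
    apply: nondecreasing_series => k _ _; exact: normr_ge0.
  exists (B * Num.sqrt 2) => _ [N _ <-]; 
  rewrite [leLHS](_ : _ = \sum_(k < N) `|c k * eigfun k x|); last first.
    by rewrite /series/= -(big_mkord xpredT (fun k => `|c k * eigfun k x|)).
  apply: (@le_trans _ _ (\sum_(k < N) `|c k| * (k%:R * pi) `^ 0 * Num.sqrt 2)).
    by apply: ler_sum => k _; rewrite powRr0 mulr1 normrM ler_wpM2l// eigfun_bound.
  by rewrite -mulr_suml ler_wpM2r// sqrtr_ge0.
by rewrite /cosine_series /series/=; under eq_fun do rewrite big_mkord.
Qed.

Lemma norm_cvg_le (u : nat -> R) (l C : R) : u N @[N --> \oo] --> l ->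
  (forall N, `|u N| <= C) -> `|l| <= C.
Proof.
move=> ul uC; have nl : `|u N| @[N --> \oo] --> `|l| by exact: cvg_norm.
by apply: (ler_cvg_to nl (cvg_cst C)); exact: nearW.
Qed.

Lemma cosine_series_bound c B x : abs_bounded c 0 B -> `|cosine_series c x| <= B * Num.sqrt 2.
Proof.
move=> HB; apply: (norm_cvg_le (cosine_series_cvg HB)) => N.
rewrite (le_trans (ler_norm_sum _ _ _))//.
apply: (@le_trans _ _ (\sum_(k < N) `|c k| * (k%:R * pi) `^ 0 * Num.sqrt 2)).
  by apply: ler_sum => k _; rewrite powRr0 mulr1 normrM ler_wpM2l// eigfun_bound.
by rewrite -mulr_suml ler_wpM2r// sqrtr_ge0.
Qed.

Lemma norm_sin_le (y : R) : `|sin y| <= `|y|.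
Proof.
wlog y0 : y / 0 <= y.
  by move=> H; have [|/ltW y0] := leP 0 y; [exact: H|rewrite -normrN -sinN -(normrN y) H ?oppr_ge0].
have d z : z \in `]0, y[ -> is_derive z 1 (@sin R) (cos z) by move=> _; exact: is_derive_sin.
have cs : {within `[0, y], continuous (@sin R)} by apply: continuous_subspaceT; exact: continuous_sin.
have [z _] := MVT_segment y0 d cs.
by rewrite sin0 !subr0 => ->; rewrite normrM ler_piMl// cos_max.
Qed.

(** Interpolation between |sin y| <= 1, used for |y| >= 1, and |sin y| <= |y|, used below 1. *)
Lemma norm_sin_le_powR (b y : R) : 0 <= b <= 1 -> `|sin y| <= `|y| `^ b.
Proof.
move=> /andP[b0 b1]; have [y1|y1] := leP 1 `|y|.
  apply: le_trans (sin_max y) _.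
  by rewrite -(powRr0 `|y|) ler_powR.
have [->|y0] := eqVneq y 0; first by rewrite sin0 normr0 powR_ge0.
apply: le_trans (norm_sin_le y) _.
by apply: ger1_powR => //; rewrite normr_gt0 y0 ltW.
Qed.

Lemma cosB_half (a b : R) : cos a - cos b = - 2 * sin ((a + b) / 2) * sin ((a - b) / 2).
Proof.
have -> : cos a = cos ((a + b) / 2 + (a - b) / 2) by congr cos; field.
have -> : cos b = cos ((a + b) / 2 - (a - b) / 2) by congr cos; field.
by rewrite cosB cosD; ring.
Qed.

Lemma norm_cosB_le (b x y : R) : 0 <= b <= 1 -> `|cos x - cos y| <= 2 * `|x - y| `^ b.
Proof.
move=> b01; rewrite cosB_half !normrM normrN (ger0_norm (ler0n _ 2)) -mulrA ler_wpM2l//.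
apply: (@le_trans _ _ `|sin ((x - y) / 2)|); first by rewrite ler_piMl// sin_max.
apply: le_trans (norm_sin_le_powR _ b01) _.
case/andP: b01 => b0 _; apply: ge0_ler_powR; rewrite ?nnegrE//.
by rewrite normrM ler_piMr// ger0_norm//; lra.
Qed.

(** Exponents up to 2 are reached because 1 - cos y = 2 sin(y/2)^2, each sine giving half of the
    power. *)
Lemma norm_1Bcos_le (b y : R) : 0 <= b <= 2 -> `|1 - cos y| <= 2 * `|y| `^ b.
Proof.
move=> /andP[b0 b2]; have -> : 1 - cos y = 2 * (sin (y / 2) * sin (y / 2)).
  have := cosB_half 0 y; rewrite cos0 add0r (_ : (0 - y) / 2 = - (y / 2)); last by field.
  by rewrite sinN => ->; ring.
rewrite -expr2 normrM (ger0_norm (ler0n _ 2)) ler_wpM2l//.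
rewrite normrX; have b01 : 0 <= b / 2 <= 1 by lra.
have h := norm_sin_le_powR (y / 2) b01.
have h2 : `|y / 2| `^ (b / 2) <= `|y| `^ (b / 2).
  apply: ge0_ler_powR; rewrite ?nnegrE//; first by lra.
  by rewrite normrM ler_piMr// ger0_norm//; lra.
have -> : `|y| `^ b = (`|y| `^ (b / 2)) ^+ 2.
  by rewrite -powR_mulrn ?powR_ge0// -powRrM divfK// pnatr_eq0.
by rewrite lerXn2r ?nnegrE ?powR_ge0//; exact: le_trans h2.
Qed.

Lemma cosine_series_holder c (b B0 B x y : R) : abs_bounded c 0 B0 -> 0 <= b <= 1 ->
  abs_bounded c b B ->
  `|cosine_series c x - cosine_series c y| <= 2 * Num.sqrt 2 * B * `|x - y| `^ b.
Proof.
move=> HB0 b01 HB.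
have L : \sum_(k < N) c k * eigfun k x - \sum_(k < N) c k * eigfun k y @[N --> \oo] -->
    cosine_series c x - cosine_series c y by apply: cvgB; exact: cosine_series_cvg HB0.
apply: (norm_cvg_le L) => N /=.
rewrite -sumrB (le_trans (ler_norm_sum _ _ _))//.
apply: (@le_trans _ _ (\sum_(k < N) `|c k| * (k%:R * pi) `^ b * (2 * Num.sqrt 2 * `|x - y| `^ b))).
  apply: ler_sum => k _; rewrite -mulrBr normrM -mulrA ler_wpM2l//.
  rewrite /eigfun; case: eqP => _; first by rewrite subrr normr0 !mulr_ge0 ?powR_ge0 ?sqrtr_ge0.
  rewrite -mulrBr normrM (ger0_norm (sqrtr_ge0 _)) (mulrC 2) mulrCA mulrA.
  rewrite [leRHS](_ : _ = Num.sqrt 2 * (2 * ((k%:R * pi) `^ b * `|x - y| `^ b))); last by ring.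
  rewrite ler_wpM2l ?sqrtr_ge0//.
  apply: le_trans (norm_cosB_le _ _ b01) _.
  have ak0 : 0 <= k%:R * pi :> R by rewrite mulr_ge0 ?pi_ge0.
  rewrite -mulrBr (normrM (k%:R * pi)) (ger0_norm ak0) (powRM _ ak0 (normr_ge0 _)).
  by [].
rewrite -mulr_suml [leRHS](_ : _ = B * (2 * Num.sqrt 2 * `|x - y| `^ b)); last by ring.
by rewrite ler_wpM2r// !mulr_ge0 ?powR_ge0 ?sqrtr_ge0.
Qed.

(** Mode by mode, the second difference of cos(a x) equals -2 cos(a x) (1 - cos(a h)), which allows
    exponents up to 2 where the first difference stops at 1. *)
Lemma cosine_series_diff2 c (b B0 B x h : R) : abs_bounded c 0 B0 -> 0 <= b <= 2 ->
  abs_bounded c b B ->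
  `|cosine_series c (x + h) + cosine_series c (x - h) - 2 * cosine_series c x|
    <= 4 * Num.sqrt 2 * B * `|h| `^ b.
Proof.
move=> HB0 b02 HB.
have L : \sum_(k < N) c k * eigfun k (x + h) + \sum_(k < N) c k * eigfun k (x - h)
    - 2 * \sum_(k < N) c k * eigfun k x @[N --> \oo] -->
    cosine_series c (x + h) + cosine_series c (x - h) - 2 * cosine_series c x.
  apply: cvgB; first by apply: cvgD; exact: cosine_series_cvg HB0.
  by apply: cvgMr => //; exact: (cosine_series_cvg HB0).
apply: (norm_cvg_le L) => N /=.
rewrite mulr_sumr -big_split -sumrB/= (le_trans (ler_norm_sum _ _ _))//.
apply: (@le_trans _ _ (\sum_(k < N) `|c k| * (k%:R * pi) `^ b * (4 * Num.sqrt 2 * `|h| `^ b))).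
  apply: ler_sum => k _.
  rewrite (_ : _ - _ = c k * (eigfun k (x + h) + eigfun k (x - h) - 2 * eigfun k x)); last by ring.
  rewrite normrM -mulrA ler_wpM2l//.
  rewrite /eigfun; case: eqP => _.
    rewrite (_ : 1 + 1 - 2 * 1 = 0); last by ring.
    by rewrite normr0 !mulr_ge0 ?powR_ge0 ?sqrtr_ge0.
  rewrite (_ : _ - _ = - (2 * Num.sqrt 2) * cos (k%:R * pi * x) * (1 - cos (k%:R * pi * h))); last first.
    by rewrite mulrDr mulrBr cosB cosD; ring.
  rewrite normrM (normrM (- _)) normrN (ger0_norm (_ : 0 <= 2 * Num.sqrt 2)); last first.
    by rewrite mulr_ge0 ?sqrtr_ge0.
  have := norm_1Bcos_le (k%:R * pi * h) b02.
  have ak0 : 0 <= k%:R * pi :> R by rewrite mulr_ge0 ?pi_ge0.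
  rewrite (normrM (k%:R * pi)) (ger0_norm ak0) (powRM _ ak0 (normr_ge0 _)).
  have := cos_max (k%:R * pi * x).
  move: (`|cos _|) (normr_ge0 (cos (k%:R * pi * x))) (`|1 - cos _|) (normr_ge0 (1 - cos (k%:R * pi * h))).
  move: (_ `^ b) (powR_ge0 (k%:R * pi) b) (`|h| `^ b) (powR_ge0 `|h| b) (Num.sqrt 2) (sqrtr_ge0 (2 : R)).
  move=> A A0 H H0 s s0 C C0 D D0 C1 HD.
  apply: (@le_trans _ _ (2 * s * 1 * (2 * (A * H)))); last by nra.
  by apply: ler_pM => //; [rewrite !mulr_ge0|rewrite ler_wpM2l// mulr_ge0].
rewrite -mulr_suml [leRHS](_ : _ = B * (4 * Num.sqrt 2 * `|h| `^ b)); last by ring.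
by rewrite ler_wpM2r// !mulr_ge0 ?powR_ge0 ?sqrtr_ge0.
Qed.

Lemma measurable_cosine_series c B : abs_bounded c 0 B ->
  measurable_fun Omega (cosine_series c).
Proof.
move=> HB; apply: (@measurable_fun_cvg _ _ _ _ (fun N x => \sum_(k < N) c k * eigfun k x)).
  move=> N; apply: measurable_sum => k; apply: measurable_funM => //; exact: measurable_eigfun.
by move=> x _; exact: cosine_series_cvg HB.
Qed.

(** Let w be the difference of the two functions. Both int v w, by L^2 convergence, and the integral
    of the series against w, by dominated convergence, are the limit of the same sums; hence int w^2
    = 0. *)
Lemma expands_cosine_series c v B : expands c v -> abs_bounded c 0 B ->
  {ae mu, forall x, Omega x -> v x = cosine_series c x}.
Proof.
move=> ev HB; have mO := @measurable_Omega R.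
have Lv : inLpO 2%:E v by case: ev.
have ms := measurable_cosine_series HB.
have Ls : inLpO 2%:E (cosine_series c).
  by apply: (@bounded_inLpO2 _ _ (B * Num.sqrt 2)) => // x _; exact: cosine_series_bound.
pose w x := v x - cosine_series c x.
have mv : measurable_fun Omega v by case: Lv.
have mw : measurable_fun Omega w by exact: measurable_funB.
have i1 := inLpO2_mul_integrable Lv Lv.
have i2 := inLpO2_mul_integrable Lv Ls.
have i3 := inLpO2_mul_integrable Ls Ls.
have Lw : inLpO 2%:E w.
  split => //.
  have : (LpO 2%:E w `^ 2 < +oo)%E.
    rewrite LpO2_sqr.
    have : mu.-integrable Omega (EFin \o (fun x => (v x * v x - 2 * (v x * cosine_series c x))
        + cosine_series c x * cosine_series c x)).
      by apply: integrableRD => //; apply: integrableRB => //; exact: integrableRZl.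
    rewrite (_ : EFin \o _ = EFin \o (fun x => w x ^+ 2)); last first.
      by apply/funext => x /=; rewrite /w; congr (_%:E); ring.
    move=> /integrableP[_]; under eq_integral do rewrite /= ger0_norm ?sqr_ge0//.
    exact.
  by rewrite !ltey; apply: contra => /eqP ->; rewrite poweRyr ?pnatr_eq0.
have E1 := expands_int ev Lw.
have E2 : \sum_(k < N) c k * coef w k @[N --> \oo] --> \int[mu]_(x in Omega) (cosine_series c x * w x).
  under eq_fun do rewrite -int_partial_sum//.
  apply: (@Rintegral_dominated _ _ _ mu _ _ _ (fun x => B * Num.sqrt 2 * `|w x|)) => //.
  - move=> N; apply: measurable_funM => //.
    by have [] := partial_sum_inLpO2 c N.
  - exact: measurable_funM.
  - by apply: aeW => x _; apply: cvgMl => //; exact: (cosine_series_cvg HB).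
  - by apply: integrableRZl => //; apply: integrable_norm => //; exact: inLpO2_integrable.
  - apply: aeW => x N _; rewrite normrM ler_wpM2r//.
    rewrite (le_trans (ler_norm_sum _ _ _))//.
    apply: (@le_trans _ _ (\sum_(k < N) `|c k| * (k%:R * pi) `^ 0 * Num.sqrt 2)).
      by apply: ler_sum => k _; rewrite powRr0 mulr1 normrM ler_wpM2l// eigfun_bound.
    by rewrite -mulr_suml ler_wpM2r// sqrtr_ge0.
have E : \int[mu]_(x in Omega) (w x ^+ 2) = 0.
  have -> : \int[mu]_(x in Omega) (w x ^+ 2) =
      \int[mu]_(x in Omega) (v x * w x - cosine_series c x * w x).
    by apply: eq_Rintegral => x _; rewrite -mulrBl expr2.
  rewrite RintegralB//; [|exact: inLpO2_mul_integrable..].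
  apply/eqP; rewrite subr_eq0; apply/eqP.
  by rewrite -(cvg_lim _ E1) ?(cvg_lim _ E2)//; exact: Rhausdorff.
have iw := inLpO2_sqr_integrable Lw.
have : (\int[mu]_(x in Omega) `|(w x ^+ 2)%:E| = 0)%E.
  under eq_integral do rewrite /= ger0_norm ?sqr_ge0//.
  by rewrite -EFin_Rintegral// E.
move=> /(ae_eq_integral_abs mu mO (measurable_int _ iw)); apply: ae_mono => x /= H Ox.
have /eqP := H Ox; rewrite /= eqe sqrf_eq0 subr_eq0 => /eqP; exact.
Qed.

End CosineSeries.

(** * A Stroock-Varopoulos inequality *)

Section Fejer.
Context {R : realType}.
Local Notation mu := (@lebesgue_measure R).
Implicit Types (a c : nat -> R) (th : R).

(** The squared modulus of the sum of exp(i m th) over m < N, that is N times the usual Fejer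
    kernel; its sign is then obvious. *)
Definition fejer N th : R :=
  (\sum_(m < N) cos (m%:R * th)) ^+ 2 + (\sum_(m < N) sin (m%:R * th)) ^+ 2.

Lemma fejer_ge0 N th : 0 <= fejer N th.
Proof. by rewrite addr_ge0 ?sqr_ge0. Qed.

(** Consecutive exponential sums differ by a number of modulus 1, so they cannot both be small:
    |z|^2 + |z + e|^2 >= |e|^2 / 2. *)
Lemma fejer_pair N th : 1 / 2 <= fejer N th + fejer N.+1 th.
Proof.
rewrite /fejer !big_ord_recr/=.
move: (\sum_(m < N) _) (\sum_(m < N) _) => C S.
have := cos2Dsin2 (N%:R * th); move: (cos _) (sin _) => x y E.
have := sqr_ge0 (2 * S + x); have := sqr_ge0 (2 * C + y); nra.
Qed.

Definition cos_weight (k : nat) : R := if k == 0%N then 1 else 2.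

(** The increment is the Dirichlet kernel. Only products with the new term of index N survive, and
    reversing the sum turns N - m into the frequency. *)
Lemma fejerS N th :
  fejer N.+1 th - fejer N th = \sum_(k < N.+1) cos_weight k * cos (k%:R * th).
Proof.
rewrite [in RHS]big_ord_recl /fejer !big_ord_recr/= {1}/cos_weight/= mul0r cos0 mulr1.
have -> : \sum_(i < N) cos_weight (lift ord0 i) * cos ((lift ord0 i)%:R * th) =
    2 * \sum_(m < N) (cos (m%:R * th) * cos (N%:R * th) + sin (m%:R * th) * sin (N%:R * th)).
  rewrite mulr_sumr (reindex_inj rev_ord_inj)/=; apply: eq_bigr => m _.
  rewrite /bump leq0n add1n /cos_weight/=; congr (_ * _).
  have mN := ltn_ord m.
  rewrite -subSn// subSS natrB ?(ltnW mN)// mulrBl cosB.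
  by rewrite mulrC (mulrC (sin _)).
rewrite big_split/= -!mulr_suml.
move: (\sum_(m < N) _) (\sum_(m < N) _) => C S.
have := cos2Dsin2 (N%:R * th); move: (cos _) (sin _) => x y E.
by transitivity ((x ^+ 2 + y ^+ 2) + 2 * (S * x + C * y)); [ring|rewrite E].
Qed.

(** The coefficient a N - a k vanishes at the cut k = N, so raising N adds a multiple of the whole
    Dirichlet kernel, that is of a difference of Fejer kernels. *)
Definition cos_kernel a N th : R :=
  \sum_(k < N) (a N - a k) * (cos_weight k * cos (k%:R * th)).

Lemma cos_kernelS a N th :
  cos_kernel a N.+1 th = cos_kernel a N th + (a N.+1 - a N) * (fejer N.+1 th - fejer N th).
Proof.
rewrite fejerS mulr_sumr {1}/cos_kernel big_ord_recr/= [in RHS]big_ord_recr/= addrA; congr (_ + _).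
rewrite /cos_kernel -big_split/=; apply: eq_bigr => k _; ring.
Qed.

(* Two summations by parts turn the kernel of a concave multiplier into a
   nonnegative combination of Fejer kernels. *)
Lemma cos_kernel_fejer a N th : (forall k, a k.+2 - a k.+1 <= a k.+1 - a k) ->
  (a N.+2 - a N.+1) * fejer N.+2 th + ((a 1%N - a 0%N) - (a 2%N - a 1%N)) <=
  cos_kernel a N.+2 th.
Proof.
move=> conc; elim: N => [|N IH].
  rewrite !cos_kernelS {1}/cos_kernel big_ord0.
  have -> : fejer 0 th = 0 by rewrite /fejer !big_ord0 expr0n addr0.
  have -> : fejer 1 th = 1.
    by rewrite /fejer !big_ord1 mul0r cos0 sin0 expr1n expr0n addr0.
  by rewrite le_eqVlt; apply/orP; left; apply/eqP; ring.
rewrite cos_kernelS; have h := conc N.+1; have F0 := fejer_ge0 N.+2 th.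
move: IH h F0.
move: (fejer N.+2 th) (fejer N.+3 th) (cos_kernel a N.+2 th) => F F' K.
move: (a N.+3) (a N.+2) (a N.+1) (a 1%N) (a 2%N) (a 0%N) => a3 a2 a1 b1 b2 b0.
by move=> IH h F0; have := ler_wpM2r F0 h; lra.
Qed.

Lemma eigfunM k (x y : R) : eigfun k x * eigfun k y =
  (cos_weight k * cos (k%:R * (pi * (x - y))) + cos_weight k * cos (k%:R * (pi * (x + y)))) / 2.
Proof.
rewrite /eigfun /cos_weight; case: eqP => [->|_].
  by rewrite !mul0r cos0; lra.
rewrite mulrACA -expr2 sqrt2_sqr.
have -> : k%:R * (pi * (x - y)) = k%:R * pi * x - k%:R * pi * y by ring.
have -> : k%:R * (pi * (x + y)) = k%:R * pi * x + k%:R * pi * y by ring.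
by rewrite cosB cosD; field.
Qed.

(** The products of eigenfunctions split into kernels at x - y and x + y. Two consecutive truncation
    levels are added so that [fejer_pair] contributes half of the last increment of [a]; the first
    summand of the bound is the second difference of [a] at 0, counted once per level. *)
Lemma kernel_lower_bound a (kap : R) N (x y : R) :
  (forall k, a k.+2 - a k.+1 <= a k.+1 - a k) -> (forall k, a k <= a k.+1) ->
  kap <= 2 * ((a 1%N - a 0%N) - (a 2%N - a 1%N)) + (a N.+3 - a N.+2) / 2 ->
  kap <= \sum_(k < N.+3) (a N.+2 + a N.+3 - 2 * a k) * (eigfun k x * eigfun k y).
Proof.
move=> conc mono Hk.
have -> : \sum_(k < N.+3) (a N.+2 + a N.+3 - 2 * a k) * (eigfun k x * eigfun k y) =
   ((cos_kernel a N.+2 (pi * (x - y)) + cos_kernel a N.+3 (pi * (x - y))) +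
    (cos_kernel a N.+2 (pi * (x + y)) + cos_kernel a N.+3 (pi * (x + y)))) / 2.
  have E th : cos_kernel a N.+2 th + cos_kernel a N.+3 th =
      \sum_(k < N.+3) (a N.+2 + a N.+3 - 2 * a k) * (cos_weight k * cos (k%:R * th)).
    rewrite /cos_kernel [in RHS]big_ord_recr/= [in X in _ + X]big_ord_recr/= addrA.
    rewrite -big_split/=; congr (_ + _); last by congr (_ * _); ring.
    by apply: eq_bigr => k _; ring.
  rewrite !E -big_split/= mulr_suml; apply: eq_bigr => k _.
  by rewrite eigfunM; field.
have key th : kap <= cos_kernel a N.+2 th + cos_kernel a N.+3 th.
  have h2 := @cos_kernel_fejer a N th conc; have h3 := @cos_kernel_fejer a N.+1 th conc.
  have hp := fejer_pair N.+2 th; have c := conc N.+1; have m := mono N.+2.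
  have f2 := fejer_ge0 N.+2 th; have f3 := fejer_ge0 N.+3 th.
  move: h2 h3 hp f2 f3 (Hk) c m.
  move: (fejer N.+2 th) (fejer N.+3 th) (cos_kernel a N.+2 th) (cos_kernel a N.+3 th).
  move: (a N.+3) (a N.+2) (a N.+1) (a 1%N) (a 2%N) (a 0%N) => a3 a2 a1 b1 b2 b0.
  move=> F2 F3 K2 K3 h2 h3 hp f2 f3 hk c m.
  have e1 : (a3 - a2) * F2 <= (a2 - a1) * F2 by rewrite ler_wpM2r.
  have e2 : (a3 - a2) * (1/2) <= (a3 - a2) * (F2 + F3) by rewrite ler_wpM2l// subr_ge0.
  lra.
by have k1 := key (pi * (x - y)); have k2 := key (pi * (x + y)); lra.
Qed.

(** Multiply the kernel bound by the nonnegative (v x - v y) (w x - w y) and integrate over the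
    square: the constant gives twice the covariance of [v] and [w], and the kernel gives the
    spectral sum, since only the zero mode sees a factor without [y] or without [x]. *)
Lemma stroock_varopoulos_finite (b : nat -> R) (kap : R) N (v w : R -> R) (M : R) :
  measurable_fun Omega v -> measurable_fun Omega w ->
  (forall x, Omega x -> `|v x| <= M) -> (forall x, Omega x -> `|w x| <= M) ->
  (forall x y, Omega x -> Omega y -> 0 <= (v x - v y) * (w x - w y)) ->
  (forall x y, kap <= \sum_(k < N.+1) b k * (eigfun k x * eigfun k y)) ->
  kap * (\int[mu]_(x in Omega) (v x * w x) -
         (\int[mu]_(x in Omega) v x) * (\int[mu]_(x in Omega) w x)) <=
  b 0%N * \int[mu]_(x in Omega) (v x * w x) - \sum_(k < N.+1) b k * (coef v k * coef w k).
Proof.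
move=> mv mw vM wM mono Hk; have mO := @measurable_Omega R.
have Lv := bounded_inLpO2 mv vM; have Lw := bounded_inLpO2 mw wM.
have Lvw : inLpO 2%:E (fun x => v x * w x).
  apply: (@bounded_inLpO2 _ _ (M * M)); first exact: measurable_funM.
  by move=> x Ox; rewrite normrM ler_pM// ?vM ?wM.
have iv := inLpO2_integrable Lv; have iw := inLpO2_integrable Lw.
have ivw := inLpO2_integrable Lvw.
set V := \int[mu]_(x in Omega) v x; set W := \int[mu]_(x in Omega) w x.
set X := \int[mu]_(x in Omega) (v x * w x).
have c1 (r : R) : mu.-integrable Omega (EFin \o (fun=> r)).
  by apply: inLpO2_integrable; apply: (@bounded_inLpO2 _ _ `|r|).
have int1 (r : R) : \int[mu]_(x in Omega) r = r.
  by rewrite Rintegral_cst// [X in fine X]mu_Omega mulr1.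
have iZ (p : R) f : mu.-integrable Omega (EFin \o f) ->
    mu.-integrable Omega (EFin \o (fun x => p * f x)) by exact: integrableRZl.
have iA f g : mu.-integrable Omega (EFin \o f) -> mu.-integrable Omega (EFin \o g) ->
    mu.-integrable Omega (EFin \o (fun x => f x + g x)) by exact: integrableRD.
(* All four integrations, in [y] and then in [x], have this form: a fixed function times a
   polynomial in v and w. *)
have quad (f : R -> R) (p q r s : R) : inLpO 2%:E f ->
    \int[mu]_(y in Omega) (f y * (p + (- q) * w y + (- r) * v y + s * (v y * w y))) =
    p * \int[mu]_(y in Omega) f y - q * \int[mu]_(y in Omega) (w y * f y)
      - r * \int[mu]_(y in Omega) (v y * f y) + s * \int[mu]_(y in Omega) (v y * w y * f y)
    /\ mu.-integrable Omega (EFin \o (fun y => f y * (p + (- q) * w y + (- r) * v y + s * (v y * w y)))).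
  move=> Lf.
  have i1 := inLpO2_integrable Lf; have i2 := inLpO2_mul_integrable Lw Lf.
  have i3 := inLpO2_mul_integrable Lv Lf; have i4 := inLpO2_mul_integrable Lvw Lf.
  have E : (fun y => f y * (p + (- q) * w y + (- r) * v y + s * (v y * w y))) =
     (fun y => ((p * f y + (- q) * (w y * f y)) + (- r) * (v y * f y)) + s * (v y * w y * f y)).
    by apply/funext => y; ring.
  have j1 := iZ p _ i1; have j2 := iZ (- q) _ i2.
  have j3 := iZ (- r) _ i3; have j4 := iZ s _ i4.
  have j12 := iA _ _ j1 j2; have j123 := iA _ _ j12 j3.
  rewrite E; split; last exact: iA j123 j4.
  by rewrite !RintegralD// !RintegralZl// !mulNr.
have int_eig k : \int[mu]_(y in Omega) eigfun k y = (k == 0%N)%:R :> R.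
  by case: k => [|k]; [rewrite /eigfun /= int1|rewrite coef_eigfun0].
pose D x y := (v x - v y) * (w x - w y).
pose f k x := eigfun k x * ((k == 0%N)%:R * (v x * w x) - coef w k * v x - coef v k * w x + coef (fun y => v y * w y) k).
have inner x : \int[mu]_(y in Omega) ((\sum_(k < N.+1) b k * (eigfun k x * eigfun k y)) * D x y)
    = \sum_(k < N.+1) b k * f k x /\ mu.-integrable Omega (EFin \o
      (fun y => (\sum_(k < N.+1) b k * (eigfun k x * eigfun k y)) * D x y)).
  have E : (fun y => (\sum_(k < N.+1) b k * (eigfun k x * eigfun k y)) * D x y) =
     (fun y => \sum_(k < N.+1) (b k * eigfun k x) * (eigfun k y *
        (v x * w x + (- v x) * w y + (- w x) * v y + 1 * (v y * w y)))).
    by apply/funext => y; rewrite mulr_suml; apply: eq_bigr => k _; rewrite /D; ring.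
  have q k := @quad (eigfun k) (v x * w x) (v x) (w x) 1 (eigfun_inLpO2 k).
  rewrite E; have [-> ?] := @Rintegral_sum_ord _ N.+1 (fun k y => (b k * eigfun k x) * (eigfun k y *
        (v x * w x + (- v x) * w y + (- w x) * v y + 1 * (v y * w y))))
     (fun k => iZ _ _ (q k).2).
  split=> //; apply: eq_bigr => k _; rewrite RintegralZl//; last by have [] := q k.
  by rewrite (q k).1 int_eig /f /coef; ring.
have outer : \int[mu]_(x in Omega) (\sum_(k < N.+1) b k * f k x) =
    2 * (b 0%N * X - \sum_(k < N.+1) b k * (coef v k * coef w k)) /\
    mu.-integrable Omega (EFin \o (fun x => \sum_(k < N.+1) b k * f k x)).
  have Ef k : f k = (fun x => eigfun k x * (coef (fun y => v y * w y) k + (- coef v k) * w x +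
      (- coef w k) * v x + (k == 0%N)%:R * (v x * w x))).
    by apply/funext => x; rewrite /f; ring.
  have q k := @quad (eigfun k) (coef (fun y => v y * w y) k) (coef v k) (coef w k) (k == 0%N)%:R
    (eigfun_inLpO2 k).
  have fi k : mu.-integrable Omega (EFin \o (fun x => b k * f k x)).
    by rewrite Ef; apply: integrableRZl => //; exact: (q k).2.
  have [-> ?] := @Rintegral_sum_ord _ N.+1 (fun k x => b k * f k x) fi; split=> //.
  have T k : \int[mu]_(x in Omega) (b k * f k x) =
      2 * ((k == 0%N)%:R * (b k * coef (fun y => v y * w y) k)) - 2 * (b k * (coef v k * coef w k)).
    rewrite Ef RintegralZl ?(q k).1 ?int_eig//; last exact: (q k).2.
    by rewrite /coef; ring.
  under eq_bigr do rewrite T.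
  rewrite sumrB -!mulr_sumr -mulrBr; congr (2 * (_ - _)).
  rewrite big_ord_recl/= mul1r big1 ?addr0; last by move=> k _; rewrite mul0r.
  by congr (_ * _); rewrite /X /coef; apply: eq_Rintegral => y _; rewrite /eigfun /= mulr1.
have innerD x : \int[mu]_(y in Omega) (kap * D x y) =
    kap * (v x * w x - v x * W - w x * V + X) /\
    mu.-integrable Omega (EFin \o (fun y => kap * D x y)).
  have L1 := @inLpO2_1 R.
  have [q1 q2] := @quad (fun=> 1) (v x * w x) (v x) (w x) 1 L1.
  have E : (fun y => D x y) = (fun y => 1 * (v x * w x + (- v x) * w y + (- w x) * v y + 1 * (v y * w y))).
    by apply/funext => y; rewrite /D; ring.
  have iD : mu.-integrable Omega (EFin \o D x) by rewrite [D x]E.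
  split; last exact: integrableRZl.
  rewrite RintegralZl//; congr (_ * _); rewrite [D x]E q1 int1.
  by under eq_Rintegral do rewrite mulr1; rewrite -/W;
     under eq_Rintegral do rewrite mulr1; rewrite -/V;
     under eq_Rintegral do rewrite mulr1; rewrite -/X; ring.
have outerD : \int[mu]_(x in Omega) (kap * (v x * w x - v x * W - w x * V + X)) =
    2 * (kap * (X - V * W)) /\
    mu.-integrable Omega (EFin \o (fun x => kap * (v x * w x - v x * W - w x * V + X))).
  have L1 := @inLpO2_1 R.
  have [q1 q2] := @quad (fun=> 1) X V W 1 L1.
  have E : (fun x => v x * w x - v x * W - w x * V + X) =
    (fun y => 1 * (X + (- V) * w y + (- W) * v y + 1 * (v y * w y))).
    by apply/funext => y; ring.
  have iD : mu.-integrable Omega (EFin \o (fun x => v x * w x - v x * W - w x * V + X)) by rewrite E.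
  split; last exact: integrableRZl.
  rewrite RintegralZl// E q1 int1.
  by under eq_Rintegral do rewrite mulr1; rewrite -/W;
     under eq_Rintegral do rewrite mulr1; rewrite -/V;
     under eq_Rintegral do rewrite mulr1; rewrite -/X; ring.
have : 2 * (kap * (X - V * W)) <= 2 * (b 0%N * X - \sum_(k < N.+1) b k * (coef v k * coef w k)).
  rewrite -(outer.1) -(outerD.1); apply: le_Rintegral => //; [exact: outerD.2|exact: outer.2|].
  move=> x Ox; rewrite -(innerD x).1 -(inner x).1.
  apply: le_Rintegral => //; [exact: (innerD x).2|exact: (inner x).2|].
  by move=> y Oy; rewrite ler_wpM2r ?Hk// mono.
by rewrite ler_pM2l.
Qed.

End Fejer.

(** * The inequality for the fractional Neumann Laplacian, and its consequence for powers *)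

Section StroockVaropoulos.
Context {R : realType}.
Local Notation mu := (@lebesgue_measure R).
Implicit Types (al : R) (v w : R -> R).

Lemma powR_concave al (x : R) : 0 < al -> al <= 1 -> 0 < x ->
  (x + 2) `^ al - (x + 1) `^ al <= (x + 1) `^ al - x `^ al.
Proof.
move=> al0 al1 x0.
have step (y : R) : 0 < y -> exists2 z, y < z < y + 1 & (y + 1) `^ al - y `^ al = al * z `^ (al - 1).
  move=> y0; have y1 : y < y + 1 by rewrite ltrDl.
  have d z : z \in `]y, y + 1[ -> is_derive z 1 (fun z => z `^ al) (al * z `^ (al - 1)).
    by rewrite in_itv/= => /andP[yz _]; apply: is_derive1_powR; exact: lt_trans yz.
  have cf : {within `[y, y + 1], continuous (fun z => z `^ al)}.
    apply: continuous_in_subspaceT => z; rewrite inE/= in_itv/= => /andP[yz _].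
    by apply: continuous_powR_gt0; exact: lt_le_trans yz.
  have [z] := MVT y1 d cf; rewrite in_itv/= => zy; rewrite [y + 1 - y]addrAC subrr add0r mulr1.
  by exists z.
have [z1 /andP[h1 h2] E1] := step x x0.
have [|z2 /andP[h3 h4] E2] := step (x + 1); first by rewrite addr_gt0.
rewrite (_ : x + 2 = x + 1 + 1); last by ring.
have z10 : 0 < z1 by exact: lt_trans h1.
have z12 : z1 <= z2 by lra.
have z20 : 0 < z2 by exact: lt_le_trans z12.
rewrite E1 E2 ler_pM2l// -(opprB 1 al) !powRN lef_pV2 ?posrE ?powR_gt0//.
by apply: ge0_ler_powR; rewrite ?nnegrE ?subr_ge0 ?(ltW z10) ?(ltW z20).
Qed.

(** The symbol (k pi)^al of -I. *)
Definition half_eig al (k : nat) : R := eigval k `^ (al / 2).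

Lemma half_eigE al k : half_eig al k = k%:R `^ al * pi `^ al.
Proof.
by rewrite /half_eig eigval_powR (_ : 2 * (al / 2) = al) ?powRM ?pi_ge0//; field.
Qed.

Lemma half_eig_mono al k : 0 < al -> half_eig al k <= half_eig al k.+1.
Proof.
move=> al0; rewrite !half_eigE ler_wpM2r ?powR_ge0//.
by apply: ge0_ler_powR; rewrite ?nnegrE ?(ltW al0)// ler_nat.
Qed.

Lemma two_powR_le2 al : 0 < al -> al <= 1 -> 2 `^ al <= 2 :> R.
Proof. by move=> al0 al1; rewrite -[leRHS]powRr1// ler_powR// ler1n. Qed.

Lemma half_eig_concave al k : 0 < al -> al <= 1 ->
  half_eig al k.+2 - half_eig al k.+1 <= half_eig al k.+1 - half_eig al k.
Proof.
move=> al0 al1; rewrite !half_eigE -!mulrBl ler_wpM2r ?powR_ge0//.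
case: k => [|k].
  rewrite powR0 ?gt_eqF// powR1; have := two_powR_le2 al0 al1; lra.
have := @powR_concave al k.+1%:R al0 al1 (ltr0Sn _ _).
have -> : k.+3%:R = k.+1%:R + 2 :> R by rewrite -natrD addn2.
by have -> : k.+2%:R = k.+1%:R + 1 :> R by rewrite natr1.
Qed.

(** Two sources of positivity. For al = 1 the second difference at 0 vanishes but every increment
    equals pi; for al < 1 the second difference at 0 is (2 - 2^al) pi^al > 0, and the increments are
    merely nonnegative. *)
Lemma half_eig_gap al : 0 < al -> al <= 1 -> exists2 kap, 0 < kap &
  forall N, kap <= 2 * ((half_eig al 1 - half_eig al 0) - (half_eig al 2 - half_eig al 1))
    + (half_eig al N.+3 - half_eig al N.+2) / 2.
Proof.
move=> al0; rewrite le_eqVlt => /predU1P[->|al1].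
  exists (pi / 2) => [|N]; first by rewrite divr_gt0// pi_gt0.
  rewrite !half_eigE !powRr1 ?pi_ge0//.
  have -> : N.+3%:R = N.+2%:R + 1 :> R by rewrite natr1.
  by have := pi_gt0 R; move: (N.+2%:R : R) (pi : R) => x p p0; lra.
have P0 : 0 < pi `^ al :> R by rewrite powR_gt0 ?pi_gt0.
exists (2 * ((2 - 2 `^ al) * pi `^ al)) => [|N].
  rewrite !mulr_gt0// subr_gt0 -[ltRHS]powRr1//.
  by rewrite /powR pnatr_eq0/= ltr_expR ltr_pM2r// ln_gt0// ltr1n.
have h := @half_eig_mono al N.+2 al0.
rewrite -[leLHS]addr0 lerD//; last by rewrite divr_ge0// subr_ge0.
rewrite !half_eigE powR0 ?gt_eqF// powR1.
by rewrite le_eqVlt; apply/orP; left; apply/eqP; ring.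
Qed.

Lemma half_eig_sqr_le al k : 0 < al -> al <= 2 ->
  half_eig al k ^+ 2 <= 1 + eigval k `^ (al / 2 + 1).
Proof.
move=> al0 al2; case: k => [|k].
  by rewrite half_eigE powR0 ?gt_eqF// mul0r expr0n/= addr_ge0// powR_ge0.
rewrite /half_eig -powR_mulrn ?powR_ge0// -powRrM.
have e1 : 1 <= eigval k.+1 :> R.
  rewrite /eigval exprn_ege1// -[leLHS]mulr1 ler_pM// ?ler1n//.
  by apply: le_trans (pi_ge2 R); rewrite ler1n.
apply: (@le_trans _ _ (eigval k.+1 `^ (al / 2 + 1))); last by rewrite lerDr.
by apply: ler_powR => //; lra.
Qed.

(** Passage to the limit in the finite inequality. The truncated symbol multiplies the tail L - S N
    by weights that tend to infinity, so convergence of S N is not enough: the absolute convergence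
    of the sums of a k x k, from the energy bound and Bessel, compensates. *)
Lemma stroock_varopoulos al : 0 < al -> al <= 1 -> exists2 kap, 0 < kap &
  forall v w Iv M C, measurable_fun Omega v -> measurable_fun Omega w ->
  (forall x, Omega x -> `|v x| <= M) -> (forall x, Omega x -> `|w x| <= M) ->
  (forall x y, Omega x -> Omega y -> 0 <= (v x - v y) * (w x - w y)) ->
  expands (coef v) v -> fracI al v Iv ->
  (forall N, \sum_(k < N) coef v k ^+ 2 * (1 + eigval k `^ (al / 2 + 1)) <= C) ->
  kap * (\int[mu]_(x in Omega) (v x * w x) -
         (\int[mu]_(x in Omega) v x) * (\int[mu]_(x in Omega) w x)) <=
  - \int[mu]_(x in Omega) (Iv x * w x).
Proof.
move=> al0 al1; have [kap0 kp H0] := half_eig_gap al0 al1.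
exists (kap0 / 2); first by rewrite divr_gt0.
move=> v w Iv M C mv mw vM wM mono ev eI HC.
have Lv := bounded_inLpO2 mv vM; have Lw := bounded_inLpO2 mw wM.
pose a k := half_eig al k; pose x k := coef v k * coef w k.
set L := \int[mu]_(x in Omega) (v x * w x).
set cov := L - _.
have a0 k : 0 <= a k by exact: powR_ge0.
have amono k : a k <= a k.+1 by exact: half_eig_mono.
have aconc k : a k.+2 - a k.+1 <= a k.+1 - a k by exact: half_eig_concave.
have a00 : a 0%N = 0 by rewrite /a half_eigE powR0 ?mul0r// gt_eqF.
pose S N := \sum_(k < N) x k; pose Y N := \sum_(k < N) a k * x k.
pose A N : R := \sum_(k < N) `|a k * x k|.
have SL : S N @[N --> \oo] --> L by exact: expands_int.
have YI : Y N @[N --> \oo] --> - \int[mu]_(x in Omega) (Iv x * w x).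
  rewrite (_ : Y = (fun N => - \sum_(k < N) - (coef v k * eigval k `^ (al / 2)) * coef w k)).
    exact: (cvgN (expands_int eI Lw)).
  by apply/funext => N; rewrite /Y -sumrN; apply: eq_bigr => k _; rewrite /a /x /half_eig; ring.
have Abnd N : A N <= C + \int[mu]_(x in Omega) (w x ^+ 2).
  apply: le_trans (lerD (HC N) (bessel N Lw)); rewrite -big_split/=; apply: ler_sum => k _.
  rewrite /x !normrM (ger0_norm (a0 k)) -(real_normK (num_real (coef v k))) -(real_normK (num_real (coef w k))).
  have := @half_eig_sqr_le al k al0 (_ : al <= 2); rewrite -/(a k) => /(_ _)/wrap[]; first by lra.
  move: (a k) (a0 k) (eigval k `^ _) (powR_ge0 (eigval k) (al / 2 + 1)) `|coef v k| `|coef w k|.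
  move=> b b0 e e0 p q h; have h2 := ler_wpM2l (sqr_ge0 p) h.
  by apply: le_trans (lerD h2 (lexx _)); have := sqr_ge0 (b * p - q); nra.
have Amono : {homo A : m n / (m <= n)%N >-> m <= n}.
  apply/nondecreasing_seqP => N; rewrite /A big_ord_recr/= lerDl; exact: normr_ge0.
have [Ai AAi] : exists Ai : R, A N @[N --> \oo] --> Ai.
  apply/cvg_ex; apply: nondecreasing_is_cvgn => //.
  by exists (C + \int[mu]_(x in Omega) (w x ^+ 2)) => _ [N _ <-]; exact: Abnd.
have ALe N : A N <= Ai.
  rewrite -(cvg_lim _ AAi)//; apply: nondecreasing_cvgn_le => //.
  by apply/cvg_ex; exists Ai.
have amono2 m j : a m <= a (m + j)%N.
  by elim: j => [|j IH]; rewrite ?addn0// addnS (le_trans IH).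
(* Since the weights do not decrease, a m times a tail of S is at most the tail of the absolutely
   weighted sums. *)
have tail m j : `|S (m + j)%N - S m| * a m <= A (m + j)%N - A m.
  elim: j => [|j IH]; first by rewrite addn0 !subrr normr0 mul0r.
  have -> : S (m + j.+1)%N = S (m + j)%N + x (m + j)%N by rewrite addnS /S big_ord_recr.
  have -> : A (m + j.+1)%N = A (m + j)%N + `|a (m + j)%N * x (m + j)%N|.
    by rewrite addnS /A big_ord_recr.
  rewrite addrAC (addrAC (A _)).
  apply: (le_trans (ler_wpM2r (a0 m) (ler_normD _ _))); rewrite mulrDl lerD//.
  by rewrite (normrM (a _)) (ger0_norm (a0 _)) mulrC ler_wpM2r.
have tailL m : `|L - S m| * a m <= Ai - A m.
  have L1 : `|S j - S m| * a m @[j --> \oo] --> `|L - S m| * a m.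
    apply: cvgMl => //; apply: cvg_norm; apply: cvgB => //; exact: cvg_cst.
  apply: (ler_cvg_to L1 (cvg_cst (Ai - A m))); near=> j.
  have mj : (m <= j)%N by near: j; exact: nbhs_infty_ge.
  rewrite -(subnKC mj); apply: (le_trans (tail m _)); rewrite lerD2r; exact: ALe.
have main N : kap0 * cov <= 2 * (Ai - A N.+3) + 2 * Y N.+3.
  pose b k := a N.+2 + a N.+3 - 2 * a k.
  have := @stroock_varopoulos_finite R b kap0 N.+2 v w M mv mw vM wM mono.
  move=> /(_ _)/wrap[].
    by move=> y z; apply: kernel_lower_bound => //; exact: H0.
  rewrite -/L -/cov => /le_trans; apply.
  have -> : b 0%N * L - \sum_(k < N.+3) b k * (coef v k * coef w k) =
      (a N.+2 + a N.+3) * (L - S N.+3) + 2 * Y N.+3.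
    rewrite /b a00 mulr0 subr0 mulrBr -addrA; congr (_ + _).
    rewrite /S /Y !mulr_sumr -sumrN -[in RHS]sumrN -big_split/=; apply: eq_bigr => k _.
    by rewrite /x; ring.
  rewrite lerD2r; have := tailL N.+3; have := amono N.+2; have := a0 N.+2.
  have := ler_norm (L - S N.+3); have := normr_ge0 (L - S N.+3).
  move: (L - S N.+3) (a N.+2) (a N.+3) => d p q D0 dD p0 pq h.
  have h1 : (p + q) * d <= (p + q) * `|d| by rewrite ler_wpM2l// addr_ge0// (le_trans p0).
  have h2 := ler_wpM2r D0 pq; lra.
have RHS : 2 * (Ai - A N.+3) + 2 * Y N.+3 @[N --> \oo] -->
    2 * (Ai - Ai) + 2 * (- \int[mu]_(x in Omega) (Iv x * w x)).
  have A3 : A N.+3 @[N --> \oo] --> Ai by rewrite (cvg_shiftS (fun N => A N.+2)) (cvg_shiftS (fun N => A N.+1)) cvg_shiftS.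
  have Y3 : Y N.+3 @[N --> \oo] --> - \int[mu]_(x in Omega) (Iv x * w x).
    by rewrite (cvg_shiftS (fun N => Y N.+2)) (cvg_shiftS (fun N => Y N.+1)) cvg_shiftS.
  apply: cvgD; last by apply: cvgMr.
  by apply: cvgMr => //; apply: cvgB => //; exact: cvg_cst.
have fin : kap0 * cov <= 2 * (Ai - Ai) + 2 * (- \int[mu]_(x in Omega) (Iv x * w x)).
  apply: (ler_cvg_to (cvg_cst (kap0 * cov)) RHS); exact: nearW.
by move: fin; rewrite subrr mulr0 add0r; lra.
Unshelve. all: by end_near. Qed.

(** Take w = v^n. Where v >= m + 1 one has v^(n+1) - m v^n >= v^n, and elsewhere v^n is bounded, so
    the covariance controls int v^n. The constant [K] is fixed before [M] and [C]: the supremum and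
    the energy of the slice do not enter it. *)
Lemma power_integral_bound al (m n : R) : 0 < al -> al <= 1 -> 0 < n -> 0 <= m ->
  exists2 K, 0 < K & forall v Iv M C, measurable_fun Omega v ->
  (forall x, Omega x -> 0 <= v x <= M) ->
  \int[mu]_(x in Omega) v x = m ->
  expands (coef v) v -> fracI al v Iv ->
  (forall N, \sum_(k < N) coef v k ^+ 2 * (1 + eigval k `^ (al / 2 + 1)) <= C) ->
  \int[mu]_(x in Omega) (v x `^ n) <=
    K * (1 + \int[mu]_(x in Omega) `|v x `^ n * Iv x|).
Proof.
move=> al0 al1 n0 m0; have [kap kp SV] := stroock_varopoulos al0 al1.
have mO := @measurable_Omega R.
(* The worst case of (1 + m) v^n on the set where v < m + 1. *)
pose c := (m + 1) `^ n * (1 + m).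
have c0 : 0 <= c by rewrite mulr_ge0 ?powR_ge0// addr_ge0.
exists (kap^-1 + c); first by rewrite ltr_pwDl// invr_gt0.
move=> v Iv M C mv vM Ev ev eI HC.
have mw : measurable_fun Omega (fun x => v x `^ n).
  by apply: (@measurableT_comp _ _ _ _ _ _ (fun x : R => x `^ n)) => //; exact: measurable_powR.
pose M' := Num.max M (M `^ n).
have vb x : Omega x -> `|v x| <= M'.
  by move=> Ox; have /andP[h1 h2] := vM x Ox; rewrite ger0_norm// le_max h2.
have wb x : Omega x -> `|v x `^ n| <= M'.
  move=> Ox; have /andP[h1 h2] := vM x Ox; rewrite ger0_norm ?powR_ge0// le_max.
  apply/orP; right; apply: ge0_ler_powR; rewrite ?nnegrE ?(ltW n0)//.
  exact: le_trans h1 h2.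
have mono x y : Omega x -> Omega y -> 0 <= (v x - v y) * (v x `^ n - v y `^ n).
  move=> Ox Oy; have /andP[h1 _] := vM x Ox; have /andP[h2 _] := vM y Oy.
  have P (p q : R) : 0 <= p -> 0 <= q -> p <= q -> p `^ n <= q `^ n.
    by move=> p0 q0 pq; apply: ge0_ler_powR; rewrite ?nnegrE ?(ltW n0).
  have [vxy|/ltW vxy] := leP (v x) (v y).
    by rewrite mulr_le0// subr_le0// P.
  by rewrite mulr_ge0// subr_ge0// P.
have Lv := bounded_inLpO2 mv vb; have Lw := bounded_inLpO2 mw wb.
have LI : inLpO 2%:E Iv by case: eI.
have := SV v (fun x => v x `^ n) Iv M' C mv mw vb wb mono ev eI HC; rewrite Ev.
have ivw := inLpO2_mul_integrable Lv Lw; have iw := inLpO2_integrable Lw.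
have iIw := inLpO2_mul_integrable LI Lw.
set VW := \int[mu]_(x in Omega) (v x * v x `^ n); set W := \int[mu]_(x in Omega) (v x `^ n).
have h1 : - (\int[mu]_(x in Omega) (Iv x * v x `^ n)) <= \int[mu]_(x in Omega) `|v x `^ n * Iv x|.
  apply: le_trans (ler_norm _) _; rewrite normrN.
  apply: le_trans (le_normr_Rintegral _ iIw) _ => //.
  by under [leRHS]eq_Rintegral do rewrite mulrC.
have h2 : W <= VW - m * W + c.
  have i1 : mu.-integrable Omega (EFin \o (fun x => m * v x `^ n)) by exact: integrableRZl.
  have i2 : mu.-integrable Omega (EFin \o (fun x => v x * v x `^ n - m * v x `^ n)) by exact: integrableRB.
  have i3 : mu.-integrable Omega (EFin \o (fun=> c)).
    by apply: inLpO2_integrable; apply: (@bounded_inLpO2 _ _ `|c|).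
  have -> : VW - m * W + c = \int[mu]_(x in Omega) (v x * v x `^ n - m * v x `^ n + c).
    by rewrite RintegralD// RintegralB// RintegralZl// Rintegral_cst// [X in fine X]mu_Omega mulr1.
  apply: le_Rintegral => //; first exact: integrableRD.
  move=> x Ox; have /andP[v0 _] := vM x Ox; have p0 := powR_ge0 (v x) n.
  have [vm|vm] := leP (m + 1) (v x).
    have := ler_wpM2r p0 vm; rewrite mulrDl mul1r => h; move: c0; rewrite -/c; lra.
  have pc : v x `^ n <= (m + 1) `^ n.
    by apply: ge0_ler_powR; rewrite ?nnegrE ?(ltW n0) ?(ltW vm)// addr_ge0.
  have m1 : 0 <= 1 + m by rewrite addr_ge0.
  rewrite /c; have := ler_wpM2r m1 pc; have := mulr_ge0 p0 v0.
  move: (v x `^ n) ((m + 1) `^ n) (v x) => p q r; nra.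
set AI := \int[mu]_(x in Omega) `|_| in h1 *.
have AI0 : 0 <= AI by apply: Rintegral_ge0.
move=> h3; have h4 : VW - m * W <= kap^-1 * AI.
  by rewrite -ler_pdivrMl ?invr_gt0// invrK; exact: le_trans h1.
rewrite mulrDr mulr1 mulrDl; have k0 : 0 <= kap^-1 by rewrite invr_ge0 ltW.
have := mulr_ge0 c0 AI0; lra.
Qed.

End StroockVaropoulos.

(** * Entropy and positivity *)

Section Entropy.
Context {R : realType}.
Local Notation mu := (@lebesgue_measure R).
Implicit Types (f h F v : R -> R) (c : nat -> R).

Lemma Rintegral_FTC2 f F (a b : R) : a < b ->
  (forall x : R, a <= x -> is_derive x 1 F (f x)) ->
  (forall x : R, a <= x -> {for x, continuous f}) ->
  mu.-integrable `[a, b] (EFin \o f) /\ \int[mu]_(x in `[a, b]) f x = F b - F a.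
Proof.
move=> ab dF cf.
have cF (x : R) : a <= x -> {for x, continuous F}.
  move=> ax; apply: differentiable_continuous; apply/derivable1_diffP.
  by have [] := dF x ax.
have cfw : {within `[a, b], continuous f}.
  apply: continuous_in_subspaceT => x; rewrite inE/= in_itv/= => /andP[ax _].
  exact: cf.
split; first by apply: continuous_compact_integrable => //; exact: segment_compact.
rewrite /Rintegral (@continuous_FTC2 _ f F)//.
- split.
  + by move=> x; rewrite in_itv/= => /andP[ax _]; have [] := dF x (ltW ax).
  + by apply: cvg_at_right_filter; exact: cF.
  + by apply: cvg_at_left_filter; apply: cF; exact: ltW.
- move=> x; rewrite in_itv/= => /andP[ax _]; rewrite derive1E.
  by have [_ ->] := dF x (ltW ax).
Qed.

Lemma oriented_int_FTC2 h f F (a b : R) : 0 < a -> 0 < b ->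
  (forall x : R, 0 < x -> h x = f x) ->
  (forall x : R, 0 < x -> is_derive x 1 F (f x)) ->
  (forall x : R, 0 < x -> {for x, continuous f}) ->
  oriented_int h a b = F b - F a.
Proof.
move=> a0 b0 hf dF cf; rewrite /oriented_int.
have E p q : 0 < p -> \int[mu]_(x in `[p, q]) h x = \int[mu]_(x in `[p, q]) f x.
  move=> p0; apply: eq_Rintegral => x; rewrite inE/= in_itv/= => /andP[px _].
  by rewrite hf// (lt_le_trans p0).
have O p q : q < p -> \int[mu]_(x in `[p, q]) f x = 0.
  by move=> qp; rewrite set_itv_ge ?bnd_simp -?ltNge// Rintegral_set0.
rewrite !E//; have [ab|ba|<-] := ltgtP a b.
- rewrite (O b a)// subr0; apply: (Rintegral_FTC2 ab _ _).2 => x ax.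
    by apply: dF; exact: lt_le_trans ax.
  by apply: cf; exact: lt_le_trans ax.
- rewrite (O a b)// sub0r -[RHS]opprB; congr (- _).
  apply: (Rintegral_FTC2 ba _ _).2 => x ax.
    by apply: dF; exact: lt_le_trans ax.
  by apply: cf; exact: lt_le_trans ax.
- by rewrite !subrr.
Qed.

Lemma is_derive_powR (p x : R) : 0 < x ->
  is_derive x 1 (fun y => y `^ (p + 1)) ((p + 1) * x `^ p).
Proof.
by move=> x0; have := is_derive1_powR (p + 1) x0; rewrite addrK.
Qed.

Lemma Gpos_formula (n s : R) : 2 < n -> 0 < s ->
  Gpos n s = (s - 1) / (n - 1) + (s `^ (2 - n) - 1) / ((n - 1) * (n - 2)).
Proof.
move=> n2 s0.
have n1 : n - 1 != 0 by rewrite subr_eq0 gt_eqF// (lt_trans _ n2)// ltr1n.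
have n2' : n - 2 != 0 by rewrite subr_eq0 gt_eqF.
have n1' : 1 - n != 0 by rewrite -opprB oppr_eq0.
have inner r : 0 < r -> oriented_int (fun t => t `^ (- n)) 1 r = (1 - r `^ (1 - n)) / (n - 1).
  move=> r0.
  apply: etrans (@oriented_int_FTC2 _ (fun t => t `^ (- n)) (fun t => (1 - n)^-1 * t `^ (- n + 1))
    1 r ltr01 r0 _ _ _) _ => //; last first.
  - by rewrite powR1 (addrC _ 1); field; rewrite n1.
  - by move=> x x0; exact: continuous_powR_gt0.
  - move=> x x0; have d := is_derive_powR (- n) x0.
    by apply: is_derive_eq; rewrite /GRing.scale/= (addrC _ 1) mulrA mulVf// mul1r.
apply: etrans (@oriented_int_FTC2 _ (fun r => (n - 1)^-1 - (n - 1)^-1 * r `^ (1 - n))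
  (fun r => (n - 1)^-1 * r - ((n - 1) * (2 - n))^-1 * r `^ (1 - n + 1)) 1 s ltr01 s0 _ _ _) _;
  last first.
- rewrite powR1 (_ : 1 - n + 1 = 2 - n); last by ring.
  by field; rewrite n1 n2' -opprB oppr_eq0.
- move=> x x0; apply: cvgB; first exact: cvg_cst.
  by apply: cvgMr; exact: continuous_powR_gt0.
- move=> x x0; have d := is_derive_powR (1 - n) x0.
  apply: is_derive_eq; rewrite /GRing.scale/= (_ : 1 - n + 1 = 2 - n); last by ring.
  by move: (x `^ _) => y; field; rewrite n1 -opprB oppr_eq0.
- by move=> x x0; rewrite inner//; field.
Qed.

Lemma powRN_ge (p x : R) : 0 <= p -> 0 < x -> 1 - p * ln x <= x `^ (- p).
Proof.
by move=> p0 x0; rewrite /powR gt_eqF// mulNr; exact: expR_ge1Dx.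
Qed.

(** By convexity of the exponential s^(2-n) >= 1 - (n-2) ln s, and ln s <= s - 1 cancels the linear
    part. *)
Lemma Gpos_ge0 (n s : R) : 2 < n -> 0 < s -> 0 <= Gpos n s.
Proof.
move=> n2 s0; rewrite Gpos_formula//.
have n1 : 0 < n - 1 by lra.
have n2' : 0 < n - 2 by lra.
have -> : (s - 1) / (n - 1) + (s `^ (2 - n) - 1) / ((n - 1) * (n - 2)) =
  ((n - 2) * (s - 1) + (s `^ (2 - n) - 1)) / ((n - 1) * (n - 2)).
  by field; rewrite !gt_eqF.
rewrite divr_ge0//; last by rewrite mulr_ge0 ?ltW.
have := @powRN_ge (n - 2) s (ltW n2') s0; rewrite opprB.
have : ln s <= s - 1.
  by have := @le_ln1Dx R (s - 1); rewrite addrCA subrr addr0; apply; lra.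
move=> /(ler_wpM2l (ltW n2')); lra.
Qed.

Lemma Gpos_lower (n s : R) : 2 < n -> 0 < s ->
  s `^ (2 - n) / ((n - 1) * (n - 2)) - ((n - 1)^-1 + ((n - 1) * (n - 2))^-1) <= Gpos n s.
Proof.
move=> n2 s0; rewrite Gpos_formula//.
have n1 : 0 <= (n - 1)^-1 by rewrite invr_ge0; lra.
by have := mulr_ge0 (ltW s0) n1; rewrite !mulrBl !mul1r; lra.
Qed.

Lemma G_cases (n s : R) : 2 < n -> G n s = if 0 < s then (Gpos n s)%:E else +oo%E.
Proof.
move=> n2; rewrite /G; case: ifPn => // _; case: ifPn => // _.
apply: cvg_lim => //; apply/cvgeyPge => A.
set k := (n - 1) * (n - 2); have k0 : 0 < k by rewrite mulr_gt0//; lra.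
set D := (n - 1)^-1 + k^-1.
have n2' : 0 < n - 2 by lra.
(* The solution of 1 - (n-2) ln d = k (A + D), so that the lower bound on Gpos reaches A below d. *)
pose d := expR ((1 - k * (A + D)) / (n - 2)).
near=> r; have r0 : 0 < r by near: r; exact: nbhs_right_gt.
have rd : r < d by near: r; apply: nbhs_right_lt; exact: expR_gt0.
rewrite lee_fin; apply: le_trans (Gpos_lower n2 r0); rewrite -/k -/D.
rewrite lerBrDr ler_pdivlMr// mulrC.
have := @powRN_ge (n - 2) r (ltW n2') r0; rewrite opprB; apply: le_trans.
have : ln r <= ln d by rewrite ler_ln ?posrE ?expR_gt0// ltW.
rewrite /d expRK ler_pdivlMr// mulrC; lra.
Unshelve. all: by end_near. Qed.

Lemma G_ge0 (n s : R) : 2 < n -> (0 <= G n s)%E.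
Proof.
by move=> n2; rewrite G_cases//; case: ifPn => // s0; rewrite lee_fin Gpos_ge0.
Qed.

Lemma measurable_G D (n : R) : 2 < n -> measurable_fun D (G n).
Proof.
move=> n2; apply: measurable_funTS.
have -> : G n = fun s : R => if 0 < s then
    ((s - 1) / (n - 1) + (s `^ (2 - n) - 1) / ((n - 1) * (n - 2)))%:E else +oo%E.
  by apply/funext => s; rewrite G_cases//; case: ifPn => // s0; rewrite Gpos_formula.
apply: measurable_fun_if => //.
- exact: measurable_fun_ltr.
- apply: measurable_funTS; apply/measurable_EFinP.
  apply: measurable_funD; apply: measurable_funM => //.
    exact: measurable_funB.
  by apply: measurable_funB => //; exact: measurable_powR.
Qed.

(** The lower bound q/(x - x0) <= G(v) + D is integrated from x0 + e to x0 + d: the left side grows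
    like -q ln e, while the right side stays below the total entropy plus D. Where v vanishes, G is
    infinite and the bound is trivial. *)
Lemma cosine_series_gt0 c (al n M : R) : 0 < al < 2 -> 2 + 2 / (al + 1) < n ->
  (forall N, \sum_(k < N) c k ^+ 2 * (1 + eigval k `^ (al / 2 + 1)) <= M) ->
  (forall x, Omega x -> 0 <= cosine_series c x) ->
  (\int[mu]_(x in Omega) G n (cosine_series c x) < +oo)%E ->
  forall x, Omega x -> 0 < cosine_series c x.
Proof.
move=> /andP[al0 al2] hn HM v0 Gv x0 Ox0; rewrite lt_neqAle v0// andbT eq_sym.
apply/negP => /eqP vx0.
have al1 : 0 < al + 1 by lra.
have n2 : 2 < n by apply: lt_trans hn; rewrite ltrDl divr_gt0.
have n2' : 0 < n - 2 by lra.
pose b := (n - 2)^-1; have b0 : 0 < b by rewrite invr_gt0.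
have bal : b < (al + 1) / 2.
  by rewrite /b -[ltRHS]invrK ltf_pV2 ?posrE ?invr_gt0 ?divr_gt0// invf_div; lra.
have [B0 hB0] := @weighted_sum_bounded R (al / 2 + 1) 0 (lexx _) ltac:(lra).
have A0 : abs_bounded c 0 (M + B0) by move=> N; exact: hB0.
have [B1 hB1] := @weighted_sum_bounded R (al / 2 + 1) b (ltW b0) ltac:(lra).
have A1 : abs_bounded c b (M + B1) by move=> N; exact: hB1.
have b2 : 0 <= b <= 2 by rewrite (ltW b0)/=; lra.
pose K := `|4 * Num.sqrt 2 * (M + B1)| + 1.
have K0 : 0 < K by rewrite ltr_wpDl.
have /andP[x00 x01] : 0 < x0 < 1 by rewrite -OmegaP.
(* Half the distance to the boundary keeps both x0 + h and x0 - h in the interval. *)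
pose d := Num.min x0 (1 - x0) / 2.
have [d0 dx0 dx1] : [/\ 0 < d, d < x0 & d < 1 - x0].
  have m0 : 0 < Num.min x0 (1 - x0) by rewrite lt_min x00 subr_gt0.
  have m1 : Num.min x0 (1 - x0) <= x0 by rewrite ge_min lexx.
  have m2 : Num.min x0 (1 - x0) <= 1 - x0 by rewrite ge_min lexx orbT.
  by rewrite /d; split; lra.
have vK (h : R) : 0 < h -> h <= d -> cosine_series c (x0 + h) <= K * h `^ b.
  move=> h0 hd.
  have O1 : Omega (x0 + h) by rewrite OmegaP; apply/andP; split; lra.
  have O2 : Omega (x0 - h) by rewrite OmegaP; apply/andP; split; lra.
  have := cosine_series_diff2 x0 h A0 b2 A1; rewrite vx0 mulr0 subr0.
  rewrite ger0_norm ?addr_ge0 ?v0// (gtr0_norm h0) => E.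
  apply: le_trans (le_trans E _); first by rewrite lerDl v0.
  by rewrite ler_wpM2r ?powR_ge0// /K (le_trans (ler_norm _))// lerDl.
pose k := (n - 1) * (n - 2); have k0 : 0 < k by rewrite mulr_gt0//; lra.
pose D := (n - 1)^-1 + k^-1.
have D0 : 0 <= D by rewrite addr_ge0// invr_ge0; lra.
pose q := K `^ (2 - n) / k; have q0 : 0 < q by rewrite divr_gt0// powR_gt0.
have low (x : R) : x0 < x <= x0 + d -> ((q * (x - x0)^-1)%:E <= G n (cosine_series c x) + D%:E)%E.
  move=> /andP[x0x xd]; have h0 : 0 < x - x0 by rewrite subr_gt0.
  rewrite G_cases//; case: ifPn => vx; last by rewrite addye// leey.
  rewrite -EFinD lee_fin -lerBlDr.
  apply: le_trans (Gpos_lower n2 vx); rewrite -/k -/D lerB// /q mulrAC.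
  rewrite ler_wpM2r//; first by rewrite invr_ge0 ltW.
  have h1 : cosine_series c x <= K * (x - x0) `^ b.
    by rewrite -{1}(subrK x0 x) (addrC _ x0) vK//; lra.
  have -> : K `^ (2 - n) * (x - x0)^-1 = (K * (x - x0) `^ b) `^ (2 - n).
    rewrite powRM ?powR_ge0 ?ltW// -powRrM (_ : b * (2 - n) = -1) ?powR_inv1 ?ltW//.
    by rewrite -(opprB n 2) mulrN mulVf// gt_eqF.
  rewrite -(opprB n 2) !powRN lef_pV2 ?posrE ?powR_gt0//; last by rewrite mulr_gt0// powR_gt0.
  by apply: ge0_ler_powR => //; rewrite ?nnegrE ltW// mulr_gt0// powR_gt0.
have mO := @measurable_Omega R.
have mv : measurable_fun Omega (fun x => G n (cosine_series c x)).
  apply: (measurableT_comp (f := G n)); last exact: measurable_cosine_series A0.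
  exact: measurable_G.
pose H x : \bar R := (G n (cosine_series c x) + D%:E)%E.
have up (e : R) : 0 < e -> e < d -> ((q * (ln d - ln e))%:E <=
    \int[mu]_(x in Omega) G n (cosine_series c x) + D%:E)%E.
  move=> e0 ed; have ab : x0 + e < x0 + d by rewrite ltrD2l.
  have [|x ax|i1 i2] := @Rintegral_FTC2 (fun x => q * (x - x0)^-1) (fun x => q * ln (x - x0)) _ _ ab.
  - move=> x ax; have xx0 : 0 < x - x0 by lra.
    have := is_derive1_ln xx0 => dl.
    have dx : is_derive x 1 (fun x : R => x - x0) 1.
      by apply: is_derive_eq; rewrite subr0.
    have := @is_derive1_comp R (@ln R) (fun x => x - x0) x _ _ dl dx.
    by move=> d1; apply: is_derive_eq; rewrite /GRing.scale/= mulr1.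
  - apply: cvgMr; apply: cvgV; first by rewrite gt_eqF//; lra.
    by apply: cvgB => //; exact: cvg_cst.
  have -> : q * (ln d - ln e) = \int[mu]_(x in `[x0 + e, x0 + d]) (q * (x - x0)^-1).
    by rewrite i2 !(addrC x0) !addrK mulrBr.
  rewrite EFin_Rintegral//.
  have sub : `[x0 + e, x0 + d] `<=` (Omega : set R).
    by apply: subset_itv_Omega; lra.
  have mJ : measurable `[x0 + e, x0 + d]%classic by exact: measurable_itv.
  move: i1 sub mJ; set J := [set` _] => i1 sub mJ.
  have s1 : ((\int[mu]_(x in J) (q * (x - x0)^-1)%:E) <=
      \int[mu]_(x in J) H x)%E.
    apply: ge0_le_integral => //.
    - move=> x; rewrite /J/= in_itv/= => /andP[ax _]; rewrite lee_fin mulr_ge0 ?(ltW q0)//.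
      by rewrite invr_ge0; lra.
    - exact: (measurable_int mu).
    - by apply: emeasurable_funD => //; exact: (measurable_funS mO).
    - move=> x; rewrite /J/= in_itv/= => /andP[ax xb]; apply: low; rewrite xb andbT; lra.
  apply: (le_trans s1).
  have s2 : ((\int[mu]_(x in J) H x) <= \int[mu]_(x in Omega) H x)%E.
    apply: ge0_subset_integral => //.
    - exact: emeasurable_funD.
    - by move=> x _; rewrite adde_ge0// G_ge0.
  apply: (le_trans s2); rewrite ge0_integralD//.
  - by rewrite integral_cst// [X in (_ * X)%E]mu_Omega mule1.
  - by move=> x _; exact: G_ge0.
have I0 : (0 <= \int[mu]_(x in Omega) G n (cosine_series c x))%E.
  by apply: integral_ge0 => x _; exact: G_ge0.
have Ifin : (\int[mu]_(x in Omega) G n (cosine_series c x))%E \is a fin_num by rewrite ge0_fin_numE.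
rewrite -(fineK Ifin) in up; set r := fine _ in up.
have r0 : 0 <= r by exact: fine_ge0.
(* With ln e = ln d - t the lower bound becomes q t = r + D + q, which exceeds the upper bound r +
   D. *)
pose t := (r + D) / q + 1; have t0 : 0 < t.
  apply: ltr_wpDl; last exact: ltr01.
  by apply: divr_ge0; [exact: addr_ge0|exact: ltW].
have := up (expR (ln d - t)) (expR_gt0 _).
rewrite -ltr_ln ?posrE ?expR_gt0// expRK => /(_ ltac:(lra)).
rewrite -EFinD lee_fin opprB addrCA subrr addr0 /t mulrDr mulr1 mulrC divfK ?gt_eqF//.
lra.
Qed.

End Entropy.

(** * The pressure at a fixed time *)

Section Slice.
Context {R : realType}.
Local Notation mu := (@lebesgue_measure R).
Implicit Types (f g h F v w : R -> R) (c : nat -> R).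

Lemma ae_exists_itv (P : R -> Prop) (a b : R) : {ae mu, forall x, P x} -> a < b ->
  exists2 x, a < x < b & P x.
Proof.
move=> [N [mN N0 sub]] ab; apply: contrapT => H.
have : (mu `]a, b[%classic <= mu N)%E.
  apply: (le_measure mu); rewrite ?inE//.
  move=> x; rewrite /= in_itv/= => xab; apply: sub => Px; apply: H.
  by exists x.
by rewrite N0 lebesgue_measure_itv/= lte_fin ab -EFinB lee_fin; lra.
Qed.

Lemma continuous_ae_eq f g : (forall x : R, 0 < x < 1 -> {for x, continuous f}) ->
  (forall x : R, 0 < x < 1 -> {for x, continuous g}) ->
  {ae mu, forall x, Omega x -> f x = g x} -> forall x : R, 0 < x < 1 -> f x = g x.
Proof.
move=> cf cg E x x01; apply: contrapT => /eqP; rewrite -subr_eq0 => h0.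
have ch : (fun y => f y - g y) y @[y --> x] --> f x - g x by apply: cvgB; [exact: cf|exact: cg].
have : \forall y \near x, f y - g y != 0 /\ 0 < y < 1.
  near=> y; split.
    near: y; have := @cvgr_neq0 _ _ _ _ _ _ _ ch h0; exact.
  by apply/andP; split; near: y; [apply: lt_nbhsr|apply: lt_nbhsl]; case/andP: x01.
move=> /nbhs_ballP[e /= e0 He].
have xe : x - e < x + e by lra.
have [y /andP[xy yx] Ey] := ae_exists_itv E xe.
have [] := He y.
  by rewrite /ball/= ltr_norml; apply/andP; split; lra.
by rewrite subr_eq0 => /eqP fg y01; apply: fg; apply: Ey; rewrite OmegaP.
Unshelve. all: by end_near. Qed.

Lemma is_primitive_eq f F H : is_primitive f F -> (forall x : R, 0 < x < 1 -> F x = H x) ->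
  is_primitive f H.
Proof.
move=> pF FH a b a0 ab b1; have [i E] := pF a b a0 ab b1.
by split=> //; rewrite -E -!FH//; apply/andP; split; lra.
Qed.

(** Du Bois-Reymond yields some primitive equal to [u] almost everywhere; continuity identifies it
    with [v] everywhere. *)
Lemma weak_deriv_primitive (u ux v : R -> R) : weak_deriv u ux ->
  (forall x : R, 0 < x < 1 -> {for x, continuous v}) ->
  {ae mu, forall x, Omega x -> u x = v x} -> is_primitive ux v.
Proof.
move=> [lu lux wu] cv uv.
have [|||F [pF uF]] := @du_bois_reymond R u ux.
- by move=> a b a0 _ b1; exact: locally_integrable_itv.
- by move=> a b a0 _ b1; exact: locally_integrable_itv.
- move=> p q j p0 _ q1; rewrite -(wu (bump_primitive (ratr p) (ratr q) j)).
    apply: eq_Rintegral => x _; congr (_ * _); rewrite derive1E.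
    by have [_ ->] := bump_primitive_derive (ratr p : R) (ratr q) j x.
  exact: test1_bump_primitive.
apply: (is_primitive_eq pF); apply: continuous_ae_eq => //.
  by move=> x x01; apply: is_primitive_continuous x01; exact: pF.
by apply: ae_mono (ae_and uv uF) => x [E1 E2] Ox; rewrite -E1// -E2.
Qed.

Lemma powR_pow (x p q : R) : 0 < x -> x `^ p * x `^ q = x `^ (p + q).
Proof. by move=> x0; rewrite powRD//; apply/implyP => _; rewrite gt_eqF. Qed.

Lemma is_primitive_powR p f F : (forall x : R, 0 < x < 1 -> 0 < F x) -> is_primitive f F ->
  is_primitive (fun x => f x * (p * F x `^ (p - 1))) (fun x => F x `^ p).
Proof.
move=> F0 pF; apply: (@is_primitive_comp R (fun y => y `^ p) (fun y => p * y `^ (p - 1))) => //.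
by move=> y y0; apply: cvgMr; exact: continuous_powR_gt0.
Qed.

(* Dividing u^(n/2) I(u) by the positive function v^(n/2) turns the defining
   identity of g into a derivative of I(u) itself. *)
Lemma pressure_primitive (n : R) (u v ux Iu g : R -> R) :
  measurable_fun Omega v -> measurable_fun Omega g ->
  {ae mu, forall x, Omega x -> u x = v x} ->
  (forall x : R, 0 < x < 1 -> 0 < v x) -> is_primitive ux v ->
  let V x := u x `^ (n / 2) * Iu x in
  let W x := n / 2 * u x `^ ((n - 2) / 2) * ux x * Iu x in
  (forall a b, 0 < a -> a <= b -> b < 1 -> mu.-integrable `[a, b] (EFin \o V)) ->
  (forall a b, 0 < a -> a <= b -> b < 1 -> mu.-integrable `[a, b] (EFin \o (fun x => g x + W x))) ->
  (forall (p q : rat) j, 0 < ratr p :> R -> (ratr p : R) < ratr q -> ratr q < 1 :> R ->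
    \int[mu]_(x in Omega) (V x * mean0_bump (ratr p) (ratr q) j x) =
    - \int[mu]_(x in Omega) ((g x + W x) * bump_primitive (ratr p) (ratr q) j x)) ->
  exists It, is_primitive (fun x => g x * v x `^ (- (n / 2))) It /\
    {ae mu, forall x, Omega x -> Iu x = It x}.
Proof.
move=> mv mg uv v0 pv V W iV iW id.
have [F [pF VF]] := du_bois_reymond iV iW id.
exists (fun x => F x * v x `^ (- (n / 2))).
have ae0 : {ae mu, forall x, Omega x -> F x = v x `^ (n / 2) * Iu x /\ u x = v x}.
  by apply: ae_mono (ae_and uv VF) => x [E1 E2] Ox; rewrite -E2// /V E1.
split; last first.
  apply: ae_mono ae0 => x E Ox; have [-> _] := E Ox.
  have vx : 0 < v x by apply: v0; rewrite -OmegaP.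
  by rewrite mulrAC powR_pow// subrr powRr0 mul1r.
apply: is_primitive_ae (is_primitiveM pF (is_primitive_powR (- (n / 2)) v0 pv)) _ _.
  apply: measurable_funM => //.
  by apply: (@measurableT_comp _ _ _ _ _ _ (fun x : R => x `^ (- (n / 2)))) => //; exact: measurable_powR.
apply: ae_mono ae0 => x E Ox; have [-> ux'] := E Ox.
have vx : 0 < v x by apply: v0; rewrite -OmegaP.
rewrite /W ux' mulrDl -addrA -[RHS]addr0; congr (_ + _).
have E1 : v x `^ ((n - 2) / 2) * v x `^ (- (n / 2)) = v x `^ (- 1).
  by rewrite powR_pow//; congr (_ `^ _); field.
have E2 : v x `^ (- (n / 2) - 1) * v x `^ (n / 2) = v x `^ (- 1).
  by rewrite powR_pow//; congr (_ `^ _); ring.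
rewrite (_ : _ + _ = n / 2 * ux x * Iu x * (v x `^ ((n - 2) / 2) * v x `^ (- (n / 2))
   - v x `^ (- (n / 2) - 1) * v x `^ (n / 2))); last by ring.
by rewrite E1 E2 subrr mulr0.
Qed.

(** The product I(u) v^n psi is locally absolutely continuous with compact support; the three terms
    of its derivative are J psi, B and C. *)
Lemma flux_identity (n a b : R) (u v ux Iu It g psi dpsi : R -> R) :
  0 < a -> a <= b -> b < 1 ->
  measurable_fun Omega v ->
  {ae mu, forall x, Omega x -> u x = v x} ->
  (forall x : R, 0 < x < 1 -> 0 < v x) -> is_primitive ux v ->
  is_primitive (fun x => g x * v x `^ (- (n / 2))) It ->
  {ae mu, forall x, Omega x -> Iu x = It x} ->
  (forall x : R, is_derive x 1 psi (dpsi x)) -> continuous dpsi ->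
  (forall x, Omega x -> ~~ (a < x < b) -> psi x = 0 /\ dpsi x = 0) ->
  let J x := v x `^ n * (g x * v x `^ (- (n / 2))) in
  let B x := n * u x `^ (n - 1) * ux x * Iu x * psi x in
  let C x := u x `^ n * Iu x * dpsi x in
  mu.-integrable Omega (EFin \o B) -> mu.-integrable Omega (EFin \o C) ->
  mu.-integrable Omega (EFin \o (fun x => J x * psi x)) ->
  \int[mu]_(x in Omega) B x + \int[mu]_(x in Omega) C x =
  - \int[mu]_(x in Omega) (J x * psi x).
Proof.
move=> a0 ab b1 mv uv v0 pv pI II dpsi_ cdpsi supp J B C iB iC iJ.
have mO := @measurable_Omega R.
have pp : is_primitive dpsi psi by exact: is_primitive_derive.
pose h x := g x * v x `^ (- (n / 2)).
have pM := is_primitiveM pI (is_primitiveM (is_primitive_powR n v0 pv) pp).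
set k := (X in is_primitive X _) in pM.
have iBC : mu.-integrable Omega (EFin \o (fun x => B x + C x)) by exact: integrableRD.
have iS : mu.-integrable Omega (EFin \o (fun x => J x * psi x + (B x + C x))) by exact: integrableRD.
have mS := integrable_measurableR iS.
have kS : {ae mu, forall x, Omega x -> k x = J x * psi x + (B x + C x)}.
  apply: ae_mono (ae_and uv II) => x [E1 E2] Ox.
  rewrite /k /J /B /C E1// E2//; ring.
have pS : is_primitive (fun x => J x * psi x + (B x + C x)) (fun x => It x * (v x `^ n * psi x)).
  exact: is_primitive_ae pM mS kS.
have Z : \int[mu]_(x in Omega) (J x * psi x + (B x + C x)) = 0.
  apply: (is_primitive_compact pS a0 ab b1) => x Ox xab.
  by have [p0 d0] := supp x Ox xab; rewrite /B /C p0 d0 !mulr0 !addr0.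
rewrite -RintegralD//; apply/eqP; rewrite -addr_eq0 addrC -RintegralD//.
by rewrite Z.
Qed.

End Slice.

(** * Test functions and integrability on the cylinder *)

Section TestRectangles.
Context {R : realType}.
Local Notation mu := (@lebesgue_measure R).
Implicit Types (F phi : R -> R -> R) (f : R -> R) (A K : set (R * R)).

Lemma integrable2_supp A K F : measurable A -> measurable K -> K `<=` A ->
  (forall t x, A (t, x) -> ~ K (t, x) -> F t x = 0) ->
  integrable2 K F -> integrable2 A F.
Proof.
rewrite /integrable2 => mA mK KA F0 iK; apply: (integrable_mkcond _ _).2 => //.
have : (leb2 R).-integrable setT ((fun p => (F p.1 p.2)%:E) \_ K).
  by apply: (integrable_mkcond _ _).1.
congr (_.-integrable _ _).
apply/funext => -[t x]; rewrite !patchE.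
have [pK|/negP pK] := boolP ((t, x) \in K).
  by rewrite (mem_set (KA _ (set_mem pK))).
case: ifPn => // pA; rewrite F0//; first exact: set_mem pA.
by move=> Ktx; apply: pK; rewrite inE.
Qed.

(** A test function on the open cylinder is only known to vanish at points of that cylinder. Its
    values and derivatives at t = 0 and at the lateral boundary are recovered by continuity. *)
Lemma continuous_zero_right f (p q : R) : p < q -> {for p, continuous f} ->
  (forall y : R, p < y < q -> f y = 0) -> f p = 0.
Proof.
move=> pq cf f0; have L : f y @[y --> p^'+] --> f p by exact: cvg_at_right_filter.
have L0 : f y @[y --> p^'+] --> (0 : R); last exact: (cvg_unique _ L L0).
by apply: cvg_near_cst; near=> y; rewrite f0//; apply/andP; split; near: y;
  [exact: nbhs_right_gt|exact: nbhs_right_lt].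
Unshelve. all: by end_near. Qed.

Lemma continuous_zero_left f (p q : R) : q < p -> {for p, continuous f} ->
  (forall y : R, q < y < p -> f y = 0) -> f p = 0.
Proof.
move=> pq cf f0; have L : f y @[y --> p^'-] --> f p by exact: cvg_at_left_filter.
have L0 : f y @[y --> p^'-] --> (0 : R); last exact: (cvg_unique _ L L0).
by apply: cvg_near_cst; near=> y; rewrite f0//; apply/andP; split; near: y;
  [exact: nbhs_left_gt|exact: nbhs_left_lt].
Unshelve. all: by end_near. Qed.

Lemma derive1_local_zero f (p q x : R) : p < x < q ->
  (forall y : R, p < y < q -> f y = 0) -> derive1 f x = 0.
Proof.
move=> /andP[px xq] f0; rewrite derive1E.
rewrite (@near_eq_derive _ _ _ f (cst 0) x 1) ?derive_cst ?oner_eq0//.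
near=> y; rewrite f0//; apply/andP; split; near: y;
  [exact: lt_nbhsr|exact: lt_nbhsl].
Unshelve. all: by end_near. Qed.

Lemma smooth2_continuous phi (s : seq bool) : smooth2 phi ->
  continuous (fun p : R * R =>
    foldr (fun (b : bool) h => if b then Dt h else Dx h) phi s p.1 p.2).
Proof. by move=> /(_ s)[]. Qed.

Lemma smooth2_is_derive_x phi (s : seq bool) (t x : R) : smooth2 phi ->
  let g := foldr (fun (b : bool) h => if b then Dt h else Dx h) phi s in
  is_derive x 1 (g t) (Dx g t x).
Proof.
move=> /(_ s)[_ /(_ t x)[_ d]] g; rewrite /Dx derive1E.
exact: derivableP.
Qed.

Lemma smooth2_continuous_x phi (s : seq bool) (t x : R) : smooth2 phi ->
  let g := foldr (fun (b : bool) h => if b then Dt h else Dx h) phi s in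
  {for x, continuous (g t)}.
Proof.
move=> /(_ s)[_ /(_ t x)[_ d]] g.
by apply: differentiable_continuous; exact/derivable1_diffP.
Qed.

Lemma smooth2_continuous_t phi (s : seq bool) (t x : R) : smooth2 phi ->
  let g := foldr (fun (b : bool) h => if b then Dt h else Dx h) phi s in
  {for t, continuous (fun r => g r x)}.
Proof.
move=> /(_ s)[_ /(_ t x)[d _]] g.
by apply: differentiable_continuous; exact/derivable1_diffP.
Qed.

Lemma test2_rect (T : R) phi : 0 < T -> test2 (cyl T) phi -> exists a b c d,
  [/\ 0 < a, a <= b, b < T & [/\ 0 < c, c <= d, d < 1 &
   forall t x : R, 0 < t < T -> 0 < x < 1 -> ~~ ((a <= t <= b) && (c <= x <= d)) ->
     phi t x = 0]].
Proof.
move=> T0 [_ [K [cK KT K0]]].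
have cfst : continuous (@fst R R) by move=> p; exact: cvg_fst.
have csnd : continuous (@snd R R) by move=> p; exact: cvg_snd.
have [|a [b [a0 ab bT Kab]]] := @compact_sub_itv R _ K fst 0 T cfst cK T0.
  by move=> z /KT[]; rewrite /= in_itv.
have [|c [d [c0 cd d1 Kcd]]] := @compact_sub_itv R _ K snd 0 1 csnd cK ltr01.
  by move=> z /KT[_]; rewrite OmegaP.
exists a, b, c, d; split => //; split => // t x t0 x0 /negP H.
apply: (K0 (t, x)); first by split => /=; rewrite ?OmegaP// in_itv.
by move=> Ktx; apply: H; have /= -> := Kab _ Ktx; exact: (Kcd _ Ktx).
Qed.

(** Interior test functions are admissible in the weak formulation: the Neumann condition holds and
    the initial term vanishes. *)
Lemma test2_cyl0 (T : R) phi : 0 < T -> test2 (cyl T) phi ->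
  [/\ test2 (cyl0 T) phi,
      (forall t : R, 0 < t < T -> Dx phi t 0 = 0 /\ Dx phi t 1 = 0) &
      (forall x, Omega x -> phi 0 x = 0)].
Proof.
move=> T0 tphi; have [a [b [c [d [a0 ab bT [c0 cd d1 H]]]]]] := test2_rect T0 tphi.
have sphi := tphi.1.
have H1 (t : R) : 0 < t < T -> forall x : R, 0 <= x <= 1 -> ~~ ((a <= t <= b) && (c <= x <= d)) ->
    phi t x = 0.
  move=> tT x /andP[]; rewrite le_eqVlt => /predU1P[<- _ _|x0].
    apply: (@continuous_zero_right (phi t) 0 c) => //.
      by have := @smooth2_continuous_x phi [::] t 0 sphi.
    move=> y /andP[y0 yc]; apply: H => //; first by rewrite y0/=; lra.
    by apply/negP => /andP[_ /andP[h1 h2]]; lra.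
  rewrite le_eqVlt => /predU1P[-> _|x1 h]; last by apply: H => //; rewrite x0.
  apply: (@continuous_zero_left (phi t) 1 d) => //.
    by have := @smooth2_continuous_x phi [::] t 1 sphi.
  move=> y /andP[yd y1]; apply: H => //; first by rewrite y1 andbT; lra.
  by apply/negP => /andP[_ /andP[h1 h2]]; lra.
have H0 (x : R) : 0 <= x <= 1 -> phi 0 x = 0.
  move=> x01; apply: (@continuous_zero_right (fun r => phi r x) 0 a) => //.
    by have := @smooth2_continuous_t phi [::] 0 x sphi.
  move=> t /andP[t0 ta]; apply: H1 => //; first by rewrite t0/=; lra.
  by apply/negP => /andP[/andP[h1 h2] _]; lra.
split; last by move=> x; rewrite OmegaP => /andP[x0 x1]; apply: H0; rewrite !ltW.
- split=> //; exists (`[a, b]%classic `*` `[c, d]%classic); split.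
  + by apply: compact_setX; exact: segment_compact.
  + move=> [t x] [] /=; rewrite !in_itv/= => /andP[at_ tb] /andP[cx xd].
    by split; rewrite /Omegabar /= in_itv/=; apply/andP; split; lra.
  + move=> [t x] [] /=; rewrite !in_itv/= => /andP[]; rewrite le_eqVlt => /predU1P[<- _ x01 _|].
      exact: H0.
    by move=> t0 tT x01 h; apply: H1; rewrite ?t0//; apply/negP => /andP[]; move=> h1 h2; apply: h.
- move=> t tT; split.
  + apply: (@continuous_zero_right (Dx phi t) 0 c) => //.
      by have := @smooth2_continuous_x phi [:: false] t 0 sphi.
    move=> y y0c; apply: (derive1_local_zero y0c) => z /andP[z0 zc].
    apply: H => //; first by rewrite z0/=; lra.
    by apply/negP => /andP[_ /andP[h1 h2]]; lra.
  + apply: (@continuous_zero_left (Dx phi t) 1 d) => //.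
      by have := @smooth2_continuous_x phi [:: false] t 1 sphi.
    move=> y y0c; apply: (derive1_local_zero y0c) => z /andP[z0 zc].
    apply: H => //; first by rewrite zc andbT; lra.
    by apply/negP => /andP[_ /andP[h1 h2]]; lra.
Qed.

Lemma test2_tensor (T : R) (f g : R -> R) b : smooth1 f -> smooth1 g -> b < T ->
  (forall t, b < t -> f t = 0) -> test2 (cyl0 T) (fun t x => f t * g x).
Proof.
move=> sf sg bT f0; split; first exact: smooth2_tensor.
exists (`[0, b]%classic `*` `[0, 1]%classic); split.
- by apply: compact_setX; exact: segment_compact.
- move=> [t x] [] /=; rewrite !in_itv/= => /andP[at_ tb] x01.
  by split => //=; rewrite in_itv/= at_/=; lra.
- move=> [t x] [] /=; rewrite !in_itv/= => /andP[t0 tT] x01 h.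
  rewrite f0 ?mul0r// ltNge; apply/negP => tb; apply: h; split => //=.
  by rewrite t0.
Qed.

Lemma compact_bound (K : set (R * R)) (f : R * R -> R) : continuous f -> compact K ->
  exists M, forall p, K p -> `|f p| <= M.
Proof.
move=> cf cK; have [->|/set0P K0] := eqVneq K set0; first by exists 0.
have cN : {within K, continuous (fun p => `|f p|)}.
  by apply: continuous_subspaceT => p; apply: cvg_norm; exact: cf.
have [c _ Hc] := compact_EVT_max K0 cK cN.
by exists `|f c| => p /mem_set; exact: Hc.
Qed.

End TestRectangles.

(** * Integrability extracted from the weak formulation *)

Section WeakIntegrability.
Context {R : realType}.
Local Notation mu := (@lebesgue_measure R).
Implicit Types (F u v ux Iu : R -> R -> R).

Lemma integrable2_tonelli (A B : set R) F (h : R -> R) : measurable A -> measurable B ->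
  measurable2 (A `*` B) F ->
  (forall t x, A t -> B x -> 0 <= F t x) ->
  {ae mu, forall t, A t -> ((\int[mu]_(x in B) (F t x)%:E) <= (h t)%:E)%E} ->
  mu.-integrable A (EFin \o h) -> integrable2 (A `*` B) F.
Proof.
move=> mA mB mF F0 Fh ih; pose Fp := (fun p => F p.1 p.2) \_ (A `*` B).
have mAB : measurable (A `*` B) by exact: measurableX.
have Fp0 p : 0 <= Fp p.
  rewrite /Fp patchE; case: ifPn => //; rewrite in_setX => /andP[/set_mem h1 /set_mem h2].
  exact: F0.
have mFp : measurable_fun setT (EFin \o Fp).
  by apply/measurable_EFinP; exact: (measurable_restrictT _ mAB).1.
apply: (integrable_mkcond _ _).2 => //.
have -> : (fun p => (F p.1 p.2)%:E) \_ (A `*` B) = EFin \o Fp by rewrite -restrict_EFin.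
apply/integrableP; split => //.
have -> : (\int[leb2 R]_p `|(EFin \o Fp) p| = \int[leb2 R]_p (EFin \o Fp) p)%E.
  by apply: eq_integral => p _; rewrite gee0_abs// lee_fin.
rewrite (@fubini_tonelli1 _ _ _ _ _ mu mu) => [|//|p]; last by rewrite lee_fin.
have mff : measurable_fun setT (fubini_F mu (EFin \o Fp)).
  by apply: measurable_fun_fubini_tonelli_F => // p; rewrite lee_fin.
rewrite [X in (X < _)%E](_ : _ = \int[mu]_(t in A) \int[mu]_(x in B) (F t x)%:E)%E; last first.
  by rewrite [RHS]integral_mkcond -fubini_F_patch.
rewrite /Fp fubini_F_patch in mff.
have /integrableP[mh hfin] := ih.
apply: le_lt_trans hfin; apply: ae_ge0_le_integral => //.
- by move=> t At; apply: integral_ge0 => x Bx; rewrite lee_fin F0.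
- exact: (measurable_restrictT _ mA).2.
- exact: measurableT_comp.
- apply: ae_mono Fh => t H At; apply: le_trans (H At) _.
  by rewrite /= lee_fin ler_norm.
Qed.

Lemma integrable2S A B F : measurable A -> measurable B -> B `<=` A ->
  integrable2 A F -> integrable2 B F.
Proof. by rewrite /integrable2 => mA mB BA; apply: integrableS. Qed.

Lemma measurable_itvOmega (c d : R) : measurable (`[c, d] `*` (Omega : set R)).
Proof. by apply: measurableX; [exact: measurable_itv|exact: measurable_Omega]. Qed.

Lemma sub_itvOmega_cyl (c d T : R) : 0 < c -> d < T -> `[c, d] `*` Omega `<=` cyl T.
Proof.
move=> c0 dT [t x] [] /=; rewrite in_itv/= => /andP[ct td] Ox; split => //=.
by rewrite in_itv/=; apply/andP; split; lra.
Qed.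

Lemma measurable2_powR A F (p : R) : measurable2 A F ->
  measurable2 A (fun t x => F t x `^ p).
Proof.
move=> mF; exact: (@measurableT_comp _ _ _ _ _ _ (fun x : R => x `^ p)).
Qed.

Lemma measurable2S A B F : measurable A -> B `<=` A -> measurable2 A F -> measurable2 B F.
Proof. by move=> mA BA; exact: measurable_funS. Qed.

(** A smooth decreasing function that vanishes from [S] on and does not vanish before. On ]0, d]
    with d < S both it and its derivative are bounded away from 0, so integrability of a product
    with either passes to the other factor. *)
Definition time_cutoff (S t : R) : R := flat_exp (-1 * t + S).

Lemma smooth1_time_cutoff S : smooth1 (time_cutoff S).
Proof. exact: (@smooth1_aff R (@flat_exp R) (-1) S (@smooth1_flat_exp R)). Qed.

Lemma time_cutoff_out (S t : R) : S < t -> time_cutoff S t = 0.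
Proof. by move=> St; apply: flat_exp_le0; lra. Qed.

Lemma time_cutoff_low (S t d : R) : t <= d -> flat_exp (S - d) <= time_cutoff S t.
Proof. by move=> td; apply: flat_exp_mono; lra. Qed.

Lemma time_cutoff_deriv (S t d : R) : 0 < t -> t <= d -> d < S ->
  S ^- 2 * flat_exp (S - d) <= `|derive1 (time_cutoff S) t|.
Proof.
move=> t0 td dS.
have [_ ->] := @derive1_aff R (@flat_exp R) (-1) S t (@smooth1_derivable R _ (-1 * t + S) (@smooth1_flat_exp R)).
rewrite normrM normrN normr1 mul1r flat_exp_derive; last by lra.
rewrite normrM ger0_norm ?invr_ge0 ?exprn_ge0//; [|lra].
rewrite (ger0_norm (flat_exp_ge0 _)) ler_pM ?invr_ge0 ?exprn_ge0 ?flat_exp_ge0//; try lra.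
- rewrite lef_pV2 ?posrE ?exprn_gt0//; try lra.
  by rewrite lerXn2r ?nnegrE; lra.
- exact: time_cutoff_low.
Qed.

Lemma test2_time_cutoff (S T : R) g : S < T -> smooth1 g ->
  test2 (cyl0 T) (fun t x => time_cutoff S t * g x).
Proof.
move=> ST sg; apply: (@test2_tensor R T _ g S) => //; first exact: smooth1_time_cutoff.
by move=> t; exact: time_cutoff_out.
Qed.

(** The weak formulation asserts integrability of u phi_t for each admissible phi. A cut-off
    independent of [x] makes |phi_t| bounded below on the slab. *)
Lemma weak_formulation_integrable_u (T n : R) (u0 : R -> R) u ux Iu (c d : R) :
  measurable2 (cyl T) u -> weak_formulation T n u0 u ux Iu ->
  0 < c -> c <= d -> d < T -> integrable2 (`[c, d] `*` Omega) u.
Proof.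
move=> mu_ wf c0 cd dT; pose S := (d + T) / 2.
have dS : d < S by rewrite /S; lra.
have ST : S < T by rewrite /S; lra.
have [|t _|iA _ _ _] := wf (fun t x => time_cutoff S t * 1).
- exact: (test2_time_cutoff ST (@smooth1_cst R 1)).
- by rewrite !Dx_tensor ?derive1_cst ?mulr0//; exact: smooth1_cst.
have sub := sub_itvOmega_cyl c0 dT.
have mS := measurable_itvOmega c d.
pose k := S ^- 2 * flat_exp (S - d).
have k0 : 0 < k.
  by rewrite mulr_gt0 ?invr_gt0 ?exprn_gt0 ?flat_exp_gt0//; lra.
pose A t x := u t x * Dt (fun t x => time_cutoff S t * 1) t x.
have iA' : (leb2 R).-integrable (`[c, d] `*` Omega) (EFin \o (fun p => k^-1 * `|A p.1 p.2|)).
  apply: integrableRZl => //.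
  have := integrable2S (@measurable_cyl R T) mS sub iA.
  by move=> /integrable_norm.
apply: (le_integrableR _ _ _ iA') => //; first exact: measurable2S (@measurable_cyl R T) sub mu_.
move=> [t x] [] /=; rewrite in_itv/= => /andP[ct td] Ox.
rewrite /A Dt_tensor; last exact: smooth1_time_cutoff.
rewrite mulr1 normrM ler_pdivlMl// mulrC ler_wpM2l//.
by apply: time_cutoff_deriv => //; exact: lt_le_trans ct.
Qed.

Lemma smooth1_cosM (a : R) : smooth1 (fun x => cos (a * x)).
Proof.
have := @smooth1_aff R (@cos R) a 0 (@smooth1_cos R).
by congr smooth1; apply/funext => x; rewrite addr0.
Qed.

Lemma derive1_cosMx (a : R) : derive1 (fun y => cos (a * y)) = (fun x : R => - (a * sin (a * x))).
Proof.
apply/funext => x; rewrite derive1E derive_val.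
by rewrite /GRing.scale/=; ring.
Qed.

Lemma derive1_sinMx (a : R) : derive1 (fun y => - (a * sin (a * y))) = (fun x : R => - (a ^+ 2 * cos (a * x))).
Proof.
apply/funext => x; rewrite derive1E derive_val.
by rewrite /GRing.scale/=; ring.
Qed.

(** If |cos y| < 1/2 then cos 2y = 2 cos^2 y - 1 <= -1/2. *)
Lemma cos_pi_2pi (x : R) : 1 / 2 <= `|cos (pi * x)| + `|cos (2 * pi * x)|.
Proof.
rewrite -mulrA [2 * _]mulr_natl cos_mulr2n; set c := cos _.
have [h|h] := leP (1 / 2) `|c|; first by rewrite ler_wpDr.
have c2 : c ^+ 2 <= 1 / 4.
  by rewrite -(real_normK (num_real c)); move: `|c| (normr_ge0 c) h => a; nra.
have h2 : 1 / 2 <= `|c ^+ 2 *+ 2 - 1|.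
  by rewrite -normrN; apply: le_trans (ler_norm _); lra.
by apply: le_trans h2 _; rewrite lerDr.
Qed.

(* The test functions have spatial factors cos (pi x) and cos (2 pi x), whose
   second derivatives do not vanish simultaneously. *)
Lemma weak_formulation_integrable_flux (T n : R) (u0 : R -> R) u ux Iu (c d : R) :
  measurable2 (cyl T) u -> measurable2 (cyl T) Iu ->
  weak_formulation T n u0 u ux Iu ->
  0 < c -> c <= d -> d < T ->
  integrable2 (`[c, d] `*` Omega) (fun t x => u t x `^ n * Iu t x).
Proof.
move=> mu_ mI wf c0 cd dT; pose S := (d + T) / 2.
have dS : d < S by rewrite /S; lra.
have ST : S < T by rewrite /S; lra.
have sub := sub_itvOmega_cyl c0 dT.
have mS := measurable_itvOmega c d.
pose F t x := u t x `^ n * Iu t x.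
pose C (k : nat) t x := F t x * (time_cutoff S t * - ((k%:R * pi) ^+ 2 * cos (k%:R * pi * x))).
have iC (k : nat) : integrable2 (`[c, d] `*` Omega) (C k).
  pose g : R -> R := fun x => cos (k%:R * pi * x).
  have sg : smooth1 g by exact: smooth1_cosM.
  have D1 : Dx (fun t x => time_cutoff S t * g x) = (fun t x => time_cutoff S t * derive1 g x).
    by apply/funext => t; apply/funext => x; rewrite Dx_tensor.
  have [|t _|_ _ iC _] := wf (fun t x => time_cutoff S t * g x).
  - exact: (test2_time_cutoff ST sg).
  - rewrite !D1 /g derive1_cosMx !mulr0 sin0 mulr1 sin_natpi !mulr0 oppr0 mulr0.
    by split.
  have := integrable2S (@measurable_cyl R T) mS sub iC.
  congr (_.-integrable _ _); apply/funext => -[t x] /=.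
  rewrite D1 Dx_tensor; last exact: smooth1_derive1.
  by rewrite /C /F /g derive1_cosMx derive1_sinMx.
pose k := flat_exp (S - d) * pi ^+ 2 / 2.
have k0 : 0 < k.
  by rewrite divr_gt0// mulr_gt0 ?exprn_gt0 ?pi_gt0// flat_exp_gt0//; lra.
have iG : (leb2 R).-integrable (`[c, d] `*` Omega)
    (EFin \o (fun p => k^-1 * (`|C 1%N p.1 p.2| + `|C 2%N p.1 p.2|))).
  apply: integrableRZl => //; apply: integrableRD => //.
    by have /integrable_norm := iC 1%N.
  by have /integrable_norm := iC 2%N.
apply: (le_integrableR _ _ _ iG) => //.
  apply: measurable_funM; first exact: measurable2S (@measurable_cyl R T) sub (measurable2_powR n mu_).
  exact: measurable2S (@measurable_cyl R T) sub mI.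
move=> [t x] [] /=; rewrite in_itv/= => /andP[ct td] Ox.
rewrite -/(F t x) ler_pdivlMl// /C mul1r.
have z0 := time_cutoff_low S td; have e0 := flat_exp_ge0 (S - d).
have ztc : 0 <= time_cutoff S t by exact: flat_exp_ge0.
have N (a w : R) : `|F t x * (time_cutoff S t * - (a ^+ 2 * w))| =
    `|F t x| * (time_cutoff S t * (a ^+ 2 * `|w|)).
  by rewrite normrM (normrM (time_cutoff S t)) normrN (normrM (a ^+ 2)) (ger0_norm ztc) (ger0_norm (sqr_ge0 a)).
rewrite !N.
have := cos_pi_2pi x; set c1 := `|cos (pi * x)|; set c2 := `|cos (2 * pi * x)|.
have c20 : 0 <= c2 by exact: normr_ge0.
move=> h; have p0 : 0 <= (pi : R) ^+ 2 by rewrite exprn_ge0// pi_ge0.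
have -> : `|F t x| * (time_cutoff S t * (pi ^+ 2 * c1)) + `|F t x| * (time_cutoff S t * ((2 * pi) ^+ 2 * c2)) =
   `|F t x| * (time_cutoff S t * pi ^+ 2 * (c1 + 4 * c2)) by ring.
rewrite mulrC ler_wpM2l// /k ler_pM//; first by rewrite mulr_ge0.
  by rewrite ler_wpM2r.
lra.
Qed.

End WeakIntegrability.

(** * Slicing the dissipation identity *)

Section DissipationSlices.
Context {R : realType}.
Local Notation mu := (@lebesgue_measure R).
Implicit Types (F u v ux Iu g : R -> R -> R).

Lemma measurable2_slice (A B : set R) F t : measurable A -> measurable B -> A t ->
  measurable2 (A `*` B) F -> measurable_fun B (F t).
Proof.
move=> mA mB At mF; have mAB : measurable (A `*` B) by exact: measurableX.
apply: (measurable_restrictT _ mB).2.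
have mP : measurable_fun setT ((fun p => F p.1 p.2) \_ (A `*` B)).
  exact: (measurable_restrictT _ mAB).1.
have -> : F t \_ B = (fun x => ((fun p => F p.1 p.2) \_ (A `*` B)) (t, x)).
  by apply/funext => x; rewrite patch_slice mem_set.
by apply: (measurableT_comp mP); exact: measurable_pair1.
Qed.

Lemma itv_sub_seq (a b : R) : 0 < a -> b < 1 -> exists k : nat,
  k.+2%:R^-1 <= a /\ b <= 1 - k.+2%:R^-1.
Proof.
move=> a0 b1; pose e := Num.min a (1 - b).
have e0 : 0 < e by rewrite lt_min a0 subr_gt0.
exists (Num.truncn e^-1).
have ke : (Num.truncn e^-1).+2%:R^-1 < e.
  rewrite invf_plt ?posrE//; apply: lt_trans (truncnS_gt _) _.
  by rewrite ltr_nat.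
have ex : e <= a by rewrite ge_min lexx.
have e1x : e <= 1 - b by rewrite ge_min lexx orbT.
move: (_.+2%:R^-1 : R) ke => r ke; split; lra.
Qed.

Lemma rectangle_compact (a b c d : R) : compact (`[a, b]%classic `*` `[c, d]%classic).
Proof. by apply: compact_setX; exact: segment_compact. Qed.

Lemma measurable_rectangle (a b c d : R) : measurable (`[a, b]%classic `*` `[c, d]%classic).
Proof. by apply: measurableX; exact: measurable_itv. Qed.

Lemma rectangle_sub_cyl (a b c d T : R) : 0 < a -> b < T -> 0 < c -> d < 1 ->
  `[a, b]%classic `*` `[c, d]%classic `<=` cyl T.
Proof.
move=> a0 bT c0 d1 [t x] [] /=; rewrite !in_itv/= => /andP[h1 h2] /andP[h3 h4].
by split; rewrite /= ?OmegaP ?in_itv/=; apply/andP; split; lra.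
Qed.

Lemma ae_time_forall_nat (T : R) (P : nat -> R -> Prop) : (forall k, ae_time T (P k)) ->
  ae_time T (fun t => forall k, P k t).
Proof. by move=> /ae_forall_nat; apply: ae_mono => t H t0 k; exact: H. Qed.

Lemma ae_time_and (T : R) (P Q : R -> Prop) : ae_time T P -> ae_time T Q ->
  ae_time T (fun t => P t /\ Q t).
Proof. by move=> hP hQ; apply: ae_mono (ae_and hP hQ) => t [h1 h2] t0; split; auto. Qed.

Lemma ae_time_mono (T : R) (P Q : R -> Prop) : (forall t : R, 0 < t < T -> P t -> Q t) ->
  ae_time T P -> ae_time T Q.
Proof. by move=> PQ; apply: ae_mono => t H t0; exact: PQ (H t0). Qed.

(** A countable exhaustion of ]0, 1[ makes the null set of times independent of [a] and [b]. *)
Lemma ae_slice_locally_integrable (T : R) F : locally_integrable2 (cyl T) F ->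
  ae_time T (fun t => forall a b, 0 < a -> a <= b -> b < 1 ->
    mu.-integrable `[a, b] (EFin \o F t)).
Proof.
move=> [mF lF].
have H : ae_time T (fun t => forall k : nat,
    mu.-integrable `[k.+2%:R^-1, 1 - k.+2%:R^-1] (EFin \o F t)).
  apply: ae_time_forall_nat => k; apply: ae_time_exhaust => c d c0 cd dT.
  have k0 : 0 < k.+2%:R^-1 :> R by rewrite invr_gt0.
  have iF : integrable2 (`[c, d]%classic `*` `[k.+2%:R^-1, 1 - k.+2%:R^-1]%classic) F.
    apply: lF; first exact: rectangle_compact.
    by apply: rectangle_sub_cyl => //; rewrite ltrBlDr ltrDl.
  apply: ae_mono (ae_integrable_slice _ _ iF); try exact: measurable_itv.
  by move=> t H /andP[ct td]; apply: H; rewrite /= in_itv/= !ltW.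
apply: ae_time_mono H => t _ H a b a0 ab b1.
by have [k [ka kb]] := itv_sub_seq a0 b1; exact: integrable_subitv ka kb (H k).
Qed.

Lemma integrable2_mul_supp (c d a b : R) F (h : R -> R) : 0 < a -> b < 1 ->
  continuous h -> (forall x, Omega x -> ~~ (a <= x <= b) -> h x = 0) ->
  integrable2 (`[c, d]%classic `*` `[a, b]%classic) F ->
  integrable2 (`[c, d]%classic `*` Omega) (fun t x => F t x * h x).
Proof.
move=> a0 b1 ch h0 iF; have mR := @measurable_rectangle c d a b.
apply: (@integrable2_supp R _ (`[c, d]%classic `*` `[a, b]%classic)) => //.
- by apply: measurableX; [exact: measurable_itv|exact: measurable_Omega].
- by move=> [t x] [/= h1 h2]; split => //=; exact: subset_itv_Omega a0 b1 _ h2.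
- move=> t x [/= t1 Ox] nx; rewrite h0 ?mulr0//; apply/negP => xab; apply: nx.
  by split => //=; rewrite in_itv.
- have [M HM] := @itv_continuous_bounded R h a b (fun x _ => ch x).
  apply: (@integrableRM_bounded _ _ _ (leb2 R) _ _ (fun p => h p.2) M) => //.
  + by apply: measurable_fun_snd; exact: continuous_measurable_fun.
  + by move=> [t x] [/= _]; rewrite in_itv/=; exact: HM.
Qed.

Lemma integrable2_mul_time (T c d : R) j F : 0 < c -> d < T ->
  integrable2 (`[c, d]%classic `*` Omega) F ->
  integrable2 (cyl T) (fun t x => F t x * flat_bump c d j t).
Proof.
move=> c0 dT iF; have mS := @measurable_itvOmega R c d.
apply: (@integrable2_supp R _ (`[c, d]%classic `*` Omega)) => //.
- exact: measurable_cyl.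
- exact: sub_itvOmega_cyl.
- move=> t x [/= t1 Ox] nx; rewrite flat_bump_out ?mulr0//; apply/negP => /andP[h1 h2].
  by apply: nx; split => //=; rewrite in_itv/= !ltW.
- apply: (@integrableRM_bounded _ _ _ (leb2 R) _ _ (fun p => flat_bump c d j p.1) 1) => //.
  + by apply: measurable_fun_fst; exact: flat_bump_measurable.
  + by move=> p _; rewrite ger0_norm ?flat_bump_ge0 ?flat_bump_le1.
Qed.

Lemma Rint2D (A : set (R * R)) F G : measurable A -> integrable2 A F -> integrable2 A G ->
  Rint2 A (fun t x => F t x + G t x) = Rint2 A F + Rint2 A G.
Proof. by move=> mA iF iG; rewrite /Rint2 RintegralD. Qed.

Lemma sqr_integrable2 (A : set (R * R)) g : measurable A -> measurable2 A g ->
  (\int[leb2 R]_(p in A) (g p.1 p.2 ^+ 2)%:E < +oo)%E ->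
  integrable2 A (fun t x => g t x ^+ 2).
Proof.
move=> mA mg fg; apply/integrableP; split.
  by apply/measurable_EFinP; exact: measurable_funX.
by under eq_integral do rewrite gee0_abs ?lee_fin ?sqr_ge0//.
Qed.

Lemma ae_slice_L2 (T : R) g : measurable2 (cyl T) g ->
  (\int[leb2 R]_(p in cyl T) (g p.1 p.2 ^+ 2)%:E < +oo)%E ->
  ae_time T (fun t => inLpO 2%:E (g t)).
Proof.
move=> mg fg; have iG := sqr_integrable2 (measurable_cyl T) mg fg.
have mO := @measurable_Omega R.
apply: ae_mono (ae_integrable_slice _ mO iG); last exact: measurable_itv.
move=> t H tT; have tT' : `]0, T[%classic t by rewrite /= in_itv.
split.
  by apply: measurable2_slice mg => //; exact: measurable_itv.
have /integrableP[_ Hf] := H tT'.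
have : (LpO 2%:E (g t) `^ 2 < +oo)%E.
  rewrite LpO2_sqr; apply: le_lt_trans Hf; rewrite le_eqVlt; apply/orP; left; apply/eqP.
  by apply: eq_integral => x _; rewrite gee0_abs// lee_fin sqr_ge0.
by rewrite !ltey; apply: contra => /eqP ->; rewrite poweRyr ?pnatr_eq0.
Qed.

Lemma locally_integrable_of_sqr (T : R) g : measurable2 (cyl T) g ->
  (\int[leb2 R]_(p in cyl T) (g p.1 p.2 ^+ 2)%:E < +oo)%E ->
  forall c d a b, 0 < c -> d < T -> 0 < a -> b < 1 ->
  integrable2 (`[c, d]%classic `*` `[a, b]%classic) g.
Proof.
move=> mg fg c d a b c0 dT a0 b1; have mR := @measurable_rectangle c d a b.
have sub := rectangle_sub_cyl c0 dT a0 b1.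
have i2 := integrable2S (measurable_cyl T) mR sub (sqr_integrable2 (measurable_cyl T) mg fg).
pose mu_ab := fine (mu `[a, b]%classic).
have i1 : (leb2 R).-integrable (`[c, d]%classic `*` `[a, b]%classic) (EFin \o (fun=> 1)).
  have ih : mu.-integrable `[c, d] (EFin \o (fun=> mu_ab)).
    by apply: continuous_compact_integrable; [exact: segment_compact|exact: continuous_subspaceT (fun _ => cvg_cst _)].
  apply: (@integrable2_tonelli R `[c, d]%classic `[a, b]%classic (fun _ _ => 1) (fun=> mu_ab)) => //.
    exact: measurable_cst.
  apply: aeW => t _; rewrite integral_cst// mul1e /mu_ab fineK// ge0_fin_numE//.
  by rewrite lebesgue_measure_itv/=; case: ifPn => _; rewrite -?EFinB ltry.
apply: (le_integrableR _ _ _ (integrableRD _ i1 i2)) => //.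
  exact: measurable2S (measurable_cyl T) sub mg.
move=> p _; move: (g _ _) => y.
by rewrite -(real_normK (num_real y)); move: `|y| => z; have := sqr_ge0 (z - 1 / 2); nra.
Qed.

(** The planar identity is tested on products of a time bump and a space primitive. For each triple
    (p, q, j) this localizes in time outside a null set, and the triples are countable. *)
Lemma dissipation_slices (T n : R) u ux Iu g : dissipation T n u ux Iu g ->
  let V t x := u t x `^ (n / 2) * Iu t x in
  let W t x := n / 2 * u t x `^ ((n - 2) / 2) * ux t x * Iu t x in
  ae_time T (fun t => forall (p q : rat) j,
    0 < ratr p :> R -> (ratr p : R) < ratr q -> ratr q < 1 :> R ->
    \int[mu]_(x in Omega) (V t x * mean0_bump (ratr p) (ratr q) j x) =
    - \int[mu]_(x in Omega) ((g t x + W t x) * bump_primitive (ratr p) (ratr q) j x)).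
Proof.
move=> [mg fg lV lW id] V W.
suff H (i : rat * rat * nat) : ae_time T (fun t =>
    0 < ratr i.1.1 :> R -> (ratr i.1.1 : R) < ratr i.1.2 -> ratr i.1.2 < 1 :> R ->
    \int[mu]_(x in Omega) (V t x * mean0_bump (ratr i.1.1) (ratr i.1.2) i.2 x) =
    - \int[mu]_(x in Omega) ((g t x + W t x) * bump_primitive (ratr i.1.1) (ratr i.1.2) i.2 x)).
  by apply: ae_mono (ae_forall_count H) => t Ht t0 p q j; exact: (Ht (p, q, j) t0).
move: i => [[p q] j] /=; have [p0|p0] := pselect (0 < ratr p :> R); last first.
  by apply: aeW => t _ /p0.
have [q1|q1] := pselect (ratr q < 1 :> R); last by apply: aeW => t _ _ _ /q1.
pose a : R := Num.min (ratr p) (1/4); pose b : R := Num.max (ratr q) (3/4).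
have a0 : 0 < a by rewrite lt_min p0/=; lra.
have b1 : b < 1 by rewrite gt_max q1/=; lra.
pose psi := bump_primitive (ratr p : R) (ratr q) j.
pose dpsi := mean0_bump (ratr p : R) (ratr q) j.
have spsi : smooth1 psi by exact: smooth1_bump_primitive.
have dE : derive1 psi = dpsi.
  apply/funext => x; rewrite derive1E.
  by have [_ ->] := bump_primitive_derive (ratr p : R) (ratr q) j x.
have cpsi := smooth1_continuous spsi.
have cdpsi : continuous dpsi by apply: smooth1_continuous; exact: smooth1_mean0_bump.
have psi0 x : Omega x -> ~~ (a <= x <= b) -> psi x = 0.
  move=> _ h; apply: bump_primitive_out; apply: contra h => /andP[h1 h2].
  by rewrite !ltW.
have dpsi0 x : Omega x -> ~~ (a <= x <= b) -> dpsi x = 0.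
  move=> _ h; apply: mean0_bump_out; apply: contra h => /andP[h1 h2].
  by rewrite !ltW.
have lR F c d : locally_integrable2 (cyl T) F -> 0 < c -> d < T ->
    integrable2 (`[c, d]%classic `*` `[a, b]%classic) F.
  move=> [_ lF] c0 dT; apply: lF; first exact: rectangle_compact.
  exact: rectangle_sub_cyl.
have iG c d : 0 < c -> d < T -> integrable2 (`[c, d]%classic `*` Omega) (fun t x => g t x * psi x).
  move=> c0 dT; apply: (integrable2_mul_supp a0 b1) => //.
  exact: locally_integrable_of_sqr fg _ _ _ _ c0 dT a0 b1.
have iV c d : 0 < c -> d < T -> integrable2 (`[c, d]%classic `*` Omega) (fun t x => V t x * dpsi x).
  by move=> c0 dT; apply: (integrable2_mul_supp a0 b1) => //; exact: lR.
have iW c d : 0 < c -> d < T -> integrable2 (`[c, d]%classic `*` Omega) (fun t x => W t x * psi x).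
  by move=> c0 dT; apply: (integrable2_mul_supp a0 b1) => //; exact: lR.
have mO := @measurable_Omega R.
have sl F : (forall c d, 0 < c -> d < T -> integrable2 (`[c, d]%classic `*` Omega) F) ->
    ae_time T (fun t => mu.-integrable Omega (EFin \o F t)).
  move=> H; apply: ae_time_exhaust => c d c0 cd dT.
  apply: ae_mono (ae_integrable_slice _ mO (H c d c0 dT)); last exact: measurable_itv.
  by move=> t Ht /andP[ct td]; apply: Ht; rewrite /= in_itv/= !ltW.
pose E t x := g t x * psi x + V t x * dpsi x + W t x * psi x.
have E0 : ae_time T (fun t => \int[mu]_(x in Omega) E t x = 0).
  apply: slice_integral_eq0 => [c d c0 cd dT|c d k c0 cd dT].
    have mS := @measurable_itvOmega R c d.
    by apply: integrableRD => //; [apply: integrableRD => //; [exact: iG|exact: iV]|exact: iW].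
  pose phi t x := flat_bump c d k t * psi x.
  have tphi : test2 (cyl T) phi.
    split; first by apply: smooth2_tensor => //; exact: smooth1_flat_bump.
    exists (`[c, d]%classic `*` `[a, b]%classic); split.
    - exact: rectangle_compact.
    - exact: rectangle_sub_cyl.
    - move=> [t x] [/= _ Ox] h; rewrite /phi.
      have [tc|tc] := boolP (c <= t <= d); last first.
        rewrite flat_bump_out ?mul0r//; apply: contra tc => /andP[h1 h2].
        by rewrite !ltW.
      rewrite psi0 ?mulr0//; apply/negP => xab; apply: h.
      by split; rewrite /= in_itv.
  have DX t x : Dx phi t x = flat_bump c d k t * dpsi x by rewrite /phi Dx_tensor// dE.
  have := id _ tphi.
  have -> : Rint2 (cyl T) (fun t x => g t x * phi t x) =
      Rint2 (cyl T) (fun t x => (g t x * psi x) * flat_bump c d k t).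
    by apply: eq_Rintegral => -[t x] _; rewrite /phi/=; ring.
  have -> : Rint2 (cyl T) (fun t x => u t x `^ (n / 2) * Iu t x * Dx phi t x) =
      Rint2 (cyl T) (fun t x => (V t x * dpsi x) * flat_bump c d k t).
    by apply: eq_Rintegral => -[t x] _; rewrite DX /V/=; ring.
  have -> : Rint2 (cyl T) (fun t x => n / 2 * u t x `^ ((n - 2) / 2) * ux t x * Iu t x * phi t x) =
      Rint2 (cyl T) (fun t x => (W t x * psi x) * flat_bump c d k t).
    by apply: eq_Rintegral => -[t x] _; rewrite /phi /W/=; ring.
  have mC := measurable_cyl T.
  have jG := integrable2_mul_time k c0 dT (iG c d c0 dT).
  have jV := integrable2_mul_time k c0 dT (iV c d c0 dT).
  have jW := integrable2_mul_time k c0 dT (iW c d c0 dT).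
  have -> : Rint2 (cyl T) (fun t x => E t x * flat_bump c d k t) =
      Rint2 (cyl T) (fun t x => (g t x * psi x) * flat_bump c d k t +
        (V t x * dpsi x) * flat_bump c d k t + (W t x * psi x) * flat_bump c d k t).
    by apply: eq_Rintegral => -[t x] _; rewrite /E !mulrDl.
  rewrite Rint2D//; last by apply: integrableRD.
  by rewrite Rint2D// => ->; ring.
apply: ae_time_mono (ae_time_and E0 (ae_time_and (sl _ iG) (ae_time_and (sl _ iV) (sl _ iW)))).
move=> t _ [Et [gt [Vt Wt]]] _ _ _.
rewrite /E RintegralD// in Et; last exact: integrableRD.
rewrite RintegralD// in Et.
have -> : \int[mu]_(x in Omega) ((g t x + W t x) * psi x) =
    \int[mu]_(x in Omega) (g t x * psi x) + \int[mu]_(x in Omega) (W t x * psi x).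
  by rewrite -RintegralD//; apply: eq_Rintegral => x _; rewrite mulrDl.
move: Et; rewrite -/psi -/dpsi.
move: (\int[mu]_(x in Omega) (g t x * psi x)) (\int[mu]_(x in Omega) (V t x * dpsi x)).
by move: (\int[mu]_(x in Omega) (W t x * psi x)) => w x y; lra.
Qed.

End DissipationSlices.

(** * Solutions at a generic time *)

Section GoodSlices.
Context {R : realType}.
Local Notation mu := (@lebesgue_measure R).
Implicit Types (u v ux Iu g : R -> R).

Lemma HsN_partial (s : R) u : HsN s u -> exists M, forall N,
  \sum_(k < N) coef u k ^+ 2 * (1 + eigval k `^ s) <= M.
Proof. by move=> [_]; exact: hnorm2_lty_partial. Qed.

Lemma HsN_abs_bounded (s b : R) u : HsN s u -> 0 <= b -> 2 * b + 1 < 2 * s ->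
  exists B, abs_bounded (coef u) b B.
Proof.
move=> /HsN_partial[M HM] b0 bs; have [B HB] := weighted_sum_bounded b0 bs.
by exists (M + B) => N; exact: HB.
Qed.

Lemma HsN_series (s : R) u : HsN s u -> 1 < 2 * s ->
  {ae mu, forall x, Omega x -> u x = cosine_series (coef u) x} /\
  measurable_fun Omega (cosine_series (coef u)).
Proof.
move=> hu s1; have [|B HB] := HsN_abs_bounded hu (lexx 0); first by rewrite mulr0 add0r.
split; last exact: measurable_cosine_series HB.
by apply: expands_cosine_series HB; case: hu.
Qed.

Lemma HsN_holder (s b : R) u : HsN s u -> 0 <= b <= 1 -> 2 * b + 1 < 2 * s ->
  exists C, forall x y : R,
    `|cosine_series (coef u) x - cosine_series (coef u) y| <= C * `|x - y| `^ b.
Proof.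
move=> hu b01 bs; have /andP[b0 b1] := b01.
have [|B0 HB0] := HsN_abs_bounded hu (lexx 0); first by lra.
have [B HB] := HsN_abs_bounded hu b0 bs.
by exists (2 * Num.sqrt 2 * B) => x y; exact: cosine_series_holder HB0 b01 HB.
Qed.

Lemma HsN_continuous (s : R) u : HsN s u -> 1 < 2 * s ->
  continuous (cosine_series (coef u)).
Proof.
move=> hu s1; pose b := Num.min 1 ((2 * s - 1) / 4).
have b0 : 0 < b by rewrite lt_min ltr01/=; lra.
have b1 : b <= 1 by rewrite ge_min lexx.
have bs : b <= (2 * s - 1) / 4 by rewrite ge_min lexx orbT.
have [||C HC] := @HsN_holder s b u hu; [by rewrite ltW|lra|].
move=> x; apply/cvgrPdist_lt => e e0.
pose K := `|C| + 1; have K0 : 0 < K by rewrite ltr_wpDl.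
pose d := (e / K) `^ (b^-1); have d0 : 0 < d by rewrite powR_gt0// divr_gt0.
apply/nbhs_ballP; exists d => //= y; rewrite /ball/= => xy.
have lt1 : `|x - y| `^ b < e / K.
  have -> : e / K = d `^ b by rewrite /d -powRrM mulVf ?gt_eqF// powRr1// divr_ge0// ltW.
  by apply: gt0_ltr_powR => //; rewrite nnegrE ltW.
apply: le_lt_trans (HC x y) _; apply: (@le_lt_trans _ _ (K * `|x - y| `^ b)).
  by rewrite ler_wpM2r ?powR_ge0// /K (le_trans (ler_norm C))// lerDl.
by rewrite -ltr_pdivlMl// mulrC.
Qed.

Lemma ae_eq_coef u v : measurable_fun Omega u -> measurable_fun Omega v ->
  {ae mu, forall x, Omega x -> u x = v x} -> coef u = coef v.
Proof.
move=> mu_ mv uv; apply/funext => k; apply: ae_eq_Rintegral.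
- exact: measurable_Omega.
- by apply: measurable_funM => //; exact: measurable_eigfun.
- by apply: measurable_funM => //; exact: measurable_eigfun.
- by apply: ae_mono uv => x H Ox; rewrite H.
Qed.

Lemma ae_eq_LpO2 u v : measurable_fun Omega u -> measurable_fun Omega v ->
  {ae mu, forall x, Omega x -> u x = v x} -> LpO 2%:E u = LpO 2%:E v.
Proof.
move=> mu_ mv uv.
have E : (LpO 2%:E u `^ 2 = LpO 2%:E v `^ 2)%E.
  rewrite !LpO2_sqr; apply: ae_eq_integral.
  - exact: measurable_Omega.
  - by apply/measurable_EFinP; exact: measurable_funX.
  - by apply/measurable_EFinP; exact: measurable_funX.
  - by apply: ae_mono uv => x H Ox; rewrite H.
have K w : LpO 2%:E w = ((LpO 2%:E w `^ 2) `^ (2^-1))%E.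
  by rewrite -poweRrM ?mulfV ?poweRe1 ?Lnorm_ge0// pnatr_eq0.
by rewrite K E -K.
Qed.

Lemma ae_eq_expands c u v : measurable_fun Omega v ->
  {ae mu, forall x, Omega x -> u x = v x} -> expands c u -> expands c v.
Proof.
move=> mv uv [[mu_ fu] eu].
have LN N : LpO 2%:E (fun x => u x - \sum_(k < N) c k * eigfun k x) =
    LpO 2%:E (fun x => v x - \sum_(k < N) c k * eigfun k x).
  have [ms _] := @partial_sum_inLpO2 R c N.
  apply: ae_eq_LpO2; try exact: measurable_funB.
  by apply: ae_mono uv => x H Ox; rewrite H.
split; first by split => //; rewrite -(ae_eq_LpO2 mu_ mv uv).
by move: eu; under eq_fun do rewrite LN.
Qed.

Lemma HsN_positive (al n : R) u : 0 < al < 2 -> 2 + 2 / (al + 1) < n ->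
  HsN (al / 2 + 1) u -> {ae mu, forall x, Omega x -> 0 <= u x} ->
  (\int[mu]_(x in Omega) G n (u x) < +oo)%E ->
  forall x, Omega x -> 0 < cosine_series (coef u) x.
Proof.
move=> al02 hn hu u0 Gu; have /andP[al0 al2] := al02.
have s1 : 1 < 2 * (al / 2 + 1) by lra.
have [uv mv] := HsN_series hu s1; have cv := HsN_continuous hu s1.
have [M HM] := HsN_partial hu.
have n2 : 2 < n by apply: lt_trans hn; rewrite ltrDl divr_gt0//; lra.
apply: cosine_series_gt0 al02 hn HM _ _.
  move=> x; rewrite OmegaP => x01.
  (* The series agrees almost everywhere with its absolute value, and both are continuous, so they
     agree at every point. *)
  rewrite (_ : cosine_series _ x = `|cosine_series (coef u) x|) ?normr_ge0//.
  apply: (@continuous_ae_eq R _ (fun y => `|cosine_series (coef u) y|)) x01 => //.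
      by move=> y _; exact: cv.
    by move=> y _; apply: cvg_norm; exact: cv.
  by apply: ae_mono (ae_and u0 uv) => y [h1 h2] Oy; rewrite -h2// ger0_norm// h1.
apply: le_lt_trans Gu; rewrite le_eqVlt; apply/orP; left; apply/eqP.
have mu_ : measurable_fun Omega u by case: hu => -[[]].
have mG f : measurable_fun Omega f -> measurable_fun Omega (fun x => G n (f x)).
  by move=> mf; apply: (measurableT_comp (f := G n)) mf; exact: measurable_G.
apply: ae_eq_integral; [exact: measurable_Omega|exact: mG|exact: mG|].
by apply: ae_mono uv => x H Ox; rewrite H.
Qed.

(** What is retained of the solution at one time. The mass [m] and the bound [C0] are parameters
    common to all times, which is what makes later constants uniform. *)
Definition good_slice (al n m C0 : R) u ux Iu g :=
  [/\ HsN (al / 2 + 1) u, (hnorm2 (al / 2) u <= C0%:E)%E,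
    {ae mu, forall x, Omega x -> 0 <= u x},
    weak_deriv u ux & fracI al u Iu] /\
  [/\ \int[mu]_(x in Omega) u x = m, (\int[mu]_(x in Omega) G n (u x) < +oo)%E & inLpO 2%:E g] /\
  let V x := u x `^ (n / 2) * Iu x in
  let W x := n / 2 * u x `^ ((n - 2) / 2) * ux x * Iu x in
  [/\ (forall a b, 0 < a -> a <= b -> b < 1 -> mu.-integrable `[a, b] (EFin \o V)),
   (forall a b, 0 < a -> a <= b -> b < 1 -> mu.-integrable `[a, b] (EFin \o W)) &
   (forall (p q : rat) j, 0 < ratr p :> R -> (ratr p : R) < ratr q -> ratr q < 1 :> R ->
    \int[mu]_(x in Omega) (V x * mean0_bump (ratr p) (ratr q) j x) =
    - \int[mu]_(x in Omega) ((g x + W x) * bump_primitive (ratr p) (ratr q) j x))].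

Lemma good_slice_primitives (al n m C0 : R) u ux Iu g : 0 < al < 2 -> 2 + 2 / (al + 1) < n ->
  good_slice al n m C0 u ux Iu g -> let v := cosine_series (coef u) in
  is_primitive ux v /\
  exists It, is_primitive (fun x => g x * v x `^ (- (n / 2))) It /\
    {ae mu, forall x, Omega x -> Iu x = It x}.
Proof.
move=> al02 hn [[hu _ u0 du fI] [[_ Gu Lg] /= [iV iW id]]]; have /andP[al0 al2] := al02.
have s1 : 1 < 2 * (al / 2 + 1) by lra.
have [uv mv] := HsN_series hu s1; have cv := HsN_continuous hu s1.
have v0 := HsN_positive al02 hn hu u0 Gu.
have pv : is_primitive ux (cosine_series (coef u)).
  by apply: weak_deriv_primitive du _ uv => x _; exact: cv.
split=> //; apply: (pressure_primitive mv _ uv _ pv iV _ id).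
- by case: Lg.
- by move=> x x01; apply: v0; rewrite OmegaP.
- move=> a b a0 ab b1; apply: integrableRD => //; last exact: iW.
  apply: integrableS (inLpO2_integrable Lg) => //; first exact: measurable_Omega.
  exact: subset_itv_Omega.
Qed.

(** On a slice J equals g v^(n/2), the product of an L^2 function and a bounded one. *)
Lemma good_slice_flux (al n m C0 : R) u ux Iu g : 0 < al < 2 -> 2 + 2 / (al + 1) < n ->
  good_slice al n m C0 u ux Iu g -> let v := cosine_series (coef u) in
  [/\ measurable_fun Omega (fun x => g x * v x `^ (- (n / 2))),
   mu.-integrable Omega (EFin \o (fun x => v x `^ n * (g x * v x `^ (- (n / 2))))),
   fracI al v Iu & weak_deriv Iu (fun x => g x * v x `^ (- (n / 2)))].
Proof.
move=> al02 hn gs v; have [pv [It [pI II]]] := good_slice_primitives al02 hn gs.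
have [[hu _ u0 du fI] [[_ Gu Lg] _]] := gs; have /andP[al0 al2] := al02.
have s1 : 1 < 2 * (al / 2 + 1) by lra.
have [uv mv] := HsN_series hu s1; have cv := HsN_continuous hu s1.
have v0 := HsN_positive al02 hn hu u0 Gu.
have n0 : 0 < n by apply: lt_trans hn; rewrite addr_gt0// divr_gt0//; lra.
have mO := @measurable_Omega R.
have mpow p : measurable_fun Omega (fun x => v x `^ p).
  exact: (@measurableT_comp _ _ _ _ _ _ (fun x : R => x `^ p)).
have md : measurable_fun Omega (fun x => g x * v x `^ (- (n / 2))).
  by apply: measurable_funM => //; case: Lg.
split=> //.
- have [|B HB] := HsN_abs_bounded hu (lexx 0); first by lra.
  pose M := B * Num.sqrt 2.
  have vM x : v x <= M.
    by apply: le_trans (ler_norm _) _; exact: cosine_series_bound HB.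
  have i1 : mu.-integrable Omega (EFin \o (fun x => g x * v x `^ (n / 2))).
    apply: (@integrableRM_bounded _ _ _ mu _ _ _ (M `^ (n / 2))) => //; first exact: mpow.
      move=> x Ox; rewrite ger0_norm ?powR_ge0//.
      have vx := v0 x Ox; apply: ge0_ler_powR; rewrite ?nnegrE ?(ltW vx)//; first by rewrite divr_ge0// ltW.
      by apply: le_trans (vM x); exact: ltW.
    exact: inLpO2_integrable.
  apply: eq_integrable i1 => // x /set_mem Ox /=; congr EFin.
  rewrite mulrCA powR_pow; last exact: v0.
  by congr (_ * _ `^ _); field.
- have mu_ : measurable_fun Omega u by case: hu => -[[]].
  by rewrite /fracI -(ae_eq_coef mu_ mv uv).
- apply: (is_primitive_weak_deriv pI _ md II).
    by case: fI => -[].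
  exact: aeW.
Qed.

(** [K] is chosen before the slice. For al <= 1 it comes from the mass; for al > 1 the bound [C0] in
    H^(al/2) already dominates the absolute sum of the coefficients, hence the supremum of v. *)
Lemma good_slice_power (al n m C0 : R) : 0 < al < 2 -> 2 + 2 / (al + 1) < n -> 0 <= m ->
  exists2 K, 0 < K & forall u ux Iu g, good_slice al n m C0 u ux Iu g ->
  (\int[mu]_(x in Omega) (cosine_series (coef u) x `^ n)%:E <=
    (K * (1 + \int[mu]_(x in Omega) `|u x `^ n * Iu x|))%:E)%E.
Proof.
move=> al02 hn m0; have /andP[al0 al2] := al02.
have n0 : 0 < n by apply: lt_trans hn; rewrite addr_gt0// divr_gt0//; lra.
have s1 : 1 < 2 * (al / 2 + 1) by lra.
have mO := @measurable_Omega R.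
have iv v M : measurable_fun Omega v -> (forall x, Omega x -> 0 <= v x <= M) ->
   mu.-integrable Omega (EFin \o (fun x => v x `^ n)).
  move=> mv vM; apply: inLpO2_integrable; apply: (@bounded_inLpO2 _ _ (M `^ n)).
    exact: (@measurableT_comp _ _ _ _ _ _ (fun x : R => x `^ n)).
  move=> x Ox; have /andP[h1 h2] := vM x Ox; rewrite ger0_norm ?powR_ge0//.
  by apply: ge0_ler_powR; rewrite ?nnegrE ?(ltW n0)//; exact: le_trans h2.
have [al1|al1] := leP al 1.
- have [K K0 HK] := power_integral_bound al0 al1 n0 m0.
  exists K => // u ux Iu g gs; set v := cosine_series _.
  have [_ _ fv _] := good_slice_flux al02 hn gs.
  have [[hu _ u0 du fI] [[um Gu Lg] _]] := gs.
  have [uv mv] := HsN_series hu s1; have v0 := HsN_positive al02 hn hu u0 Gu.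
  have [|B HB] := HsN_abs_bounded hu (lexx 0); first by lra.
  have vM x : Omega x -> 0 <= v x <= B * Num.sqrt 2.
    move=> Ox; rewrite ltW ?v0//=; apply: le_trans (ler_norm _) _.
    exact: cosine_series_bound HB.
  rewrite -EFin_Rintegral ?lee_fin//; last exact: iv vM.
  have mu_ : measurable_fun Omega u by case: hu => -[[]].
  have [M HM] := HsN_partial hu.
  have cE := ae_eq_coef mu_ mv uv.
  have -> : \int[mu]_(x in Omega) `|u x `^ n * Iu x| = \int[mu]_(x in Omega) `|v x `^ n * Iu x|.
    have mI : measurable_fun Omega Iu by case: fI => -[].
    have mp w : measurable_fun Omega w -> measurable_fun Omega (fun x => `|w x `^ n * Iu x|).
      move=> mw; apply: measurableT_comp => //; apply: measurable_funM => //.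
      exact: (@measurableT_comp _ _ _ _ _ _ (fun x : R => x `^ n)).
    apply: ae_eq_Rintegral; [exact: mO|exact: mp|exact: mp|].
    by apply: ae_mono uv => x H Ox; rewrite H.
  apply: (HK v Iu (B * Num.sqrt 2) M) => //.
  + rewrite -um; apply: ae_eq_Rintegral => //.
    by apply: ae_mono uv => x H Ox; rewrite H.
  + rewrite -cE; apply: ae_eq_expands mv uv _; by case: hu.
  + by move=> N; rewrite -cE.
- have [|B HB] := @weighted_sum_bounded R (al / 2) 0 (lexx 0); first by lra.
  pose M := `|(C0 + B) * Num.sqrt 2|.
  exists (M `^ n + 1); first by rewrite ltr_wpDl ?powR_ge0.
  move=> u ux Iu g gs; set v := cosine_series _.
  have [[hu hC u0 du fI] [[um Gu Lg] _]] := gs.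
  have [uv mv] := HsN_series hu s1; have v0 := HsN_positive al02 hn hu u0 Gu.
  have HB0 : abs_bounded (coef u) 0 (C0 + B).
    by move=> N; apply: HB => N'; exact: hnorm2_partial.
  have vM x : Omega x -> 0 <= v x <= M.
    move=> Ox; rewrite ltW ?v0//=; apply: le_trans (ler_norm _) _.
    by apply: le_trans (cosine_series_bound x HB0) (ler_norm _).
  have i1 := iv v M mv vM.
  rewrite -EFin_Rintegral ?lee_fin//.
  have ic : mu.-integrable Omega (EFin \o (fun=> M `^ n)).
    by apply: inLpO2_integrable; apply: (@bounded_inLpO2 _ _ `|M `^ n|).
  apply: (@le_trans _ _ (\int[mu]_(x in Omega) M `^ n)).
    apply: le_Rintegral => // x Ox; have /andP[h1 h2] := vM x Ox.
    by apply: ge0_ler_powR; rewrite ?nnegrE ?(ltW n0)//; exact: le_trans h2.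
  rewrite Rintegral_cst// [X in fine X]mu_Omega mulr1.
  have p0 : 0 <= M `^ n by exact: powR_ge0.
  have A0 : 0 <= \int[mu]_(x in Omega) `|u x `^ n * Iu x| by apply: Rintegral_ge0.
  by move: (\int[mu]_(x in Omega) `|_|) (M `^ n) A0 p0 => a b a0 b0; nra.
Qed.

End GoodSlices.

(** * The conservation law *)

Section Assembly.
Context {R : realType}.
Local Notation mu := (@lebesgue_measure R).
Implicit Types (F u v ux Iu g J : R -> R -> R).

(** Choosing a representative at each time separately could destroy joint measurability. The
    coefficients are measurable in [t] by Fubini, so the series is a limit of jointly measurable
    sums. *)
Lemma joint_representative (T : R) (P : set R) u : measurable2 (cyl T) u ->
  measurable P -> P `<=` `]0, T[ ->
  (forall t, P t -> exists B, abs_bounded (coef (u t)) 0 B) ->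
  exists v : R -> R -> R, [/\ measurable2 setT v,
    (forall t, P t -> v t = cosine_series (coef (u t))) &
    forall t x, ~ P t -> v t x = 0].
Proof.
move=> mu_ mP PT HB.
pose U t x := ((fun p => u p.1 p.2) \_ (cyl T)) (t, x).
have mU : measurable_fun setT (fun p : R * R => U p.1 p.2).
  have -> : (fun p : R * R => U p.1 p.2) = (fun p => u p.1 p.2) \_ (cyl T).
    by apply/funext => -[t x].
  by apply: (measurable_restrictT _ _).1 => //; exact: measurable_cyl.
pose c k t := \int[mu]_x (U t x * eigfun k x).
have mc k : measurable_fun setT (c k).
  apply: measurable_Rintegral_slice; apply: measurable_funM => //.
  by apply: measurable_fun_snd; exact: measurable_eigfun.
have cE t k : P t -> c k t = coef (u t) k.
  move=> Pt; rewrite /coef [RHS]Rintegral_mkcond; apply: eq_Rintegral => x _.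
  rewrite /U patch_slice mem_set; last exact: PT.
  by rewrite !patchE; case: ifPn => //; rewrite mul0r.
(* The indicator removes the times outside P, so that the series converges at every time. *)
pose b t k := c k t * \1_P t.
have bB t : exists B, abs_bounded (b t) 0 B.
  have [Pt|nPt] := pselect (P t).
    have [B HB'] := HB t Pt; exists B => N; rewrite /b indicE mem_set//.
    apply: le_trans (HB' N); apply: ler_sum => k _.
    by rewrite mulr1 cE.
  exists 0 => N; rewrite big1// => k _.
  by rewrite /b indicE memNset// mulr0 normr0 mul0r.
exists (fun t x => cosine_series (b t) x); split.
- apply: (@measurable_fun_cvg _ _ _ _ (fun N p => \sum_(k < N) b p.1 k * eigfun k p.2)).
    move=> N; apply: measurable_sum => k; apply: measurable_funM.
      apply: (@measurable_fun_fst R setT (fun t => b t k)); exact: measurable_funM.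
    by apply: (@measurable_fun_snd R setT (eigfun k)); exact: measurable_eigfun.
  by move=> p _; have [B HB'] := bB p.1; exact: cosine_series_cvg HB'.
- move=> t Pt; congr cosine_series; apply/funext => k.
  by rewrite /b indicE mem_set// mulr1 cE.
- move=> t x nPt; rewrite /cosine_series (_ : (fun N => _) = fun=> 0) ?lim_cst//.
  apply/funext => N; rewrite big1// => k _.
  by rewrite /b indicE memNset// mulr0 mul0r.
Qed.

Lemma hdot2_ge0 (s : R) (w : R -> R) : (0 <= hdot2 s w)%E.
Proof.
by apply: nneseries_ge0 => k _ _; rewrite lee_fin mulr_ge0 ?sqr_ge0 ?powR_ge0.
Qed.

Lemma ae_eq_RintegralDN (D : set R) (f g h : R -> R) : measurable D ->
  mu.-integrable D (EFin \o f) -> mu.-integrable D (EFin \o g) ->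
  mu.-integrable D (EFin \o h) -> {ae mu, forall t, D t -> f t + g t = - h t} ->
  \int[mu]_(t in D) f t + \int[mu]_(t in D) g t = - \int[mu]_(t in D) h t.
Proof.
move=> mD fi gi hi E; rewrite -RintegralD// -[RHS]mulN1r -RintegralZl//.
apply: ae_eq_Rintegral => //.
- by apply: measurable_funD; [exact: integrable_measurableR fi|exact: integrable_measurableR gi].
- by apply: measurable_funM => //; exact: integrable_measurableR hi.
- by apply: ae_mono E => t H Dt; rewrite mulN1r H.
Qed.

(** The slice identity is applied with psi = phi_x, and Fubini sums it over time; the slice terms B
    and C are those of the weak formulation. *)
Lemma conservation_law_of_flux (T n : R) (u0 : R -> R) u ux Iu J : 0 < T ->
  weak_formulation T n u0 u ux Iu ->
  locally_integrable2 (cyl T) u -> locally_integrable2 (cyl T) J ->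
  ae_time T (fun t => forall (a b : R) (psi dpsi : R -> R), 0 < a -> a <= b -> b < 1 ->
    (forall x : R, is_derive x 1 psi (dpsi x)) -> continuous dpsi ->
    (forall x, Omega x -> ~~ (a < x < b) -> psi x = 0 /\ dpsi x = 0) ->
    let B x := n * u t x `^ (n - 1) * ux t x * Iu t x * psi x in
    let C x := u t x `^ n * Iu t x * dpsi x in
    mu.-integrable Omega (EFin \o B) -> mu.-integrable Omega (EFin \o C) ->
    mu.-integrable Omega (EFin \o (fun x => J t x * psi x)) ->
    \int[mu]_(x in Omega) B x + \int[mu]_(x in Omega) C x =
    - \int[mu]_(x in Omega) (J t x * psi x)) ->
  conservation_law T u J.
Proof.
have alg (w x y z : R) : w - x - y = 0 -> x + y = - z -> w + z = 0 by lra.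
move=> T0 wf lu lJ slice; split=> // phi tphi.
have [tphi0 bc init] := test2_cyl0 T0 tphi.
have sphi := tphi.1.
have [_ iB iC] := wf phi tphi0 bc; set A := fun t x => u t x * Dt phi t x.
rewrite -/A; set B := fun t x => _ * Dx phi t x in iB *; set C := fun t x => _ * _ in iC *.
have -> : \int[mu]_(x in Omega) (u0 x * phi 0 x) = 0.
  transitivity (\int[mu]_(x in Omega) (0 : R)).
    by apply: eq_Rintegral => x /set_mem Ox; rewrite init// mulr0.
  by rewrite Rintegral_cst ?mul0r//; exact: measurable_Omega.
have [a [b [c [d [a0 ab bT [c0 cd d1 supp]]]]]] := test2_rect T0 tphi.
have Dx0 (t x : R) : 0 < t < T -> 0 < x < 1 -> ~~ ((a <= t <= b) && (c <= x <= d)) ->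
    exists p q, p < x < q /\ forall y, p < y < q -> phi t y = 0.
  move=> tT x01 h; have [tab|tab] := boolP (a <= t <= b); last first.
    by exists 0, 1; split => // y y01; apply: supp => //; rewrite negb_and tab.
  move: h; rewrite tab/= negb_and -!ltNge => /orP[xc|dx].
    exists 0, c; split; first by case/andP: x01 => ->.
    move=> y /andP[y0 yc]; apply: supp => //; first by rewrite y0/=; lra.
    by apply/negP => /andP[_ /andP[h1 h2]]; lra.
  exists d, 1; split; first by rewrite dx; case/andP: x01.
  move=> y /andP[dy y1]; apply: supp => //; first by rewrite y1 andbT; lra.
  by apply/negP => /andP[_ /andP[h1 h2]]; lra.
have D0 (t x : R) : 0 < t < T -> 0 < x < 1 -> ~~ ((a <= t <= b) && (c <= x <= d)) ->
    Dx phi t x = 0 /\ Dx (Dx phi) t x = 0.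
  move=> tT x01 h; have [p [q [pxq Hpq]]] := Dx0 t x tT x01 h.
  split; first exact: derive1_local_zero pxq Hpq.
  apply: (derive1_local_zero pxq) => y ypq; exact: derive1_local_zero ypq Hpq.
(* The slice identity requires vanishing outside an open interval, endpoints included, hence the
   margin around [c, d]. *)
have [c2 cd2 d2] : [/\ 0 < c / 2, c / 2 <= (1 + d) / 2 & (1 + d) / 2 < 1] by split; lra.
have Dsupp (t x : R) : 0 < t < T -> 0 < x < 1 -> ~~ (c / 2 < x < (1 + d) / 2) ->
    Dx phi t x = 0 /\ Dx (Dx phi) t x = 0.
  move=> tT x01 h; apply: D0 => //.
  by apply: contra h => /andP[_ /andP[h1 h2]]; apply/andP; split; lra.
have mO := @measurable_Omega R.
have mT : measurable (`]0, T[%classic : set R) by exact: measurable_itv.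
have mR := @measurable_rectangle R a b c d.
have iJ : integrable2 (cyl T) (fun t x => J t x * Dx phi t x).
  apply: (@integrable2_supp R _ (`[a, b]%classic `*` `[c, d]%classic)) => //.
  - exact: measurable_cyl.
  - exact: rectangle_sub_cyl.
  - move=> t x [/= t1 Ox] nx.
    have x01 : 0 < x < 1 by rewrite -OmegaP.
    have tT : 0 < t < T by move: t1; rewrite in_itv.
    have [|-> _] := D0 t x tT x01; last by rewrite mulr0.
    by apply/negP => /andP[h1 h2]; apply: nx; split; rewrite /= in_itv.
  - have cD := smooth2_continuous (s := [:: false]) sphi.
    have [M HM] := compact_bound cD (@rectangle_compact R a b c d).
    apply: (@integrableRM_bounded _ _ _ (leb2 R) _ _ (fun p => Dx phi p.1 p.2) M) => //.
    + by apply: measurable_funTS; exact: continuous_measurable_plane.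
    + have [_ H] := lJ; apply: H; first exact: rectangle_compact.
      exact: rectangle_sub_cyl.
have [fB eB] := Rint2_fubini mT mO iB.
have [fC eC] := Rint2_fubini mT mO iC.
have [fJ eJ] := Rint2_fubini mT mO iJ.
have BCJ : Rint2 (cyl T) B + Rint2 (cyl T) C = - Rint2 (cyl T) (fun t x => J t x * Dx phi t x).
  rewrite eB eC eJ; apply: (ae_eq_RintegralDN mT fB fC fJ).
  have sB := ae_integrable_slice mT mO iB.
  have sC := ae_integrable_slice mT mO iC.
  have sJ := ae_integrable_slice mT mO iJ.
  apply: ae_mono (ae_and slice (ae_and sB (ae_and sC sJ))) => t [H [tB [tC tJ]]] Tt.
  have tT : 0 < t < T by move: Tt; rewrite /= in_itv.
  apply: (H tT (c / 2) ((1 + d) / 2) (Dx phi t) (Dx (Dx phi) t)).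
  - exact: c2.
  - exact: cd2.
  - exact: d2.
  - by move=> x; have := @smooth2_is_derive_x R phi [:: false] t x sphi.
  - by move=> x; have := @smooth2_continuous_x R phi [:: false; false] t x sphi.
  - by move=> x; rewrite OmegaP => x01 h; exact: Dsupp.
  - exact: tB.
  - exact: tC.
  - exact: tJ.
by rewrite oppr0 => E; exact: alg E BCJ.
Qed.

Lemma locally_integrable2_slab (T : R) F : 0 < T -> measurable2 (cyl T) F ->
  (forall c d, 0 < c -> c <= d -> d < T -> integrable2 (`[c, d]%classic `*` Omega) F) ->
  locally_integrable2 (cyl T) F.
Proof.
move=> T0 mF H; split=> // K cK KT.
have cfst : continuous (@fst R R) by move=> p; exact: cvg_fst.
have [|a [b [a0 ab bT Kab]]] := @compact_sub_itv R _ K fst 0 T cfst cK T0.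
  by move=> z /KT[]; rewrite /= in_itv.
apply: (integrable2S _ _ _ (H a b a0 ab bT)); first exact: measurable_itvOmega.
  exact: compact_measurable_plane.
by move=> z Kz; split; [rewrite /= in_itv; exact: Kab|have [_] := KT z Kz].
Qed.

(** For v > 0 the flux is g v^(n/2), and a product is at most the sum of the squares. The case v = 0
    is included because the joint representative is 0 at exceptional times. *)
Lemma flux_bound (n v g : R) : 0 < n -> 0 <= v ->
  `|v `^ n * (g * v `^ (- (n / 2)))| <= v `^ n + g ^+ 2.
Proof.
move=> n0; rewrite le_eqVlt => /predU1P[<-|v0].
  by rewrite powR0 ?gt_eqF// !mul0r normr0 add0r sqr_ge0.
have -> : v `^ n * (g * v `^ (- (n / 2))) = g * v `^ (n / 2).
  by rewrite mulrCA powR_pow//; congr (_ * _ `^ _); field.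
have -> : v `^ n = v `^ (n / 2) ^+ 2.
  by rewrite expr2 powR_pow//; congr (_ `^ _); field.
rewrite normrM -(real_normK (num_real (v `^ _))) -(real_normK (num_real g)).
by move: `|g| `|v `^ _| (normr_ge0 g) (normr_ge0 (v `^ (n / 2))) => a b a0 b0; nra.
Qed.

Lemma constructed_good_slices (T al n : R) (u0 : R -> R) u ux Iu g :
  0 < al < 2 -> 2 < n -> (\int[mu]_(x in Omega) G n (u0 x) < +oo)%E ->
  Linf_HsN T (al / 2) u -> L2_HsN T (al / 2 + 1) u ->
  {ae leb2 R, forall p, cyl T p -> 0 <= u p.1 p.2} ->
  is_dx T u ux -> is_I T al u Iu -> same_mass T u0 u -> dissipation T n u ux Iu g ->
  ae_time T (fun t =>
    ((\int[mu]_(x in Omega) G n (u t x)) +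
     \int[mu]_(s in `]0%R, t[) hdot2 (al / 2 + 1) (u s)
     <= \int[mu]_(x in Omega) G n (u0 x))%E) ->
  exists C0, ae_time T (fun t => good_slice al n (\int[mu]_(x in Omega) u0 x) C0
    (u t) (ux t) (Iu t) (g t)).
Proof.
move=> al02 n2 Gu0 [_ _ [C0 hC]] [_ hs _] u0_ [_ du] [_ fI] um dis ent.
have [mg fg lV lW _] := dis; exists C0.
have h1 := ae_time_and hs (ae_time_and hC (ae_time_and (@ae_of_ae_cyl R T (fun t x => 0 <= u t x) u0_) (ae_time_and du fI))).
have h2 := ae_time_and um (ae_time_and ent (ae_slice_L2 mg fg)).
have h3 := ae_time_and (ae_slice_locally_integrable lV)
  (ae_time_and (ae_slice_locally_integrable lW) (dissipation_slices dis)).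
apply: ae_time_mono (ae_time_and h1 (ae_time_and h2 h3)).
move=> t _ [[k1 [k2 [k3 [k4 k5]]]] [[k6 [k7 k8]] [k9 [k10 k11]]]].
split; first by split.
split; last by split.
split=> //; apply: le_lt_trans Gu0; apply: le_trans k7.
by apply: leeDl; apply: integral_ge0 => s _; exact: hdot2_ge0.
Qed.

End Assembly.

Theorem theorem1p3 (R : realType) (T alpha n : R) (u0 : R -> R)
    (u : R -> R -> R)
    (hT : 0 < T)
    (halpha : 0 < alpha < 2)
    (hn : 2 + 2 / (alpha + 1) < n)
    (hu0 : HsN (alpha / 2) u0)
    (hu0_ge0 : {ae leb R, forall x, Omega x -> 0 <= u0 x})
    (hu0_G : (\int[leb R]_(x in Omega) G n (u0 x) < +oo)%E)
    (hu : constructed_solution T alpha n u0 u) :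
  exists (P : set R) (v J : R -> R -> R),
    [/\ P `<=` `]0%R, T[,
        (leb R).-negligible (`]0%R, T[ `\` P),
        (* v t is the continuous representative of u(t, .) *)
        (forall t, P t ->
          [/\ {ae leb R, forall x, Omega x -> v t x = u t x},
              (forall beta, 0 < beta -> beta < Num.min 1 ((alpha + 1) / 2) ->
                Holder beta (v t)) &
              forall x, Omega x -> 0 < v t x]),
        (* J(t, .) = u^n d_x I(u) belongs to L^1(Omega) *)
        (forall t, P t ->
          (leb R).-integrable Omega (EFin \o J t) /\
          exists Iv dIv : R -> R,
            [/\ fracI alpha (v t) Iv, weak_deriv Iv dIv &
                forall x, Omega x -> J t x = v t x `^ n * dIv x]) &
        conservation_law T u J].
Proof.
move: hu => [[hLinf hL2] u_ge0 _ [ux [Iu [g [[hux hIu] wf um [dis _] ent]]]]].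
have /andP[al0 al2] := halpha.
have n2 : 2 < n by apply: lt_trans hn; rewrite ltrDl divr_gt0//; lra.
have s1 : 1 < 2 * (alpha / 2 + 1) by lra.
have mO := @measurable_Omega R.
have [C0 [N [mN N0 HN]]] := constructed_good_slices halpha n2 hu0_G hLinf hL2 u_ge0 hux hIu um dis ent.
(* A measurable null set is removed, so that P is measurable, as the joint representative
   requires. *)
pose P : set R := `]0, T[%classic `\` N.
have mP : measurable P by apply: measurableD => //; exact: measurable_itv.
have PT : P `<=` `]0, T[ by move=> t [].
have gs t : P t -> good_slice alpha n (\int[leb R]_(x in Omega) u0 x) C0 (u t) (ux t) (Iu t) (g t).
  move=> [tT nt]; apply: contrapT => H; apply: nt; apply: HN => /= K; apply: H; apply: K.
  by move: tT; rewrite /= in_itv.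
have aeP (Q : R -> Prop) : (forall t, P t -> Q t) -> {ae leb R, forall t, 0 < t < T -> Q t}.
  move=> PQ; exists N; split => // t /= H; apply: contrapT => nt; apply: H => tT.
  by apply: PQ; split => //=; rewrite in_itv.
have mu_ : measurable2 (cyl T) u by case: hL2.
have mI : measurable2 (cyl T) Iu by case: hIu.
have [mg fg _ _ _] := dis.
have hsP t : P t -> HsN (alpha / 2 + 1) (u t) by move=> /gs[[]].
have [|v [mv vP vN]] := joint_representative mu_ mP PT.
  by move=> t /hsP hs; apply: (HsN_abs_bounded hs (lexx 0)); rewrite mulr0 add0r.
have v_gt0 t x : P t -> Omega x -> 0 < v t x.
  move=> Pt Ox; rewrite vP//; have [[hs _ u0' _ _] [[_ Gu _] _]] := gs t Pt.
  exact: HsN_positive halpha hn hs u0' Gu x Ox.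
have v_ge0 t x : Omega x -> 0 <= v t x.
  move=> Ox; have [Pt|nPt] := pselect (P t); first by rewrite ltW// v_gt0.
  by rewrite vN.
have n0 : 0 < n by exact: lt_trans n2.
have m0 : 0 <= \int[leb R]_(x in Omega) u0 x.
  have mu0 : measurable_fun Omega u0 by case: hu0 => -[[]].
  rewrite (_ : Rintegral _ _ _ = \int[leb R]_(x in Omega) `|u0 x|).
    by apply: Rintegral_ge0.
  apply: ae_eq_Rintegral => //; first exact: measurableT_comp.
  by apply: ae_mono hu0_ge0 => x H Ox; rewrite ger0_norm ?H.
(* On each slice int v^n is at most K (1 + int |u^n I(u)|) with one K for all times; the right side
   is integrable in time by the weak formulation, and Tonelli concludes. *)
have ivn c d : 0 < c -> c <= d -> d < T ->
    integrable2 (`[c, d]%classic `*` Omega) (fun t x => v t x `^ n).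
  move=> c0 cd dT; have [K K0 HK] := good_slice_power C0 halpha hn m0.
  have mcd : measurable (`[c, d]%classic : set R) by exact: measurable_itv.
  have iF := weak_formulation_integrable_flux mu_ mI wf c0 cd dT.
  have iF' : integrable2 (`[c, d]%classic `*` Omega) (fun t x => `|u t x `^ n * Iu t x|).
    by move/integrable_norm: iF.
  have [ih _] := Rint2_fubini mcd mO iF'.
  have ic : (leb R).-integrable `[c, d] (EFin \o (fun=> 1 : R)).
    by apply: continuous_compact_integrable; [exact: segment_compact|exact: continuous_subspaceT (fun _ => cvg_cst _)].
  have iK : (leb R).-integrable `[c, d] (EFin \o (fun t =>
      K * (1 + \int[leb R]_(x in Omega) `|u t x `^ n * Iu t x|))).
    by apply: integrableRZl => //; exact: integrableRD.
  apply: (integrable2_tonelli mcd mO _ _ _ iK).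
  - exact: measurable2S (measurable2_powR n mv).
  - by move=> t x _ _; exact: powR_ge0.
  - have := aeP (fun t => ((\int[leb R]_(x in Omega) (v t x `^ n)%:E) <=
      (K * (1 + \int[leb R]_(x in Omega) `|u t x `^ n * Iu t x|))%:E)%E).
    move=> /(_ (fun t Pt => ltac:(by rewrite vP//; exact: HK (gs t Pt)))).
    by apply: ae_mono => t H /=; rewrite in_itv/= => /andP[ct td]; apply: H; lra.
(* The second factor stands for d_x I(u). Off P the representative is 0, hence so is J, as n > 0. *)
pose J t x := v t x `^ n * (g t x * v t x `^ (- (n / 2))).
exists P, v, J; split => //.
- by exists N; split => // t [tT nP]; apply: contrapT => nt; exact: nP.
- move=> t Pt; have hs := hsP t Pt; have [uv _] := HsN_series hs s1; rewrite vP//; split.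
  + by apply: ae_mono uv => x H Ox; rewrite H.
  + move=> beta b0; rewrite lt_min => /andP[b1 b2].
    have [||C HC] := @HsN_holder R _ beta _ hs; [by rewrite !ltW|lra|].
    by exists C.
  + by move=> x Ox; rewrite -vP// v_gt0.
- move=> t Pt; have [_ iJ fv wd] := good_slice_flux halpha hn (gs t Pt).
  rewrite /J vP//; split; first exact: iJ.
  by exists (Iu t), (fun x => g t x * cosine_series (coef (u t)) x `^ (- (n / 2))).
- have lu : locally_integrable2 (cyl T) u.
    apply: locally_integrable2_slab => // c d c0 cd dT.
    exact: weak_formulation_integrable_u wf c0 cd dT.
  have lJ : locally_integrable2 (cyl T) J.
    apply: locally_integrable2_slab => // [|c d c0 cd dT].
      apply: measurable_funM; first exact: measurable2S (measurable2_powR n mv).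
      by apply: measurable_funM => //; exact: measurable2S (measurable2_powR _ mv).
    have mS := @measurable_itvOmega R c d.
    have sub := sub_itvOmega_cyl c0 dT.
    have ig2 : integrable2 (`[c, d]%classic `*` Omega) (fun t x => g t x ^+ 2).
      exact: integrable2S (measurable_cyl T) mS sub (sqr_integrable2 (measurable_cyl T) mg fg).
    have mJ : measurable2 (`[c, d]%classic `*` Omega) J.
      apply: measurable_funM; first exact: measurable2S (measurable2_powR n mv).
      apply: measurable_funM; first exact: measurable2S (measurable_cyl T) sub mg.
      exact: measurable2S (measurable2_powR _ mv).
    have iS : (leb2 R).-integrable (`[c, d]%classic `*` Omega)
        (EFin \o (fun p => v p.1 p.2 `^ n + g p.1 p.2 ^+ 2)).
      by apply: integrableRD => //; exact: ivn.
    apply: (le_integrableR _ _ _ iS) => //.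
    move=> [t x] [/= _ Ox]; apply: flux_bound => //; exact: v_ge0.
  apply: (conservation_law_of_flux hT wf lu lJ); apply: aeP => t Pt a b psi dpsi a0 ab b1 dp cp supp.
  move=> B C iB iC iJ.
  have [pv [It [pI II]]] := good_slice_primitives halpha hn (gs t Pt).
  have [uv mvt] := HsN_series (hsP t Pt) s1.
  move: iJ; rewrite /J (vP t Pt) => iJ.
  apply: (flux_identity a0 ab b1 mvt uv _ pv pI II dp cp supp iB iC iJ).
  by move=> x x01; rewrite -vP// v_gt0// OmegaP.
Qed.
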